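(* Let $K\in\mathcal K^2$, and let $A=RB^2$ with some $R>0$ be such that $K\subseteq A$. Let $f$ be a density with respect to $\nu_1^2$ on $\mathcal L_1^2$ which is non-zero $\nu_1^2$-almost everywhere. Let $E_1,E_2$ and $E_3$ be independent isotropic uniform random (IUR) lines in $\mathbb R^2$ hitting $A$. Then $$\mathrm{Var}\Big(\frac13\sum_{k=1}^3\hat\varphi_{ij}(K\cap E_k)\Big)<\mathrm{Var}_f\Big(\frac{\hat\varphi_{ij}(K\cap E)}{f(\pi(E))}\Big)$$ for $i,j\in\{1,2\}$, where on the right-hand side $E$ is an $f$-weighted random line in $\mathbb R^2$ hitting $A$.
   Context: $\mathcal K^2$ is the set of convex bodies, that is, compact convex subsets, of $\mathbb R^2$; $B^2$ is the closed unit disc centred at the origin. $\mathcal L^2_1$ is the set of lines through the origin in $\mathbb R^2$ and $\nu_1^2$ its rotation invariant probability measure. $\mathcal E_1^2$ is the set of affine lines in $\mathbb R^2$, $\mathcal B(\mathcal E_1^2)$ its Borel $\sigma$-algebra, and $\mu_1^2$ the motion invariant measure on it normalized by $\mu_1^2(\{E:E\cap B^2\neq\emptyset\})=2$. $\pi(E)\in\mathcal L_1^2$ is the line through the origin parallel to $E$. $V_0(M)=1$ if $M$ is a non-empty convex body and $V_0(\emptyset)=0$. For $u=(u_1,u_2)$ in the unit circle $S^1$ with linear span $[u]$, the symmetric matrix $(g_{ij}([u]))$ is given by $$g_{11}([u])=\tfrac38\big(u_1^2-\tfrac13\big),\quad g_{12}([u])=g_{21}([u])=\tfrac38u_1u_2,\quad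 g_{22}([u])=\tfrac38\big(u_2^2-\tfrac13\big),$$ and $\hat\varphi_{ij}(K\cap E):=2R\,g_{ij}(\pi(E))\,V_0(K\cap E)$. For a density $f:\mathcal L_1^2\to[0,\infty)$ with respect to $\nu_1^2$, an $f$-weighted random line $E$ in $\mathbb R^2$ hitting $A$ is a random line with distribution $$P(E\in\mathcal A)=\frac1{2R}\int_{\mathcal A}\mathbf 1(E'\cap A\ne\emptyset)\,f(\pi(E'))\,\mu_1^2(dE'),\qquad\mathcal A\in\mathcal B(\mathcal E_1^2).$$ An IUR line hitting $A$ is an $f$-weighted random line hitting $A$ with $f\equiv1$. $\mathrm{Var}_f$ denotes the variance when $E$ is an $f$-weighted random line hitting $A$.
   Formalization: K is additionally assumed to contain two distinct points; for K empty or a single point, almost no line hits K, both variances are 0 and the strict inequality fails. *)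

(* Defs.v *)
From HB Require Import structures.
From mathcomp Require Import all_boot all_order all_algebra.
From mathcomp Require Import all_classical all_reals all_analysis.
From mathcomp Require Import ring lra.

Set Implicit Arguments.
Unset Strict Implicit.
Unset Printing Implicit Defensive.

Import Order.TTheory GRing.Theory Num.Theory.
Import numFieldNormedType.Exports.

Local Open Scope classical_set_scope.
Local Open Scope ring_scope.

(* Points of the plane are row vectors. The library norm of 'rV[R]_2 is the
   max-norm, so Euclidean lengths go through [sqnorm]; the two norms induce the
   same topology, hence the same compact sets. *)
Notation plane R := 'rV[R]_2.

Section geometry.
Context {R : realType}.
Implicit Types (x u v : plane R) (t theta r : R).

Definition sqnorm x : R := \sum_(i < 2) x ord0 i ^+ 2.

Definition disc r : set (plane R) := [set x | sqnorm x <= r ^+ 2].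

Definition aline x u : set (plane R) := [set x + t *: u | t in [set: R]].

Definition unit_dir theta : plane R :=
  \row_(i < 2) (if i == ord0 then cos theta else sin theta).

Lemma sqnormE x : sqnorm x = x ord0 ord0 ^+ 2 + x ord0 ord_max ^+ 2.
Proof.
rewrite /sqnorm big_ord_recl big_ord1; congr (_ + x _ _ ^+ 2); exact: val_inj.
Qed.

Lemma sqnorm_unit_dir theta : sqnorm (unit_dir theta) = 1.
Proof. by rewrite sqnormE !mxE /= cos2Dsin2. Qed.

Lemma aline_diff x u :
  [set y - z | y in aline x u & z in aline x u] = aline 0 u.
Proof.
apply/seteqP; split => [_ [_ [s _ <-]] [_ [t _ <-] <-]|_ [t _ <-]].
  exists (s - t) => //.
  by rewrite add0r scalerBl opprD addrACA subrr add0r.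
exists (x + t *: u); first by exists t.
exists (x + 0 *: u); first by exists 0.
by rewrite scale0r addr0 addrAC subrr.
Qed.

Lemma aline0_unit_inj u v : sqnorm u = 1 -> sqnorm v = 1 ->
  aline 0 u = aline 0 v -> u = v \/ u = - v.
Proof.
move=> u1 v1 uv.
have [t _ tu] : aline 0 v u by rewrite -uv; exists 1; rewrite // add0r scale1r.
move: tu; rewrite add0r => tu.
have t2 : t ^+ 2 = 1.
  rewrite -u1 -tu sqnormE !mxE !exprMn -mulrDr -sqnormE v1; ring.
have /orP[/eqP t1|/eqP t1] : (t == 1) || (t == -1) by rewrite -sqrf_eq1 t2.
- by left; rewrite -tu t1 scale1r.
- by right; rewrite -tu t1 scaleN1r.
Qed.

Definition rotation (M : 'M[R]_2) : Prop := M *m M^T = 1%:M /\ \det M = 1.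

Definition motion (M : 'M[R]_2) v x : plane R := x *m M + v.

End geometry.

(* The lines through the origin and the affine lines, as types of subsets of
   the plane. *)
Record linear_line (R : realType) := LinearLine {
  linear_line_set :> set (plane R);
  linear_lineP : exists2 u, sqnorm u = 1 & linear_line_set = aline 0 u }.

Record affine_line (R : realType) := AffineLine {
  affine_line_set :> set (plane R);
  affine_lineP :
    exists x, exists2 u, sqnorm u = 1 & affine_line_set = aline x u }.

Section lines.
Context {R : realType}.

Lemma linear_line_eq (L L' : linear_line R) : L = L' :> set _ -> L = L'.
Proof.
case: L L' => [L hL] [L' hL'] /= LL'; subst L'.
by rewrite (Prop_irrelevance hL hL').
Qed.

Lemma affine_line_eq (E E' : affine_line R) : E = E' :> set _ -> E = E'.
Proof.
case: E E' => [E hE] [E' hE'] /= EE'; subst E'.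
by rewrite (Prop_irrelevance hE hE').
Qed.

Definition linear_line_at (theta : R) : linear_line R :=
  LinearLine (ex_intro2 _ _ (unit_dir theta) (sqnorm_unit_dir theta) erefl).

(* p = (theta, t): the line of direction theta at signed distance t from the
   origin. *)
Definition affine_line_at (p : R * R) : affine_line R :=
  AffineLine (ex_intro _ (p.2 *: unit_dir (p.1 + pi / 2))
    (ex_intro2 _ _ (unit_dir p.1) (sqnorm_unit_dir p.1) erefl)).

Lemma parallel_subproof (E : affine_line R) :
  exists2 u, sqnorm u = 1 & [set y - z | y in (E : set _) & z in (E : set _)]
                            = aline 0 u.
Proof.
by have [x [u u1 ->]] := affine_lineP E; exists u; rewrite // aline_diff.
Qed.

(* pi(E), the linear line parallel to E, as the difference set E - E. *)
Definition parallel (E : affine_line R) : linear_line R :=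
  LinearLine (parallel_subproof E).

(* The usual topologies on the spaces of lines are the final ones for the
   parametrizations by SO(2) and SO(2) x R; as theta |-> (rotation by theta)
   is a continuous open surjection of R onto SO(2), they are also the final
   ones for the parametrizations by angles. *)
Definition open_linear_lines : set (set (linear_line R)) :=
  [set O | open (linear_line_at @^-1` O)].

Definition open_affine_lines : set (set (affine_line R)) :=
  [set O | open (affine_line_at @^-1` O)].

End lines.

HB.instance Definition _ (R : realType) := gen_eqMixin (linear_line R).
HB.instance Definition _ (R : realType) := gen_choiceMixin (linear_line R).
HB.instance Definition _ (R : realType) :=
  isPointed.Build (linear_line R) (linear_line_at 0).
HB.instance Definition _ (R : realType) := gen_eqMixin (affine_line R).
HB.instance Definition _ (R : realType) := gen_choiceMixin (affine_line R).
HB.instance Definition _ (R : realType) :=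
  isPointed.Build (affine_line R) (affine_line_at (0, 0)).

(* The measurable spaces of lines with their Borel sigma-algebras. *)
Notation linear_lines R := (g_sigma_algebraType (@open_linear_lines R)).
Notation affine_lines R := (g_sigma_algebraType (@open_affine_lines R)).

Section measures.
Context {R : realType}.
Local Open Scope ereal_scope.

(* The set on the left-hand side is the image of B under the rotation M. *)
Definition rotation_invariant (nu : set (linear_lines R) -> \bar R) : Prop :=
  forall M : 'M[R]_2, rotation M ->
  forall B : set (linear_lines R), measurable B ->
    nu [set L : linear_line R | exists2 L' : linear_line R,
          B L' & L = motion M 0 @` L' :> set _] = nu B.

Definition motion_invariant (mu : set (affine_lines R) -> \bar R) : Prop :=
  forall (M : 'M[R]_2) (v : plane R), rotation M ->
  forall B : set (affine_lines R), measurable B ->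
    mu [set E : affine_line R | exists2 E' : affine_line R,
          B E' & E = motion M v @` E' :> set _] = mu B.

Definition hitting (A : set (plane R)) : set (affine_line R) :=
  [set E : affine_line R | E `&` A !=set0].

(* f is a probability density with respect to nu, with values in [0, +oo[. *)
Definition is_density (nu : {measure set (linear_lines R) -> \bar R})
    (f : linear_lines R -> R) : Prop :=
  [/\ measurable_fun [set: linear_lines R] f,
      forall L, (0 <= f L)%R
    & \int[nu]_L (f L)%:E = 1].

(* E is an f-weighted random line hitting disc r. *)
Definition weighted_random_line
    (mu : {measure set (affine_lines R) -> \bar R}) (r : R)
    (f : linear_lines R -> R)
    (d : measure_display) (T : measurableType d) (P : probability T R)
    (E : {mfun T >-> affine_lines R}) : Prop :=
  forall B : set (affine_lines R), measurable B ->
    P (E @^-1` B) = (2 * r)^-1%:E *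
      \int[mu]_(E' in B) (\1_(hitting (disc r)) E' * f (parallel E'))%:E.

Definition IUR_line (mu : {measure set (affine_lines R) -> \bar R}) (r : R)
    (d : measure_display) (T : measurableType d) (P : probability T R)
    (E : {mfun T >-> affine_lines R}) : Prop :=
  weighted_random_line mu r (fun=> 1%R) P E.

(* Taking B k = setT for some k gives the product rule for subfamilies. *)
Definition independent (n : nat) (d d' : measure_display)
    (T : measurableType d) (T' : measurableType d') (P : probability T R)
    (X : 'I_n -> {mfun T >-> T'}) : Prop :=
  forall B : 'I_n -> set T', (forall k, measurable (B k)) ->
    P [set w | forall k, B k (X k w)] = \prod_(k < n) P (X k @^-1` B k).

End measures.

Section estimator.
Context {R : realType}.

(* g_ij([u]) for a unit vector u; by [g_ijE] below the choice of u in its span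
   does not matter. *)
Definition g_ij (L : linear_line R) (i j : 'I_2) : R :=
  let u := s2val (cid2 (linear_lineP L)) in
  3 / 8 * (u ord0 i * u ord0 j - (i == j)%:R / 3).

Lemma g_ijE (L : linear_line R) (u : plane R) (i j : 'I_2) :
  sqnorm u = 1 -> L = aline 0 u :> set _ ->
  g_ij L i j = 3 / 8 * (u ord0 i * u ord0 j - (i == j)%:R / 3).
Proof.
move=> u1 Lu; rewrite /g_ij; case: cid2 => v v1 Lv /=.
have [->//|->] := aline0_unit_inj v1 u1 (etrans (esym Lv) Lu).
by rewrite !mxE mulrNN.
Qed.

Definition V0 (M : set (plane R)) : R := (`[< M !=set0 >])%:R.

Definition phi_hat (r : R) (K : set (plane R)) (i j : 'I_2)
    (E : affine_line R) : R :=
  2 * r * g_ij (parallel E) i j * V0 (K `&` E).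

End estimator.

(* Main.v *)
(* In the direction t of a random line, g_ij is 3/8 h(t) with
   h(t) = d + cos(2(t - eta))/2 and d = 1/6 (i = j) or d = 0 (i <> j).
   Invariance and Tonelli over translates give the law of the direction and the
   conditional hitting probability q(t), the width of K divided by 2R. After
   scaling by (2R * 3/8)^2 / pi, the claim reads, over [0, pi],
     int h^2 q / f  >  1/3 int h^2 q + 2/(3 pi) (int h q)^2.

   The function h changes sign once on each half period. Comparing q there
   with a sine interpolating it gives |int h q| <= 2 (d + 1/6) max q, and a bound
   by q(eta) alone when d = 1/6. For the left side, Cauchy-Schwarz gives
   h^2 q / f >= 2 c |h| sqrt q - c^2 f for every c > 0, and for suitable c the
   function 2 c |h| sqrt q - h^2 q / 3 increases with q, so q may be replaced by
   the width rho |sin(t - al)| of a segment in K. Bounding |h| below by a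
   trigonometric polynomial reduces the integrals to the moments of sqrt |sin|
   and |sin| against cosines, which satisfy two-term recurrences, and the claim
   to polynomial inequalities in cos(2(al - eta)). *)
Require Import Defs.
From HB Require Import structures.
From mathcomp Require Import all_boot all_order all_algebra.
From mathcomp Require Import all_classical all_reals all_analysis.
From mathcomp Require Import interval_inference measurable_realfun ring lra.
Set Implicit Arguments.
Unset Strict Implicit.
Unset Printing Implicit Defensive.
Import Order.TTheory GRing.Theory Num.Theory.
Import numFieldNormedType.Exports.
Local Open Scope classical_set_scope.
Local Open Scope ring_scope.

(** * Trigonometric minorants *)

Section chebyshev.
Context {R : realType}.
Implicit Types (x t : R) (p : seq R).

(** Minimising over [f] would turn the left side into (int |h| sqrt q)^2 / pi, so the claim is in
    essence an inequality about an arbitrary width function [q]. The obstacle is that both second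
    moments grow with [q], so a minorant of [q] cannot be inserted on one side only. A fixed weight
    [c], instead of the optimal one that depends on all of [q], makes the difference of the two
    monotone in [q] at each single [t]. The second moments and their bounds have degree one in [q],
    the squared mean has degree two. They become comparable because q <= 1, which is how the
    inclusion of the body in the disc enters. The measure on affine lines is known only through its
    invariance, not in coordinates. Translations along one axis suffice to disintegrate it, since
    the lines parallel to that axis turn out to be null. Tonelli is applied to the law of an
    isotropic line, a probability, and Lebesgue measure, so no product form of the invariant measure
    is needed. *)

Fixpoint cheb n x : R :=
  match n with
  | 0 => 1
  | 1 => x
  | (n'.+1 as n1).+1 => 2 * x * cheb n1 x - cheb n' x
  end.

Lemma cos_cheb n t : cos (n%:R * t) = cheb n (cos t).
Proof.
suff: cos (n%:R * t) = cheb n (cos t) /\ cos (n.+1%:R * t) = cheb n.+1 (cos t).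
  by case.
elim: n => [|n [IH1 IH2]]; first by rewrite mul0r cos0 mul1r.
split => //.
have -> : cheb n.+2 (cos t) = 2 * cos t * cheb n.+1 (cos t) - cheb n (cos t) by [].
rewrite -IH1 -IH2.
have -> : n.+2%:R * t = n.+1%:R * t + t by rewrite -natr1; ring.
have -> : n%:R * t = n.+1%:R * t - t by rewrite -natr1; ring.
rewrite !cosD cosN sinN; ring.
Qed.

(** The basis [e] is a parameter so that one coefficient list can be read against cosines of
    multiples, against Chebyshev values, or against Chebyshev values damped by the moment ratios. *)
Fixpoint csum (e : nat -> R) k p : R :=
  if p is a :: p' then a * e k + csum e k.+1 p' else 0.

Lemma eq_csum (e e' : nat -> R) k p : e =1 e' -> csum e k p = csum e' k p.
Proof. by move=> ee'; elim: p k => //= a p IH k; rewrite ee' IH. Qed.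

Definition cospoly p t : R := csum (fun k => cos (k%:R * t)) 0 p.
Definition chebpoly p x : R := csum (cheb^~ x) 0 p.

Lemma cospolyE p t : cospoly p t = chebpoly p (cos t).
Proof. by apply: eq_csum => k; rewrite cos_cheb. Qed.

Lemma chebE x : (cheb 2 x = 2 * x ^+ 2 - 1) *
  (cheb 3 x = 4 * x ^+ 3 - 3 * x) *
  (cheb 4 x = 8 * x ^+ 4 - 8 * x ^+ 2 + 1) *
  (cheb 5 x = 16 * x ^+ 5 - 20 * x ^+ 3 + 5 * x) *
  (cheb 6 x = 32 * x ^+ 6 - 48 * x ^+ 4 + 18 * x ^+ 2 - 1) *
  (cheb 7 x = 64 * x ^+ 7 - 112 * x ^+ 5 + 56 * x ^+ 3 - 7 * x) *
  (cheb 8 x = 128 * x ^+ 8 - 256 * x ^+ 6 + 160 * x ^+ 4 - 32 * x ^+ 2 + 1) *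
  (cheb 0 x = 1) * (cheb 1 x = x).
Proof. by repeat match goal with |- (_ * _)%type => split end; rewrite /=; ring. Qed.

Lemma bernstein_mono (a b x : R) : a <= x <= b ->
  forall i j, 0 <= (x - a) ^+ i * (b - x) ^+ j.
Proof. by case/andP=> ax xb i j; rewrite mulr_ge0// exprn_ge0// subr_ge0. Qed.

Lemma itv_split (b a c x : R) : a <= x <= c -> a <= x <= b \/ b <= x <= c.
Proof.
by case/andP => ax xc; have [xb|/ltW bx] := leP x b; [left|right]; apply/andP.
Qed.

End chebyshev.

(* Nonnegativity of a polynomial of degree at most 8 on the interval [H], by its
   expansion in the Bernstein basis. *)
Ltac bernstein8 H :=
  have := bernstein_mono H 0 8; have := bernstein_mono H 1 7;
  have := bernstein_mono H 2 6; have := bernstein_mono H 3 5;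
  have := bernstein_mono H 4 4; have := bernstein_mono H 5 3;
  have := bernstein_mono H 6 2; have := bernstein_mono H 7 1;
  have := bernstein_mono H 8 0; clear H; lra.

Section minorants.
Context {R : realType}.
Implicit Types (x t : R) (p : seq R).

(* Chebyshev coefficients of a minorant of [|1 / 6 + x / 2|], found numerically. *)
Definition pcoef : seq R :=
  [:: 1630 / 5000; 1070 / 5000; 936 / 5000; - (339 / 5000); - (66 / 5000);
      153 / 5000; - (43 / 5000); - (50 / 5000); 42 / 5000].

Lemma pcoef_le x : -1 <= x <= 1 -> chebpoly pcoef x <= `|1 / 6 + 1 / 2 * x|.
Proof.
move=> H; rewrite ler_normr /chebpoly /pcoef; cbn [csum]; rewrite !chebE.
(* The sign of [1 / 6 + x / 2] changes at -1/3 and decides which branch of the absolute value is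
   bounded. The further cuts only shorten the intervals until all Bernstein coefficients are
   nonnegative. *)
case: (itv_split (- (1 / 3)) H) => {}H; apply/orP.
  right.
  case: (itv_split (- (5 / 6)) H) => {}H; first by bernstein8 H.
  case: (itv_split (- (3 / 4)) H) => {}H; first by bernstein8 H.
  case: (itv_split (- (2 / 3)) H) => {}H; by bernstein8 H.
left.
case: (itv_split 0 H) => {}H; first by bernstein8 H.
case: (itv_split (1 / 6) H) => {}H; first by bernstein8 H.
case: (itv_split (1 / 3) H) => {}H; first by bernstein8 H.
case: (itv_split (2 / 3) H) => {}H; first by bernstein8 H.
case: (itv_split (5 / 6) H) => {}H; by bernstein8 H.
Qed.

(* [sin_ratio nu k] is the quotient of the integrals of
   [sin x ^ nu * cos (2 k x)] and [sin x ^ nu] over [0, pi]. *)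
Fixpoint sin_ratio (nu : R) (k : nat) : R :=
  if k is k'.+1 then
    (2 * k'%:R - nu) / (2 * k'%:R + 2 + nu) * sin_ratio nu k'
  else 1.

Lemma sin_ratioS nu k : sin_ratio nu k.+1 =
  (2 * k%:R - nu) / (2 * k%:R + 2 + nu) * sin_ratio nu k.
Proof. by []. Qed.

(** Integrating |sin (t - al)|^nu against a cosine polynomial in 2 (t - eta) multiplies the k-th
    coefficient by [sin_ratio nu k] and leaves a polynomial in x = cos (2 (al - eta)), up to the
    integral of |sin|^nu; see [moment_cospoly]. *)
Definition mompoly nu p x : R :=
  csum (fun k => sin_ratio nu k * cheb k x) 0 p.

Definition hsqcoef (d : R) : seq R := [:: d ^+ 2 + 1 / 8; d; 1 / 8].

Lemma hsqcoefE d t : cospoly (hsqcoef d) t = (d + 1 / 2 * cos t) ^+ 2.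
Proof.
rewrite cospolyE /chebpoly /hsqcoef; cbn [csum]; rewrite !chebE.
by lra.
Qed.

Lemma mompoly_hsq d x :
  mompoly 1 (hsqcoef d) x =
  d ^+ 2 + 1 / 8 - d / 3 * x - (2 * x ^+ 2 - 1) / 120.
Proof.
have r0 : sin_ratio 1 0 = 1 by [].
have r1 : sin_ratio 1 1 = - (1 / 3) by rewrite /=; field.
have r2 : sin_ratio 1 2 = - (1 / 15) by rewrite sin_ratioS r1; field.
rewrite /mompoly /hsqcoef; cbn [csum]; rewrite r0 r1 r2 !chebE.
by field.
Qed.

Lemma sin_ratio_half : (sin_ratio (1 / 2) 0 = 1) *
  (sin_ratio (1 / 2) 1 = - (1 / 5)) * (sin_ratio (1 / 2) 2 = - (1 / 15)) *
  (sin_ratio (1 / 2) 3 = - (7 / 195)) * (sin_ratio (1 / 2) 4 = - (77 / 3315)) *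
  (sin_ratio (1 / 2) 5 = - (11 / 663)) *
  (sin_ratio (1 / 2) 6 = - (209 / (75 * 221))) *
  (sin_ratio (1 / 2) 7 = - (4807 / (325 * 1479))) *
  (sin_ratio (1 / 2) 8 = - (1311 / (325 * 493))).
Proof.
have t0 : sin_ratio (1 / 2) 0 = 1 by [].
have t1 : sin_ratio (1 / 2) 1 = - (1 / 5) by rewrite sin_ratioS t0; field.
have t2 : sin_ratio (1 / 2) 2 = - (1 / 15) by rewrite sin_ratioS t1; field.
have t3 : sin_ratio (1 / 2) 3 = - (7 / 195) by rewrite sin_ratioS t2; field.
have t4 : sin_ratio (1 / 2) 4 = - (77 / 3315) by rewrite sin_ratioS t3; field.
have t5 : sin_ratio (1 / 2) 5 = - (11 / 663) by rewrite sin_ratioS t4; field.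
have t6 : sin_ratio (1 / 2) 6 = - (209 / (75 * 221)) by rewrite sin_ratioS t5; field.
have t7 : sin_ratio (1 / 2) 7 = - (4807 / (325 * 1479)) by rewrite sin_ratioS t6; field.
have t8 : sin_ratio (1 / 2) 8 = - (1311 / (325 * 493)) by rewrite sin_ratioS t7; field.
by repeat match goal with |- (_ * _)%type => split end.
Qed.

(* [1493 / 1250] bounds half the integral of [sqrt (sin t)] over [0, pi] from
   below; [22 / 42] is [pi / 6] rounded up, and [42 / 100] a near-optimal weight
   for the Cauchy-Schwarz inequality. *)
Definition gain p d x : R :=
  2 * (42 / 100) * (1493 / 1250) * mompoly (1 / 2) p x - (42 / 100) ^+ 2
  - 22 / 42 * mompoly 1 (hsqcoef d) x.

(** The thresholds are dictated by the squared mean. For d = 1/6 the mean lies between 0 and 2/3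
    q(eta), and after multiplication by pi the term 2/3 m^2 must stay below 4 rho times the gain. If
    q(eta)^2 <= M^2 / 2 and rho = M <= 1, this asks for 1/27; if q(eta)^2 = rho^2 (1 - x) / 2 with
    rho <= 1, it asks for (1 - x)/27. *)
Lemma gain_pcoef x : -1 <= x <= 1 ->
  1 / 27 < gain pcoef (1 / 6) x /\ (1 - x) / 27 < gain pcoef (1 / 6) x.
Proof.
move=> H; rewrite /gain mompoly_hsq /mompoly /pcoef; cbn [csum].
rewrite !sin_ratio_half !chebE; split; by bernstein8 H.
Qed.

(* The polynomial [15 / 16 x^2 - 125 / 256 x^4], which touches [|x| / 2] at
   [|x| = 4 / 5]. *)
Definition qcoef : seq R :=
  [:: 585 / 2048; 0; 115 / 512; 0; - (125 / 2048)].

Lemma qcoef_le x : -1 <= x <= 1 -> chebpoly qcoef x <= `|0 + 1 / 2 * x|.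
Proof.
move=> H; rewrite /chebpoly /qcoef; cbn [csum]; rewrite !chebE.
suff : forall y : R, 0 <= y -> 15 / 16 * y ^+ 2 - 125 / 256 * y ^+ 4 <= 1 / 2 * y.
  move=> /(_ `|x| (normr_ge0 _)); rewrite add0r normrM ger0_norm; last by lra.
  rewrite -!normrX !(ger0_norm (exprn_even_ge0 _ _))//.
  by move: `|x| => a; lra.
move=> y y0; rewrite -subr_ge0 (_ : _ - _ =
  125 / 256 * (y * (y - 4 / 5) ^+ 2 * (y + 8 / 5))); last by field.
apply: mulr_ge0; first by lra.
apply: mulr_ge0; last by rewrite addr_ge0// divr_ge0.
by rewrite mulr_ge0// sqr_ge0.
Qed.

(** For d = 0 the mean is at most M/3 in absolute value, so 2/3 (M/3)^2 < 4 M gain has to hold for M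
    <= 1; this is the threshold 1/54. *)
Lemma gain_qcoef x : -1 <= x <= 1 -> 1 / 54 < gain qcoef 0 x.
Proof.
move=> H; rewrite /gain mompoly_hsq /mompoly /qcoef; cbn [csum].
by rewrite !sin_ratio_half !chebE; bernstein8 H.
Qed.

End minorants.

(** * Moments of powers of the sine *)

(** The pushforward with its measure structure, which depends on the proof [mf]. Naming the
    structure lets the image be passed where a measure is expected, here to the uniqueness of
    Lebesgue measure. *)
Definition image_measure d d' (T : measurableType d) (T' : measurableType d')
    (R : realType) (m : {measure set T -> \bar R}) (f : T -> T')
    (mf : measurable_fun setT f) : {measure set T' -> \bar R} :=
  measure_function_pushforward__canonical__measure_function_Measure m mf.

Section pi.
Context {R : realType}.
(** Dalzell's integral: 22/7 - pi is the integral over [0, 1] of the nonnegative function x^4 (1 -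
    x)^4 / (1 + x^2), whose primitive is [F]. *)
Lemma pi_le_22_7 : pi <= 22 / 7 :> R.
Proof.
pose F (x : R) := x ^+ 7 / 7 - 2 / 3 * x ^+ 6 + x ^+ 5 - 4 / 3 * x ^+ 3 + 4 * x - 4 * atan x.
pose f (x : R) := x ^+ 4 * (1 - x) ^+ 4 / (1 + x ^+ 2).
have dF (x : R) : is_derive x 1 F (f x).
  apply: is_derive_eq.
  rewrite /f !scaler1; have := sqr_ge0 x.
  rewrite /GRing.scale/= => x2. field. lra.
have dF' (x : R) : derivable F x 1 by case: (dF x).
have : F 0 <= F 1.
  apply: (@ger0_derive1_le_cc _ F 0 1); rewrite ?in_itv/= ?lexx ?ler01//.
  - move=> x /[!in_itv]/= /andP[/ltW x0]; rewrite -subr_gt0 => /ltW x1.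
    rewrite derive1E (@derive_val _ _ _ _ _ _ _ (dF x)) /f divr_ge0//.
      by rewrite mulr_ge0// exprn_ge0.
    by rewrite addr_ge0// sqr_ge0.
  - by apply: derivable_within_continuous => x _.
rewrite /F atan0 atan1 !expr0n /=; lra.
Qed.
End pi.

Section periodic_integrals.
Context {R : realType}.
Notation mu := (@lebesgue_measure R).
Implicit Types (x a b : R).

Lemma continuous_integrable (f : R -> R) a b : continuous f ->
  mu.-integrable `[a, b] (EFin \o f).
Proof.
move=> cf; apply: continuous_compact_integrable; first exact: segment_compact.
exact: continuous_subspaceT.
Qed.

Lemma continuous_integrable_co (f : R -> R) a b : continuous f ->
  mu.-integrable `[a, b[ (EFin \o f).
Proof.
move=> cf. have := @integrableS _ _ R mu `[a, b]%classic `[a, b[%classic (EFin \o f). apply => //.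
  exact: subset_itv_co_cc.
exact: continuous_integrable.
Qed.

Let shift a (x : measurableTypeR R) : measurableTypeR R := x + a.

Let measurable_shift a : measurable_fun setT (shift a).
Proof. exact: measurable_funD. Qed.

(** The image of Lebesgue measure under a shift gives half-open intervals their length, which
    characterizes Lebesgue measure. *)
Lemma lebesgue_measure_shift a (A : set R) : measurable A ->
  mu ((fun x => x + a) @^-1` A) = mu A.
Proof.
move=> mA; 
have -> : mu ((fun x => x + a) @^-1` A) =
  image_measure mu (measurable_shift a) A by [].
symmetry; apply: (@lebesgue_measure_unique R (image_measure mu (measurable_shift a))) => //.
  move=> X [[x y] _ <-]; rewrite /= /pushforward/=.
  have -> : shift a @^-1` `]x, y] = [set` `](x - a), (y - a)]].
    by apply/seteqP; split => z /=; rewrite !in_itv/= /shift ltrBlDr lerBrDr.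
  rewrite !lebesgue_measure_itv/= !lte_fin ltrD2r.
  by case: ifP => // _; rewrite -!EFinD; congr EFin; ring.
Qed.

Lemma ge0_integral_shift a (D : set R) (f : R -> \bar R) : measurable D ->
  measurable_fun D f -> (forall x, 0 <= f x)%E ->
  (\int[mu]_(x in (fun x => (x + a)%R) @^-1` D) f (x + a)%R = \int[mu]_(x in D) f x)%E.
Proof.
move=> mD mf f0.
have := @ge0_integral_pushforward _ _ _ _ R _ (measurable_shift a) mu D f mD mf (fun x _ => f0 x).
move=> <-; apply: eq_measure_integral => A mA _.
exact: lebesgue_measure_shift.
Qed.

Lemma preimage_shift a l u :
  (fun x : R => x + a) @^-1` `[l, u[ = [set` `[l - a, u - a[].
Proof.
by apply/seteqP; split => x /=; rewrite !in_itv/= lerBlDr ltrBrDr.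
Qed.

Definition pi_periodic T (f : R -> T) := forall x, f (x + pi) = f x.

Lemma pi_periodicB T (f : R -> T) : pi_periodic f -> forall x, f (x - pi) = f x.
Proof. by move=> pf x; rewrite -[LHS]pf subrK. Qed.

Lemma pi_periodicz T (f : R -> T) : pi_periodic f ->
  forall x (k : int), f (x + k%:~R * pi) = f x.
Proof.
move=> pf x; elim/int_ind => [|n IH|n IH]; first by rewrite mul0r addr0.
- by rewrite -addn1 PoszD intrD mulrDl mul1r addrA pf.
- by rewrite -addn1 PoszD opprD intrD mulrDl mulN1r addrA pi_periodicB.
Qed.

Lemma periodic_repr x : exists2 k : int, 0 <= x - k%:~R * pi & x - k%:~R * pi < pi.
Proof.
exists (Num.floor (x / pi)).
  by rewrite subr_ge0 -ler_pdivlMr ?pi_gt0// ge_floor.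
rewrite ltrBlDr; have := floorD1_gt (x / pi).
by rewrite intrD ltr_pdivrMr ?pi_gt0// mulrDl mul1r addrC.
Qed.

(** The shift is first reduced modulo pi to some b in [0, pi[. The shifted window [b, pi + b[ is
    then cut at pi, and its second piece is moved back to [0, b[ by periodicity. Half-open intervals
    make the pieces disjoint. *)
Lemma ge0_integral_periodic a (f : R -> \bar R) : measurable_fun setT f ->
  (forall x, 0 <= f x)%E -> pi_periodic f ->
  (\int[mu]_(x in `[0%R, pi[) f (x + a)%R = \int[mu]_(x in `[0%R, pi[) f x)%E.
Proof.
move=> mf f0 pf.
have mfD (D : set R) : measurable_fun D f by exact: measurable_funS mf.
have [k ka akpi] := periodic_repr a.
set b := a - _ in ka akpi.
transitivity (\int[mu]_(x in `[0%R, pi[) f (x + b)%R)%E.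
  apply: eq_integral => x _; rewrite -(pi_periodicz pf (x + b) k).
  by congr f; rewrite /b; ring.
have := @ge0_integral_shift b `[b, pi + b[ f (measurable_itv _) (mfD _) f0.
rewrite preimage_shift subrr addrK => ->.
have bpi : (b <= pi)%R by exact: ltW.
rewrite (@itv_bndbnd_setU _ _ (BLeft b) (BLeft pi)); last 2 first.
- by rewrite bnd_simp.
- by rewrite bnd_simp lerDl.
rewrite ge0_integral_setU//=; last 2 first.
- exact: mfD.
- by apply/disj_setPS => x [] /=; rewrite !in_itv/= => /andP[_ xp] /andP[]; rewrite leNgt xp.
rewrite (@itv_bndbnd_setU _ _ (BLeft 0%R) (BLeft b) (BLeft pi)); last 2 first.
- by rewrite bnd_simp.
- by rewrite bnd_simp.
rewrite ge0_integral_setU//=; last 2 first.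
- exact: mfD.
- by apply/disj_setPS => x [] /=; rewrite !in_itv/= => /andP[_ xp] /andP[]; rewrite leNgt xp.
rewrite addeC; congr (_ + _)%E.
have := @ge0_integral_shift pi `[pi, pi + b[ f (measurable_itv _) (mfD _) f0.
rewrite preimage_shift subrr (_ : pi + b - pi = b); last by ring.
move=> <-.
by apply: eq_integral => x _; rewrite pf.
Qed.

Lemma Rintegral_periodic a (f : R -> R) : continuous f -> pi_periodic f ->
  \int[mu]_(x in `[0, pi]) f (x + a) = \int[mu]_(x in `[0, pi]) f x.
Proof.
move=> cf pf.
have mf : measurable_fun setT f by exact: continuous_measurable_fun.
rewrite -!(@Rintegral_itv_bndo_bndc _ (BLeft 0)); last 2 first.
- exact: continuous_integrable_co.
- apply: continuous_integrable_co => x.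
  apply: (@continuous_comp _ _ _ (fun x => x + a) f); last exact: cf.
  by apply: cvgD; [exact: cvg_id|exact: cvg_cst].
rewrite /Rintegral; congr fine.
rewrite integralE [in RHS]integralE; congr (_ - _)%E.
- rewrite -(@ge0_integral_periodic a (EFin \o f)^\+%E)//.
  + by apply: eq_integral => x _; rewrite !funeposE.
  + by apply: measurable_funepos; apply/measurable_EFinP.
  + by move=> x; rewrite !funeposE/= pf.
- rewrite -(@ge0_integral_periodic a (EFin \o f)^\-%E)//.
  + by apply: eq_integral => x _; rewrite !funenegE.
  + by apply: measurable_funeneg; apply/measurable_EFinP.
  + by move=> x; rewrite !funenegE/= pf.
Qed.

Lemma Rintegral_FTC2 (F f : R -> R) a b : a < b -> continuous f ->
  continuous F -> (forall x, a < x < b -> is_derive x 1 F (f x)) ->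
  \int[mu]_(x in `[a, b]) f x = F b - F a.
Proof.
move=> ab cf cF dF; rewrite /Rintegral (@continuous_FTC2 _ f F)//.
- exact: continuous_subspaceT.
- split.
  + by move=> x /[!in_itv]/= /dF [].
  + by apply: cvg_at_right_filter; exact: cF.
  + by apply: cvg_at_left_filter; exact: cF.
- by move=> x /[!in_itv]/= /dF dFx; rewrite derive1E; exact: derive_val.
Qed.

End periodic_integrals.

Section moments.
Context {R : realType}.
Notation mu := (@lebesgue_measure R).

(* [w x] plays the role of [|sin x| ^ nu]. *)
Definition sin_weight (nu : R) (w : R -> R) := [/\ 0 <= nu, continuous w,
  pi_periodic w & forall x, 0 < x < pi ->
  is_derive x 1 (fun x => w x * sin x) ((nu + 1) * w x * cos x)].

Variables (nu : R) (w : R -> R).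
Hypothesis hw : sin_weight nu w.
Let nu_ge0 : 0 <= nu. Proof. by case: hw. Qed.
Let cw : continuous w. Proof. by case: hw. Qed.
Let pw : pi_periodic w. Proof. by case: hw. Qed.
Let dw : forall x, 0 < x < pi ->
  is_derive x 1 (fun x => w x * sin x) ((nu + 1) * w x * cos x).
Proof. by case: hw. Qed.

Let moment k phi : R :=
  \int[mu]_(x in `[0, pi]) (w x * cos (2 * k%:R * x + phi)).

Let affine_cvg (a b : R) : continuous (fun x : R => a * x + b).
Proof.
move=> x; apply: cvgD; last exact: cvg_cst.
by apply: cvgM; [exact: cvg_cst|exact: cvg_id].
Qed.

Let cos_affine_continuous (a b : R) : continuous (fun x : R => cos (a * x + b)).
Proof.
move=> x; apply: (@continuous_comp _ _ _ (fun x => a * x + b) cos).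
  exact: affine_cvg.
exact: continuous_cos.
Qed.

(** The function [F] vanishes at 0 and pi because of its factor sin, so its derivative has integral
    0. By the product formulas that derivative is a combination of the integrands of the k-th and
    (k+1)-st moments. *)
Let momentS k phi : (2 * k%:R + 2 + nu) * moment k.+1 phi =
  (2 * k%:R - nu) * moment k phi.
Proof.
pose F x := w x * sin x * cos ((2 * k%:R + 1) * x + phi).
pose f j x := w x * cos (2 * j%:R * x + phi).
have cf j : continuous (f j).
  by move=> x; apply: cvgM; [exact: cw|exact: cos_affine_continuous].
have cF : continuous F.
  move=> x; apply: cvgM; last exact: cos_affine_continuous.
  by apply: cvgM; [exact: cw|exact: continuous_sin].
have fint j : mu.-integrable `[0, pi] (EFin \o f j).
  exact: continuous_integrable.
have dF x : 0 < x < pi -> is_derive x 1 F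
  (2^-1 * (nu - 2 * k%:R) * f k x + 2^-1 * (2 * k%:R + 2 + nu) * f k.+1 x).
  move=> x0pi; have dwx := dw x0pi.
  have dc : is_derive x 1 (fun x => cos ((2 * k%:R + 1) * x + phi))
      (- (2 * k%:R + 1) * sin ((2 * k%:R + 1) * x + phi)).
    by apply: is_derive_eq; rewrite /GRing.scale/=; ring.
  apply: is_derive_eq; rewrite /GRing.scale/= /f.
  set A := (2 * k%:R + 1) * x + phi.
  have -> : 2 * k%:R * x + phi = A - x by rewrite /A; ring.
  have -> : 2 * k.+1%:R * x + phi = A + x by rewrite /A -natr1; ring.
  by rewrite !cosD cosN sinN; field.
have : \int[mu]_(x in `[0, pi])
   (2^-1 * (nu - 2 * k%:R) * f k x + 2^-1 * (2 * k%:R + 2 + nu) * f k.+1 x) = 0.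
  rewrite (@Rintegral_FTC2 _ F) ?pi_gt0//.
    by rewrite /F sinpi sin0 !mulr0 !mul0r subrr.
  by move=> x; apply: cvgD; (apply: cvgM; [exact: cvg_cst|exact: cf]).
have sint c j : mu.-integrable `[0, pi] (EFin \o (fun x => c * f j x)).
  by apply: continuous_integrable => x; apply: cvgM; [exact: cvg_cst|exact: cf].
rewrite RintegralD// !RintegralZl// /f => H; rewrite /moment; lra.
Qed.

Lemma momentE k phi :
  \int[mu]_(x in `[0, pi]) (w x * cos (2 * k%:R * x + phi)) =
  sin_ratio nu k * cos phi * \int[mu]_(x in `[0, pi]) w x.
Proof.
elim: k => [|k IH].
  under eq_Rintegral do rewrite mulr0 mul0r add0r.
  by rewrite RintegralZr ?mul1r 1?mulrC//; exact: continuous_integrable.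
have k0 : 2 * k%:R + 2 + nu != 0.
  by rewrite lt0r_neq0// ltr_wpDr// ltr_wpDl// mulr_ge0.
rewrite sin_ratioS; apply: (mulfI k0).
rewrite -[X in _ * X = _]/(moment k.+1 phi) momentS [moment _ _]IH.
by field.
Qed.

Lemma continuous_csum (eta : R) j p :
  continuous (fun x => w x * csum (fun k => cos (k%:R * (2 * (x + eta)))) j p).
Proof.
move=> x; apply: cvgM; first exact: cw.
elim: p j => [|a p IH] j /=; first exact: cvg_cst.
apply: cvgD; last exact: IH.
apply: cvgM; first exact: cvg_cst.
have /funext E : (fun x => cos (j%:R * (2 * (x + eta)))) =1
    (fun x => cos ((j%:R * 2) * x + j%:R * 2 * eta)).
  by move=> y; congr cos; ring.
by move: (@cos_affine_continuous (j%:R * 2) (j%:R * 2 * eta)); rewrite -E => /(_ x).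
Qed.

Lemma moment_csum p (eta : R) j :
  \int[mu]_(x in `[0, pi]) (w x * csum (fun k => cos (k%:R * (2 * (x + eta)))) j p) =
  csum (fun k => sin_ratio nu k * cos (k%:R * (2 * eta))) j p *
  \int[mu]_(x in `[0, pi]) w x.
Proof.
elim: p j => [|a p IH] j /=.
  by under eq_Rintegral do rewrite mulr0; rewrite mul0r Rintegral_cst ?mul0r.
transitivity (\int[mu]_(x in `[0, pi])
   (a * (w x * cos (2 * j%:R * x + j%:R * (2 * eta))) +
   w x * csum (fun k => cos (k%:R * (2 * (x + eta)))) j.+1 p)).
  apply: eq_Rintegral => x _; rewrite mulrDr mulrCA; congr (_ * (_ * cos _) + _).
  by ring.
have cx : continuous (fun x => w x * cos (2 * j%:R * x + j%:R * (2 * eta))).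
  by move=> x; apply: cvgM; [exact: cw|exact: cos_affine_continuous].
rewrite RintegralD//; last 2 first.
- apply: continuous_integrable => x; apply: cvgM; [exact: cvg_cst|exact: cx].
- apply: continuous_integrable; exact: continuous_csum.
rewrite RintegralZl//; last by apply: continuous_integrable.
rewrite momentE IH; ring.
Qed.

(** Periodicity moves the shift [al] from the weight into the phase of the cosines. Each moment then
    contributes cos (2 k (al - eta)), the k-th Chebyshev polynomial at cos (2 (al - eta)). *)
Lemma moment_cospoly p (al eta : R) :
  \int[mu]_(x in `[0, pi]) (w (x - al) * cospoly p (2 * (x - eta))) =
  mompoly nu p (cos (2 * (al - eta))) * \int[mu]_(x in `[0, pi]) w x.
Proof.
pose g x := w x * csum (fun k => cos (k%:R * (2 * (x + (al - eta))))) 0 p.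
have cg : continuous g.
  by move=> x; apply: continuous_csum.
have pg : pi_periodic g.
  move=> x; rewrite /g pw; congr (_ * _); apply: eq_csum => k.
  rewrite (cos_cheb k (2 * (x + pi + _))) (cos_cheb k (2 * (x + _))); congr cheb.
  by rewrite -[RHS]cosD2pi; congr cos; rewrite mulr2n; ring.
transitivity (\int[mu]_(x in `[0, pi]) g (x - al)).
  apply: eq_Rintegral => x _; rewrite /g; congr (_ * _); apply: eq_csum => k.
  by congr cos; ring.
rewrite (Rintegral_periodic _ cg pg) moment_csum; congr (_ * _).
by rewrite /mompoly; apply: eq_csum => k; rewrite cos_cheb.
Qed.

Lemma sin_weight_sqr : sin_weight (nu + 2) (fun x => w x * sin x ^+ 2).
Proof.
split; first by rewrite addr_ge0.
- move=> x; apply: cvgM; first exact: cw.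
  by rewrite expr2; apply: cvgM; exact: continuous_sin.
- by move=> x; rewrite pw sinDpi sqrrN.
- move=> x /dw dwx.
  have -> : (fun x => w x * sin x ^+ 2 * sin x) =
            (fun x => w x * sin x * sin x ^+ 2).
    by apply/funext => y; ring.
  by apply: is_derive_eq; rewrite /GRing.scale/=; ring.
Qed.

(** Wallis' recursion, also for non-integer exponents: it is the case k = 1 of the moment formula,
    through sin^2 x = (1 - cos 2x) / 2. *)
Lemma Rintegral_weight_sqr : \int[mu]_(x in `[0, pi]) (w x * sin x ^+ 2) =
  (1 + nu) / (2 + nu) * \int[mu]_(x in `[0, pi]) w x.
Proof.
have nu2 : 2 + nu != 0 by apply: lt0r_neq0; have := nu_ge0; lra.
transitivity (\int[mu]_(x in `[0, pi])
   (2^-1 * w x - 2^-1 * (w x * cos (2 * 1%:R * x + 0)))).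
  apply: eq_Rintegral => x _; rewrite sin2cos2 addr0 mulr1 mulr_natl mulr2n cosD.
  by rewrite -!expr2 sin2cos2; field.
have cwc : continuous (fun x => w x * cos (2 * 1%:R * x + 0)).
  by move=> x; apply: cvgM; [exact: cw|exact: cos_affine_continuous].
rewrite RintegralB//; last 2 first.
- by apply: continuous_integrable => x; apply: cvgM; [exact: cvg_cst|exact: cw].
- by apply: continuous_integrable => x; apply: cvgM; [exact: cvg_cst|exact: cwc].
rewrite !RintegralZl//; do 1?[exact: continuous_integrable].
rewrite momentE cos0 /=.
by field.
Qed.

End moments.

Section sin_weights.
Context {R : realType}.
Notation mu := (@lebesgue_measure R).

Lemma is_derive_normsin (x : R) : 0 < x < pi ->
  is_derive x 1 (fun x => `|sin x|) (cos x).
Proof.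
move=> /sin_gt0_pi s0.
rewrite (_ : (fun x => _) = (Num.sqrt \o (fun x => sin x ^+ 2))); last first.
  by apply/funext => y /=; rewrite sqrtr_sqr.
have s2 : 0 < sin x ^+ 2 by rewrite exprn_gt0.
have ds : is_derive (sin x ^+ 2) 1 Num.sqrt (2 * Num.sqrt (sin x ^+ 2))^-1.
  exact: is_derive1_sqrt.
apply: is_derive_eq; rewrite sqrtr_sqr gtr0_norm// /GRing.scale/=.
by field; rewrite gt_eqF.
Qed.

Lemma continuous_normsin : continuous (fun x : R => `|sin x|).
Proof.
move=> x; apply: (@continuous_comp _ _ _ sin (fun x => `|x|)).
  exact: continuous_sin.
exact: norm_continuous.
Qed.

Lemma sin_weight_norm : sin_weight 1 (fun x : R => `|sin x|).
Proof.
split => //.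
- exact: continuous_normsin.
- by move=> x; rewrite sinDpi normrN.
- move=> x x0pi; have dn := is_derive_normsin x0pi.
  apply: is_derive_eq; rewrite /GRing.scale/= gtr0_norm ?sin_gt0_pi//.
  by ring.
Qed.

Lemma sin_weight_sqrt : sin_weight (1 / 2) (fun x : R => Num.sqrt `|sin x|).
Proof.
split => //.
- move=> x; apply: (@continuous_comp _ _ _ (fun x => `|sin x|) Num.sqrt).
    exact: continuous_normsin.
  exact: sqrt_continuous.
- by move=> x; rewrite sinDpi normrN.
- move=> x x0pi; have dn := is_derive_normsin x0pi.
  have s0 := sin_gt0_pi x0pi.
  have n0 : 0 < `|sin x| by rewrite gtr0_norm.
  have ds := is_derive1_sqrt n0.
  have dc : is_derive x 1 (Num.sqrt \o (fun x => `|sin x|))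
    (cos x * (2 * Num.sqrt `|sin x|)^-1).
    by apply: is_derive_eq; rewrite /GRing.scale/=; ring.
  rewrite -[X in is_derive _ _ X]/((Num.sqrt \o (fun x => `|sin x|)) * sin).
  apply: is_derive_eq; rewrite /GRing.scale/=.
  have r0 : Num.sqrt `|sin x| != 0 by rewrite sqrtr_eq0 -ltNge.
  have : sin x = Num.sqrt `|sin x| ^+ 2 by rewrite sqr_sqrtr// gtr0_norm.
  by move: (Num.sqrt _) r0 => r r0 ->; field.
Qed.

Lemma Rintegral_normsin : \int[mu]_(x in `[0, pi]) `|sin x| = 2 :> R.
Proof.
transitivity (\int[mu]_(x in `[0, pi]) sin x).
  apply: eq_Rintegral => x; rewrite inE/= in_itv/= => xpi.
  by rewrite ger0_norm// sin_ge0_pi.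
have cF : continuous (fun x : R => - cos x).
  by move=> x; apply: cvgN; exact: continuous_cos.
have dF (x : R) : 0 < x < pi -> is_derive x 1 (fun x : R => - cos x) (sin x).
  by move=> _; apply: is_derive_eq; rewrite opprK.
rewrite (Rintegral_FTC2 (pi_gt0 R) (@continuous_sin R) cF dF) cospi cos0.
by ring.
Qed.

(* [y^7 <= 3/4 l y^(13/2) + y^(17/2) / (4 l^3)] by AM-GM; the integrals of
   these powers of [sin] are reduced to the one of the square root. *)
Lemma Rintegral_sqrt_normsin_ge :
  2 * (1493 / 1250) <= \int[mu]_(x in `[0, pi]) Num.sqrt `|sin x| :> R.
Proof.
have w1 := @sin_weight_norm.
have w3 := sin_weight_sqr w1; have w5 := sin_weight_sqr w3.
have w7 := sin_weight_sqr w5.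
have v0 := @sin_weight_sqrt.
have v2 := sin_weight_sqr v0; have v4 := sin_weight_sqr v2.
have v6 := sin_weight_sqr v4; have v8 := sin_weight_sqr v6.
have E7 := Rintegral_weight_sqr w5.
rewrite (Rintegral_weight_sqr w3) (Rintegral_weight_sqr w1) Rintegral_normsin in E7.
have E6 := Rintegral_weight_sqr v4.
rewrite (Rintegral_weight_sqr v2) (Rintegral_weight_sqr v0) in E6.
have E8 := Rintegral_weight_sqr v6.
rewrite E6 in E8.
set I0 := \int[mu]_(x in _) Num.sqrt `|sin x| in E6 E8 *.
(* Equality in the AM-GM step occurs where sqrt (sin x) = l; this value is close to the typical size
   of sqrt (sin x) under the weight sin^7, so little is lost. *)
pose l : R := 31 / 32.
have cw nu (w : R -> R) (h : sin_weight nu w) : continuous w by case: h.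
have : \int[mu]_(x in `[0, pi]) (`|sin x| * sin x ^+ 2 * sin x ^+ 2 * sin x ^+ 2)
  <= \int[mu]_(x in `[0, pi])
  (3 / 4 * l * (Num.sqrt `|sin x| * sin x ^+ 2 * sin x ^+ 2 * sin x ^+ 2) +
   (4 * l ^+ 3)^-1 *
   (Num.sqrt `|sin x| * sin x ^+ 2 * sin x ^+ 2 * sin x ^+ 2 * sin x ^+ 2)).
  apply: le_Rintegral => //.
  - exact/continuous_integrable/(cw _ _ w7).
  - apply: continuous_integrable => x; apply: cvgD; apply: cvgM.
    + exact: cvg_cst.
    + exact: (cw _ _ v6).
    + exact: cvg_cst.
    + exact: (cw _ _ v8).
  - move=> x _; have := sqrtr_ge0 `|sin x|.
    have : `|sin x| = Num.sqrt `|sin x| ^+ 2 by rewrite sqr_sqrtr.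
    have -> : sin x ^+ 2 = `|sin x| ^+ 2 by rewrite real_normK ?num_real.
    move: (Num.sqrt _) => r -> r0; rewrite -subr_ge0.
    (* The remaining quartic r^4 - 4 l^3 r + 3 l^4 has a double root at r = l, and its other factor
       is positive. *)
    rewrite (_ : _ - _ = r ^+ 13 / (4 * l ^+ 3) *
      ((r - l) ^+ 2 * (r ^+ 2 + 2 * l * r + 3 * l ^+ 2))); last first.
      by rewrite /l; field.
    rewrite /l mulr_ge0 ?divr_ge0 ?exprn_ge0//.
    by rewrite mulr_ge0 ?sqr_ge0// !addr_ge0// ?mulr_ge0// exprn_ge0.
rewrite RintegralD//; last 2 first.
- by apply: continuous_integrable => x; apply: cvgM; [exact: cvg_cst|exact: (cw _ _ v6)].
- by apply: continuous_integrable => x; apply: cvgM; [exact: cvg_cst|exact: (cw _ _ v8)].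
rewrite !RintegralZl//; last 2 first.
- exact/continuous_integrable/(cw _ _ v8).
- exact/continuous_integrable/(cw _ _ v6).
rewrite E7 E8 E6 /l => H.
have c7 : (1 + (1 + 2 + 2)) / (2 + (1 + 2 + 2)) *
  ((1 + (1 + 2)) / (2 + (1 + 2)) * ((1 + 1) / (2 + 1) * 2)) = 32 / 35 :> R.
  by field.
have c6 : (1 + (1 / 2 + 2 + 2)) / (2 + (1 / 2 + 2 + 2)) = 11 / 13 :> R by field.
have c4 : (1 + (1 / 2 + 2)) / (2 + (1 / 2 + 2)) = 7 / 9 :> R by field.
have c2 : (1 + 1 / 2) / (2 + 1 / 2) = 3 / 5 :> R by field.
have c8 : (1 + (1 / 2 + 2 + 2 + 2)) / (2 + (1 / 2 + 2 + 2 + 2)) = 15 / 17 :> R.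
  by field.
have cl : (4 * (31 / 32) ^+ 3)^-1 = 32 * 32 * 32 / (4 * 31 * 31 * 31) :> R.
  by field.
rewrite c7 c8 c6 c4 c2 cl in H.
by clear -H; lra.
Qed.

End sin_weights.

(** * Width functions *)

Section width.
Context {R : realType}.
Notation mu := (@lebesgue_measure R).

(* The width of a convex body in the directions of the circle: an upper
   envelope, attained everywhere, of widths of segments. *)
Definition width_fun (q : R -> R) := [/\ continuous q, pi_periodic q &
  forall t0, exists rho al, [/\ 0 <= rho, q t0 = rho * `|sin (t0 - al)| &
    forall t, rho * `|sin (t - al)| <= q t]].

Lemma width_fun_ge0 q t : width_fun q -> 0 <= q t.
Proof. by case=> _ _ /(_ t)[rho [al [r0 -> _]]]; rewrite mulr_ge0. Qed.

Lemma width_fun_shift q a : width_fun q -> width_fun (fun t => q (t + a)).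
Proof.
case=> cq pq sq; split.
- move=> t; apply: (@continuous_comp _ _ _ (fun t => t + a) q); last exact: cq.
  by apply: cvgD; [exact: cvg_id|exact: cvg_cst].
- by move=> t; rewrite addrAC pq.
- move=> t0; have [rho [al [r0 qt0 qt]]] := sq (t0 + a).
  exists rho, (al - a); split => //.
    by rewrite qt0; congr (_ * `|sin _|); ring.
  by move=> t; apply: le_trans (qt (t + a)); rewrite opprB addrA.
Qed.

Lemma width_fun_opp q : width_fun q -> width_fun (fun t => q (- t)).
Proof.
case=> cq pq sq; split.
- move=> t; apply: (@continuous_comp _ _ _ (fun t => - t) q); last exact: cq.
  by apply: cvgN; exact: cvg_id.
- by move=> t; rewrite opprD pi_periodicB.
- have nsin (u v : R) : `|sin (u + v)| = `|sin (- u - v)|.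
    by rewrite -opprD sinN normrN.
  move=> t0; have [rho [al [r0 qt0 qt]]] := sq (- t0).
  exists rho, (- al); split => //.
    by rewrite qt0 opprK (nsin t0).
  by move=> t; apply: le_trans (qt (- t)); rewrite opprK (nsin t).
Qed.

(** Trigonometric convexity: between [t1] and [t3] the function stays below the sinusoid through its
    values there. For the segment attaining q(t2) this is an addition formula followed by the
    triangle inequality, and at the two ends that segment lies below [q]. *)
Lemma width_fun3 q t1 t2 t3 : width_fun q -> t1 <= t2 -> t2 <= t3 ->
  t3 - t1 <= pi ->
  sin (t3 - t1) * q t2 <= sin (t3 - t2) * q t1 + sin (t2 - t1) * q t3.
Proof.
case=> _ _ sq t12 t23 t13.
have [rho [al [r0 -> qt]]] := sq t2.
have s13 : 0 <= sin (t3 - t1) by rewrite sin_ge0_pi//; lra.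
have s12 : 0 <= sin (t2 - t1) by rewrite sin_ge0_pi//; lra.
have s23 : 0 <= sin (t3 - t2) by rewrite sin_ge0_pi//; lra.
apply: (@le_trans _ _ (sin (t3 - t2) * (rho * `|sin (t1 - al)|) +
    sin (t2 - t1) * (rho * `|sin (t3 - al)|))); last first.
  by rewrite lerD// ler_wpM2l.
have -> : sin (t3 - t1) * (rho * `|sin (t2 - al)|) =
    rho * `|sin (t3 - t1) * sin (t2 - al)|.
  by rewrite normrM (ger0_norm s13); ring.
have -> : sin (t3 - t1) * sin (t2 - al) =
    sin (t3 - t2) * sin (t1 - al) + sin (t2 - t1) * sin (t3 - al).
  have -> : t3 - t1 = (t3 - t2) + (t2 - t1) by ring.
  have -> : t1 - al = (t2 - al) - (t2 - t1) by ring.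
  have -> : t3 - al = (t2 - al) + (t3 - t2) by ring.
  by move: (t3 - t2) (t2 - t1) (t2 - al) => A B C; rewrite !sinD cosN sinN; ring.
apply: (@le_trans _ _ (rho * (`|sin (t3 - t2) * sin (t1 - al)| +
    `|sin (t2 - t1) * sin (t3 - al)|))).
  by rewrite ler_wpM2l// ler_normD.
by rewrite !normrM !(ger0_norm s23) !(ger0_norm s12) le_eqVlt; apply/orP; left; apply/eqP; ring.
Qed.

Section crossing.
Variables (d ts : R).
Hypothesis ts_gt0 : 0 < ts.
Hypothesis ts_lt : ts < pi / 2.
Hypothesis cos2ts : cos (2 * ts) = - 2 * d.

Let h u := d + 1 / 2 * cos (2 * u).

Let ts_pi : ts < pi. Proof. have := pi_gt0 R; move: ts_lt; lra. Qed.

Let sts : 0 < sin ts.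
Proof. by rewrite sin_gt0_pi// ts_gt0 ts_pi. Qed.

Let cts : 0 < cos ts.
Proof. by rewrite cos_gt0_pihalf// ts_lt andbT; have := pi_gt0 R; move: ts_gt0; lra. Qed.

Let h_ge0 u : 0 <= u -> u <= ts -> 0 <= h u.
Proof.
move=> u0 uts; have : cos (2 * ts) <= cos (2 * u); last by rewrite cos2ts /h; lra.
have := pi_gt0 R; move: ts_lt => tl p0.
by rewrite leNgt ltr_cos ?in_itv/=; [rewrite -leNgt|apply/andP; split|apply/andP; split]; lra.
Qed.

Let h_le0 u : ts <= u -> u <= pi / 2 -> h u <= 0.
Proof.
move=> uts u0; have : cos (2 * u) <= cos (2 * ts); last by rewrite cos2ts /h; lra.
have := pi_gt0 R; move: ts_lt ts_gt0 => tl t0 p0.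
by rewrite leNgt ltr_cos ?in_itv/=; [rewrite -leNgt|apply/andP; split|apply/andP; split]; lra.
Qed.

Variable q : R -> R.
Hypothesis wq : width_fun q.
Let k := (q ts - q 0 * cos ts) / sin ts.
Let r := (q ts - q (pi / 2) * sin ts) / cos ts.

(** The comparison sinusoid interpolates [q] at 0 and at [ts], the zero of [h]. It lies above [q]
    between the two nodes and below [q] beyond [ts], so q minus the sinusoid changes sign together
    with [h] and the product with [h] keeps one sign. *)
Lemma crossing_le u : 0 <= u -> u <= pi / 2 ->
  h u * q u <= h u * (q 0 * cos u + k * sin u).
Proof.
move=> u0 u1; have := pi_gt0 R => p0.
have E : sin ts * (q 0 * cos u + k * sin u) =
    q 0 * sin (ts - u) + sin u * q ts.
  by rewrite sinD cosN sinN /k; field; rewrite gt_eqF.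
have [uts|/ltW uts] := leP u ts.
- rewrite ler_wpM2l ?h_ge0// -(ler_pM2l sts) E.
  have := width_fun3 wq u0 uts; rewrite !subr0 (mulrC (q 0)).
  by apply; move: ts_pi; lra.
- rewrite ler_wnM2l ?h_le0// -(ler_pM2l sts) E.
  have := width_fun3 wq (ltW ts_gt0) uts; rewrite !subr0.
  move=> H; have {}H : sin u * q ts <= sin (u - ts) * q 0 + sin ts * q u.
    by apply: H; lra.
  by rewrite -(opprB u) sinN; lra.
Qed.

(** The same sign argument with the nodes [ts] and pi/2: the sinusoid now lies above [q] where h <=
    0 and below [q] where h >= 0. *)
Lemma crossing_ge u : 0 <= u -> u <= pi / 2 ->
  h u * (q (pi / 2) * sin u + r * cos u) <= h u * q u.
Proof.
move=> u0 u1; have := pi_gt0 R => p0.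
have E : cos ts * (q (pi / 2) * sin u + r * cos u) =
    q (pi / 2) * sin (u - ts) + cos u * q ts.
  by rewrite sinD cosN sinN /r; field; rewrite gt_eqF.
have cE v : sin (pi / 2 - v) = cos v by rewrite addrC sinDpihalf cosN.
have [uts|/ltW uts] := leP u ts.
- rewrite ler_wpM2l ?h_ge0// -(ler_pM2l cts) E.
  have := width_fun3 wq uts (ltW ts_lt); rewrite !cE => H.
  have {}H : cos u * q ts <= cos ts * q u + sin (ts - u) * q (pi / 2).
    by apply: H; lra.
  by rewrite -(opprB ts u) sinN; lra.
- rewrite ler_wnM2l ?h_le0// -(ler_pM2l cts) E.
  have := width_fun3 wq uts u1; rewrite !cE => H.
  have {}H : cos ts * q u <= cos u * q ts + sin (u - ts) * q (pi / 2).
    by apply: H; move: ts_gt0; lra.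
  by lra.
Qed.

End crossing.

End width.

Section width_mean.
Context {R : realType}.
Notation mu := (@lebesgue_measure R).

Let hcs_integral (d x k a b : R) : a < b ->
  \int[mu]_(u in `[a, b]) ((d + 1 / 2 * cos (2 * u)) * (x * cos u + k * sin u)) =
  (x * ((d + 1 / 2) * sin b - sin b ^+ 3 / 3) -
   k * ((d - 1 / 2) * cos b + cos b ^+ 3 / 3)) -
  (x * ((d + 1 / 2) * sin a - sin a ^+ 3 / 3) -
   k * ((d - 1 / 2) * cos a + cos a ^+ 3 / 3)).
Proof.
move=> ab.
pose F u : R := x * ((d + 1 / 2) * sin u - sin u ^+ 3 / 3) -
   k * ((d - 1 / 2) * cos u + cos u ^+ 3 / 3).
have cosc : continuous (@cos R) := @continuous_cos R.
have sinc : continuous (@sin R) := @continuous_sin R.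
have cf : continuous (fun u : R => (d + 1 / 2 * cos (2 * u)) * (x * cos u + k * sin u)).
  move=> u; apply: cvgM; apply: cvgD.
  - exact: cvg_cst.
  - apply: cvgM; first exact: cvg_cst.
    apply: (@continuous_comp _ _ _ (fun u : R => 2 * u) (@cos R)); last exact: cosc.
    by apply: cvgM; [exact: cvg_cst|exact: cvg_id].
  - by apply: cvgM; [exact: cvg_cst|exact: cosc].
  - by apply: cvgM; [exact: cvg_cst|exact: sinc].
have dF (u : R) :
  is_derive u 1 F ((d + 1 / 2 * cos (2 * u)) * (x * cos u + k * sin u)).
  apply: is_derive_eq; rewrite /GRing.scale/= mulr_natl mulr2n cosD.
  rewrite -!expr2; have := cos2sin2 u.
  move: (cos u) (sin u) => c s cs.
  apply/eqP; rewrite -subr_eq0.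
  rewrite (_ : _ - _ = 1 / 2 * (1 - s ^+ 2 - c ^+ 2) * (x * c - k * s)).
    by rewrite cs subrr mulr0 mul0r.
  by field.
have cF : continuous F.
  by move=> u; apply/differentiable_continuous/derivable1_diffP; case: (dF u).
exact: (Rintegral_FTC2 ab cf cF (fun u _ => dF u)).
Qed.

Lemma Rintegral_split (f : R -> R) a b c : continuous f -> a <= b -> b <= c ->
  \int[mu]_(x in `[a, c]) f x =
  \int[mu]_(x in `[a, b]) f x + \int[mu]_(x in `[b, c]) f x.
Proof.
move=> cf ab bc.
have := @Rintegral_itvB R f (BLeft a) (BRight c) b (continuous_integrable _ _ cf).
rewrite !bnd_simp => /(_ ab bc); rewrite Rintegral_itv_obnd_cbnd.
  by move/eqP; rewrite subr_eq addrC => /eqP.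
apply: (@integrableS _ _ R mu `[b, c]%classic `]b, c]%classic) => //.
  exact: subset_itv_oc_cc.
exact: continuous_integrable.
Qed.

(** Both quarter periods are compared with sinusoids sharing the value at 0 (upper bound) or at pi/2
    (lower bound). Their second coefficients depend on the unknown q(ts), but enter the integral
    only through their sum, whose sign is a three-point inequality. The upper bound needs d <= 1/6
    here. *)
Lemma width_mean (d : R) q : 0 <= d <= 1 / 6 -> width_fun q ->
  2 * (d - 1 / 6) * q (pi / 2) <=
  \int[mu]_(u in `[0, pi]) ((d + 1 / 2 * cos (2 * u)) * q u) <=
  2 * (d + 1 / 6) * q 0.
Proof.
move=> /andP[d0 d1] wq; have p0 := pi_gt0 R.
have d11 : -1 <= - 2 * d <= 1 by apply/andP; split; lra.
pose ts := acos (- 2 * d) / 2.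
have c2ts : cos (2 * ts) = - 2 * d.
  by rewrite /ts mulrC divfK// acosK// in_itv.
have ac1 : pi / 2 <= acos (- 2 * d).
  have acp := acos_lepi d11; have ac0 := acos_ge0 d11.
  rewrite leNgt; apply/negP => H.
  have : cos (pi / 2) < cos (acos (- 2 * d)).
    by rewrite ltr_cos// in_itv/=; apply/andP; split; lra.
  by rewrite acosK ?in_itv// cos_pihalf; lra.
have ac2 : acos (- 2 * d) < pi.
  by apply: acos_ltpi; apply/andP; split; lra.
have ts0 : 0 < ts by rewrite /ts; lra.
have ts1 : ts < pi / 2 by rewrite /ts; lra.
have sts : 0 < sin ts by rewrite sin_gt0_pi//; apply/andP; split; lra.
have cts : 0 < cos ts by rewrite cos_gt0_pihalf//; apply/andP; split; lra.
(* By reflection and periodicity, [q] on [pi/2, pi] becomes [q'] on [0, pi/2], where the crossing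
   lemmas apply. *)
pose q' u := q (- u).
have wq' : width_fun q' := width_fun_opp wq.
have q'0 : q' 0 = q 0 by rewrite /q' oppr0.
have [cq pq _] := wq.
have q'pi : q' (pi / 2) = q (pi / 2).
  by rewrite /q' -pq; congr q; field.
have q'E u : q u = q' (pi - u) by rewrite /q' opprB pi_periodicB.
have hpi u : cos (2 * u) = cos (2 * (pi - u)) :> R.
  by rewrite -[RHS]cosN -[RHS]cosD2pi; congr cos; rewrite mulr2n; ring.
have cpi (u : R) : cos (pi - u) = - cos u by rewrite addrC cosDpi cosN.
have spi (u : R) : sin (pi - u) = sin u by rewrite addrC sinDpi sinN opprK.
have cE (v : R) : sin (pi / 2 - v) = cos v by rewrite addrC sinDpihalf cosN.
have S2 : sin (2 * ts) = 2 * sin ts * cos ts.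
  by rewrite mulr_natl mulr2n sinD; ring.
pose f u := (d + 1 / 2 * cos (2 * u)) * q u.
have ch : continuous (fun u : R => d + 1 / 2 * cos (2 * u)).
  move=> u; apply: cvgD; first exact: cvg_cst.
  apply: cvgM; first exact: cvg_cst.
  apply: (@continuous_comp _ _ _ (fun u : R => 2 * u) (@cos R)).
    by apply: cvgM; [exact: cvg_cst|exact: cvg_id].
  exact: continuous_cos.
have cf : continuous f by move=> u; apply: cvgM; [exact: ch|exact: cq].
have cg x k : continuous (fun u : R => (d + 1 / 2 * cos (2 * u)) * (x * cos u + k * sin u)).
  move=> u; apply: cvgM; first exact: ch.
  apply: cvgD; apply: cvgM; do 1?[exact: cvg_cst].
    exact: continuous_cos.
  exact: continuous_sin.
have p02 : 0 <= pi / 2 :> R by lra.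
have p2p : pi / 2 <= pi :> R by lra.
have p02' : 0 < pi / 2 :> R by lra.
have p2p' : pi / 2 < pi :> R by lra.
rewrite (Rintegral_split cf p02 p2p).
apply/andP; split.
- pose r := (q ts - q (pi / 2) * sin ts) / cos ts.
  pose r' := (q' ts - q' (pi / 2) * sin ts) / cos ts.
  (* Trigonometric convexity at the symmetric points ts, pi/2, pi - ts. *)
  have rr : 0 <= r + r'.
    have := @width_fun3 _ _ ts (pi / 2) (pi - ts) wq.
    rewrite (_ : pi - ts - ts = pi - 2 * ts); last by ring.
    rewrite (_ : pi - ts - pi / 2 = pi / 2 - ts); last by field.
    rewrite spi cE S2 (q'E (pi - ts)) opprB addrCA subrr addr0 => H.
    have {}H : 2 * sin ts * cos ts * q (pi / 2) <= cos ts * q ts + cos ts * q' ts.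
      by apply: H; lra.
    rewrite /r /r' q'pi -mulrDl divr_ge0//; last exact: ltW.
    by rewrite -(pmulr_rge0 _ cts); lra.
  apply: (@le_trans _ _ (
    \int[mu]_(u in `[0, pi / 2]) ((d + 1 / 2 * cos (2 * u)) * (r * cos u + q (pi / 2) * sin u)) +
    \int[mu]_(u in `[pi / 2, pi]) ((d + 1 / 2 * cos (2 * u)) * (- r' * cos u + q (pi / 2) * sin u)))).
    rewrite !hcs_integral// cos0 sin0 cos_pihalf sin_pihalf cospi sinpi.
    rewrite -subr_ge0 (_ : _ - _ = (r + r') * (d + 1 / 6)); last by field.
    by rewrite mulr_ge0//; lra.
  apply: lerD; (apply: le_Rintegral => //; do 1?[exact: continuous_integrable]) => u.
    rewrite /= in_itv/= => /andP[u0 u1]; rewrite (addrC (r * _)).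
    exact: (crossing_ge ts0 ts1 c2ts wq u0 u1).
  rewrite /= in_itv/= => /andP[u0 u1].
  have v0 : 0 <= pi - u by lra.
  have v1 : pi - u <= pi / 2 by lra.
  have := crossing_ge ts0 ts1 c2ts wq' v0 v1.
  by rewrite -hpi -q'E q'pi cpi spi mulrN -mulNr (addrC (q (pi / 2) * _)) /r' q'pi.
- pose k := (q ts - q 0 * cos ts) / sin ts.
  pose k' := (q' ts - q' 0 * cos ts) / sin ts.
  (* Trigonometric convexity at the symmetric points -ts, 0, ts. *)
  have kk : 0 <= k + k'.
    have := @width_fun3 _ _ (- ts) 0 ts wq.
    rewrite subr0 !opprK add0r (_ : ts + ts = 2 * ts); last by ring.
    rewrite S2 => H.
    have {}H : 2 * sin ts * cos ts * q 0 <= sin ts * q' ts + sin ts * q ts.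
      by apply: H; lra.
    rewrite /k /k' q'0 -mulrDl divr_ge0//; last exact: ltW.
    by rewrite -(pmulr_rge0 _ sts); lra.
  apply: (@le_trans _ _ (
    \int[mu]_(u in `[0, pi / 2]) ((d + 1 / 2 * cos (2 * u)) * (q 0 * cos u + k * sin u)) +
    \int[mu]_(u in `[pi / 2, pi]) ((d + 1 / 2 * cos (2 * u)) * (- q 0 * cos u + k' * sin u)))); last first.
    rewrite !hcs_integral// cos0 sin0 cos_pihalf sin_pihalf cospi sinpi.
    rewrite -subr_ge0 (_ : _ - _ = (k + k') * (1 / 6 - d)); last by field.
    by rewrite mulr_ge0//; lra.
  apply: lerD; (apply: le_Rintegral => //; do 1?[exact: continuous_integrable]) => u.
    rewrite /= in_itv/= => /andP[u0 u1].
    exact: (crossing_le ts0 ts1 c2ts wq u0 u1).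
  rewrite /= in_itv/= => /andP[u0 u1].
  have v0 : 0 <= pi - u by lra.
  have v1 : pi - u <= pi / 2 by lra.
  have := crossing_le ts0 ts1 c2ts wq' v0 v1.
  by rewrite -hpi -q'E q'0 cpi spi mulrN -mulNr /k' q'0.
Qed.

End width_mean.

(** * The second moment inequality *)

Section second_moment.
Context {R : realType}.
Notation mu := (@lebesgue_measure R).

(** Two steps: completing a square removes [ft], and then [q] is lowered to [v]. In terms of y =
    |hh| sqrt q the function 2 c y - y^2 / 3 increases as long as y <= 3 c, which is the last
    hypothesis. *)
Lemma second_moment_pointwise (hh q v P ft c : R) :
  0 < ft -> 0 <= c -> 0 <= v -> v <= q -> P <= `|hh| ->
  `|hh| * Num.sqrt q <= 3 * c ->
  1 / 3 * hh ^+ 2 * q + 2 * c * P * Num.sqrt v - 1 / 3 * hh ^+ 2 * v <=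
  hh ^+ 2 * q / ft + c ^+ 2 * ft.
Proof.
move=> f0 c0 v0 vq Ph hc.
have q0 : 0 <= q by exact: le_trans vq.
have sv : Num.sqrt v <= Num.sqrt q by rewrite ler_sqrt.
have h2 : hh ^+ 2 = `|hh| ^+ 2 by rewrite real_normK ?num_real.
have hn : 0 <= `|hh| by [].
have [s0 r0] := (sqrtr_ge0 q, sqrtr_ge0 v).
have Eq : q = Num.sqrt q ^+ 2 by rewrite sqr_sqrtr.
have Ev : v = Num.sqrt v ^+ 2 by rewrite sqr_sqrtr.
move: (Num.sqrt q) (Num.sqrt v) `|hh| s0 r0 sv hc hn h2 Ph Eq Ev => s r a s0 r0 rs ac a0 -> Pa -> ->.
have H1 : 2 * c * (a * s) <= a ^+ 2 * s ^+ 2 / ft + c ^+ 2 * ft.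
  rewrite -subr_ge0 (_ : _ - _ = (a * s - c * ft) ^+ 2 / ft).
    by rewrite divr_ge0 ?sqr_ge0// ltW.
  by field; rewrite gt_eqF.
apply: le_trans H1.
have H2 : 2 * c * P * r <= 2 * c * (a * r).
  rewrite -mulrA ler_wpM2l// ?mulr_ge0// ler_wpM2r//.
(* Three times the increment of 2 c y - y^2 / 3 from y = a r to y = a s. *)
have H3 : 0 <= (a * s - a * r) * (6 * c - a * s - a * r).
  have ar : a * r <= a * s by rewrite ler_wpM2l.
  by apply: mulr_ge0; lra.
lra.
Qed.

(** [L] may be negative and [G] may have infinite integral, so the comparison passes through max (L,
    0) and takes place in the extended reals. *)
Lemma ae_le_Rintegral_ge0 (L G : R -> R) : continuous L ->
  measurable_fun `[0, pi] G -> (forall x, 0 <= G x) ->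
  {ae mu, forall x, x \in [set` `[0, pi]] -> L x <= G x} ->
  ((\int[mu]_(x in `[0, pi]) L x)%:E <= \int[mu]_(x in `[0%R, pi]) (G x)%:E)%E.
Proof.
move=> cL mG G0 LG.
have iL : mu.-integrable `[0, pi] (EFin \o L) by exact: continuous_integrable.
have mL : measurable_fun `[0, pi] L.
  by apply: measurable_funTS; exact: continuous_measurable_fun.
rewrite /Rintegral fineK ?integrable_fin_num//.
apply: (@le_trans _ _ (\int[mu]_(x in `[0%R, pi]) (Num.max (L x) 0)%:E)%E).
  have cm : continuous (fun x => Num.max (L x) 0).
    move=> x; exact: (continuous_max (cL x) (cvg_cst _)).
  apply: le_integral => //; first exact: continuous_integrable.
  by move=> x _; rewrite lee_fin le_max lexx.
apply: ae_ge0_le_integral => //.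
- by move=> x _; rewrite lee_fin le_max lexx orbT.
- by apply/measurable_EFinP; apply: measurable_maxr.
- by move=> x _; rewrite lee_fin.
- exact/measurable_EFinP.
- case: LG => N [mN N0 LGN]; exists N; split => // x nLG.
  apply: LGN => /= LGx; apply: nLG => /= xD.
  by rewrite lee_fin ge_max G0 andbT; exact/LGx/mem_set.
Qed.

Lemma continuous_weight_cospoly nu (w : R -> R) p (al eta : R) :
  sin_weight nu w ->
  continuous (fun t => w (t - al) * cospoly p (2 * (t - eta))).
Proof.
move=> hw; pose g x := w x * csum (fun k => cos (k%:R * (2 * (x + (al - eta))))) 0 p.
have -> : (fun t => w (t - al) * cospoly p (2 * (t - eta))) = (fun t => g (t - al)).
  apply/funext => t; rewrite /g; congr (_ * _); apply: eq_csum => k.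
  by congr cos; ring.
move=> t; apply: (@continuous_comp _ _ _ (fun t : R => t - al) g).
  by apply: cvgB; [exact: cvg_id|exact: cvg_cst].
exact: (continuous_csum hw).
Qed.

Lemma measurable_fun_ge0_inv d' (T : measurableType d') (D : set T) (f : T -> R) :
  (forall t, 0 <= f t) -> measurable_fun D f ->
  measurable_fun D (fun t => (f t)^-1).
Proof.
move=> f0 mf.
have -> : (fun t => (f t)^-1) = (@powR R ^~ (-1)) \o f.
  by apply/funext => t /=; rewrite powR_inv1.
exact: measurableT_comp.
Qed.

Let c' : R := 42 / 100.

Lemma mompoly_hsq_ge0 (d x : R) : -1 <= x <= 1 -> 0 <= mompoly 1 (hsqcoef d) x.
Proof.
move=> /andP[x1 x2]; rewrite mompoly_hsq.
have : x ^+ 2 <= 1 by nra.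
by have := sqr_ge0 (d - x / 6); nra.
Qed.

(** Pure algebra for z = 4 / pi. The two hypotheses are the losses from replacing the integral [I]
    of sqrt |sin| by its numerical lower bound and pi by 22/7. *)
Lemma second_moment_combine (z rho Q S I A : R) :
  0 <= z * rho * (c' * Q * (I - 2 * (1493 / 1250))) ->
  0 <= (z * (11 / 21) - 2 / 3) * (rho * S) ->
  1 / 3 * A + z * rho * (2 * (42 / 100) * (1493 / 1250) * Q - (42 / 100) ^+ 2
    - 22 / 42 * S) <=
  1 / 3 * A + z * c' * rho * (Q * I) - 1 / 3 * rho * (S * 2) -
    z * c' ^+ 2 * rho.
Proof.
move=> H1 H2; rewrite -subr_ge0.
apply: le_trans (addr_ge0 H1 H2) _; rewrite le_eqVlt; apply/orP; left.
by apply/eqP; rewrite /c'; field.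
Qed.

(* The weight [c] of the Cauchy-Schwarz inequality
   [h^2 q / f >= 2 c |h| sqrt q - c^2 f] is chosen so large that
   [2 c |h| sqrt q - h^2 q / 3] increases with [q]; thus [q] may be replaced by
   the width of a single segment. *)
Lemma second_moment_segment (d eta rho al M : R) (p : seq R) (q f : R -> R) :
  0 <= d <= 1 / 6 ->
  (forall x, -1 <= x <= 1 -> chebpoly p x <= `|d + 1 / 2 * x|) ->
  width_fun q -> (forall t, q t <= M) ->
  0 <= rho -> (forall t, rho * `|sin (t - al)| <= q t) ->
  M * (22 / 7) ^+ 2 / 81 <= c' ^+ 2 * rho ->
  0 < gain p d (cos (2 * (al - eta))) ->
  measurable_fun `[0, pi] f -> (forall t, 0 <= f t) ->
  (\int[mu]_(t in `[0%R, pi]) (f t)%:E = pi%:E)%E ->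
  {ae mu, forall t, t \in [set` `[0, pi]] -> f t != 0} ->
  ((1 / 3 * \int[mu]_(t in `[0, pi]) ((d + 1 / 2 * cos (2 * (t - eta))) ^+ 2 * q t) +
    4 / pi * rho * gain p d (cos (2 * (al - eta))))%:E <=
   \int[mu]_(t in `[0%R, pi])
     ((d + 1 / 2 * cos (2 * (t - eta))) ^+ 2 * q t / f t)%:E)%E.
Proof.
move=> d01 Pp wq qM rho0 qrho Mrho gain0 mf f0 intf f_neq0.
have p0 := pi_gt0 R.
have pn0 : pi != 0 :> R by exact: lt0r_neq0.
pose h t := d + 1 / 2 * cos (2 * (t - eta)).
(* The factor sqrt rho makes every term produced by the segment linear in [rho], and 2 / pi lets 4 /
   pi be factored out of the Cauchy-Schwarz terms. *)
pose c := 2 / pi * c' * Num.sqrt rho.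
have c0 : 0 <= c by rewrite /c !mulr_ge0 ?sqrtr_ge0 ?invr_ge0 ?(ltW p0)// /c'; lra.
pose v t := rho * `|sin (t - al)|.
pose P t := cospoly p (2 * (t - eta)).
pose L t := 1 / 3 * (h t ^+ 2 * q t) + 2 * c * Num.sqrt rho * (Num.sqrt `|sin (t - al)| * P t)
  - 1 / 3 * rho * (`|sin (t - al)| * cospoly (hsqcoef d) (2 * (t - eta))).
have cos1 (x : R) : -1 <= cos x <= 1 by rewrite cos_geN1 cos_le1.
have hle t : `|h t| <= 2 / 3.
  by have := cos1 (2 * (t - eta)); rewrite ler_norml /h; lra.
(* The range in which the pointwise bound is monotone. With |h| <= 2/3, q <= M and pi <= 22/7, its
   square reduces to the hypothesis relating [M] and [rho]. *)
have hq t : `|h t| * Num.sqrt (q t) <= 3 * c.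
  have q0 : 0 <= q t by exact: width_fun_ge0.
  have hs0 : 0 <= `|h t| * Num.sqrt (q t) by rewrite mulr_ge0 ?sqrtr_ge0.
  have c30 : 0 <= 3 * c by rewrite mulr_ge0.
  rewrite -ler_sqr ?nnegrE// exprMn sqr_sqrtr// /c !exprMn sqr_sqrtr// -(ler_pM2r (exprn_gt0 2 p0)).
  have E (z : R) : z != 0 -> 3 ^+ 2 * (2 ^+ 2 * z^-1 ^+ 2 *
      (42 ^+ 2 * 100^-1 ^+ 2) * rho) * z ^+ 2 = 36 * (c' ^+ 2 * rho).
    by move=> z0; rewrite /c'; field.
  rewrite E//.
  have h2 : `|h t| ^+ 2 <= 4 / 9 by have := hle t; have := normr_ge0 (h t); nra.
  have M0 : 0 <= M by exact: le_trans q0 (qM t).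
  have hqM : `|h t| ^+ 2 * q t <= 4 / 9 * M by rewrite ler_pM ?sqr_ge0.
  have pi2 : pi ^+ 2 <= (22 / 7) ^+ 2 :> R by have := pi_le_22_7 (R := R); nra.
  apply: (@le_trans _ _ (4 / 9 * M * (22 / 7) ^+ 2)); last by lra.
  apply: ler_pM => //; first by rewrite mulr_ge0// exprn_ge0.
  exact: sqr_ge0.
have LG t : 0 < f t -> L t <= h t ^+ 2 * q t / f t + c ^+ 2 * f t.
  move=> ft0.
  have v0 : 0 <= v t by rewrite mulr_ge0.
  have Pt : P t <= `|h t| by rewrite /P cospolyE; exact: Pp.
  have := second_moment_pointwise ft0 c0 v0 (qrho t) Pt (hq t).
  apply: le_trans.
  by rewrite /L hsqcoefE -/(h t) /v sqrtrM//; lra.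
have cq : continuous q by case: wq.
have cP := @continuous_weight_cospoly _ _ p al eta (@sin_weight_sqrt R).
have cS := @continuous_weight_cospoly _ _ (hsqcoef d) al eta (@sin_weight_norm R).
have ch : continuous h.
  move=> t; apply: cvgD; first exact: cvg_cst.
  apply: cvgM; first exact: cvg_cst.
  apply: (@continuous_comp _ _ _ (fun u : R => 2 * (u - eta)) (@cos R)).
    apply: cvgM; first exact: cvg_cst.
    by apply: cvgB; [exact: cvg_id|exact: cvg_cst].
  exact: continuous_cos.
have chq : continuous (fun t => h t ^+ 2 * q t).
  by move=> t; apply: cvgM; [apply: cvgM; exact: ch|exact: cq].
have cMl (k : R) (g : R -> R) : continuous g -> continuous (fun t => k * g t).
  by move=> cg t; apply: cvgM; [exact: cvg_cst|exact: cg].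
have cL : continuous L.
  by move=> t; apply: cvgB; [apply: cvgD; [exact: (cMl _ _ chq)|exact: (cMl _ _ cP)]|exact: (cMl _ _ cS)].
have Eint : \int[mu]_(t in `[0, pi]) L t =
    1 / 3 * \int[mu]_(t in `[0, pi]) (h t ^+ 2 * q t) +
    2 * c * Num.sqrt rho * (mompoly (1 / 2) p (cos (2 * (al - eta))) *
      \int[mu]_(t in `[0, pi]) Num.sqrt `|sin t|) -
    1 / 3 * rho * (mompoly 1 (hsqcoef d) (cos (2 * (al - eta))) * 2).
  rewrite RintegralB//; last 2 first.
  - by apply: continuous_integrable => t; apply: cvgD; [exact: (cMl _ _ chq)|exact: (cMl _ _ cP)].
  - exact/continuous_integrable/(cMl _ _ cS).
  rewrite RintegralD//; last 2 first.
  - exact/continuous_integrable/(cMl _ _ chq).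
  - exact/continuous_integrable/(cMl _ _ cP).
  rewrite !RintegralZl//; do 3?[exact: continuous_integrable].
  by rewrite (moment_cospoly (@sin_weight_sqrt R)) (moment_cospoly (@sin_weight_norm R)) Rintegral_normsin.
have mG : measurable_fun `[0, pi] (fun t => h t ^+ 2 * q t / f t).
  apply: measurable_funM; last exact: measurable_fun_ge0_inv.
  by apply: measurable_funTS; exact: continuous_measurable_fun.
have G0 t : 0 <= h t ^+ 2 * q t / f t.
  by rewrite divr_ge0// mulr_ge0 ?sqr_ge0//; exact: width_fun_ge0.
have cf0 t : 0 <= c ^+ 2 * f t by rewrite mulr_ge0 ?sqr_ge0.
have mcf : measurable_fun `[0, pi] (fun t => c ^+ 2 * f t).
  exact: measurable_funM.
(* The extra term c^2 f has integral c^2 pi for every density; this is how the unknown [f] leaves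
   the bound. *)
have : ((\int[mu]_(t in `[0, pi]) L t)%:E <=
    \int[mu]_(t in `[0%R, pi]) (h t ^+ 2 * q t / f t + c ^+ 2 * f t)%:E)%E.
  apply: ae_le_Rintegral_ge0 => //.
  - exact: measurable_funD.
  - by move=> t; rewrite addr_ge0.
  - case: f_neq0 => N [mN N0 fN]; exists N; split => // t nLG.
    apply: fN => /= fn0; apply: nLG => /= tD.
    by apply: LG; rewrite lt_neqAle f0 andbT eq_sym fn0.
under eq_integral do rewrite EFinD.
rewrite ge0_integralD//=; last 4 first.
- by move=> t _; rewrite lee_fin.
- exact/measurable_EFinP.
- by move=> t _; rewrite lee_fin.
- exact/measurable_EFinP.
under [X in (_ <= _ + X)%E]eq_integral do rewrite EFinM.
rewrite ge0_integralZl//; last 3 first.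
- exact/measurable_EFinP.
- by move=> t _; rewrite lee_fin.
- by rewrite lee_fin sqr_ge0.
rewrite intf -EFinM -leeBlDr// -EFinB; apply: le_trans; rewrite lee_fin Eint.
have S0 : 0 <= mompoly 1 (hsqcoef d) (cos (2 * (al - eta))).
  exact: mompoly_hsq_ge0.
have I0 := @Rintegral_sqrt_normsin_ge R.
rewrite -/h; move: gain0; rewrite /gain.
move: (mompoly 1 _ _) (mompoly (1 / 2) _ _) (\int[_]_(_ in _) Num.sqrt _) S0 I0 => S Q I S0 I0 gain0.
set A := \int[_]_(_ in _) _.
have Q0 : 0 <= Q by lra.
have -> : 2 * c * Num.sqrt rho = 4 / pi * c' * rho.
  by rewrite /c -[in RHS](sqr_sqrtr rho0); ring.
have -> : c ^+ 2 * pi = 4 / pi * c' ^+ 2 * rho.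
  rewrite /c !exprMn sqr_sqrtr//.
  have E (z k : R) : z != 0 -> 2 ^+ 2 * z^-1 ^+ 2 * k * rho * z = 4 / z * k * rho.
    by move=> z0; field.
  by rewrite E.
have pip : 2 / 3 <= 4 / pi * (11 / 21) :> R.
  rewrite mulrAC ler_pdivlMr//; have := pi_le_22_7 (R := R); lra.
have H1 : 0 <= 4 / pi * rho * (c' * Q * (I - 2 * (1493 / 1250))).
  have c'0 : 0 <= c' by rewrite divr_ge0.
  have I1 : 0 <= I - 2 * (1493 / 1250) by rewrite subr_ge0.
  have z0 : 0 <= 4 / pi :> R by rewrite divr_ge0// ltW.
  exact: (mulr_ge0 (mulr_ge0 z0 rho0) (mulr_ge0 (mulr_ge0 c'0 Q0) I1)).
have H2 : 0 <= (4 / pi * (11 / 21) - 2 / 3) * (rho * S).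
  by apply: (mulr_ge0 _ (mulr_ge0 rho0 S0)); rewrite subr_ge0; exact: pip.
exact: second_moment_combine H1 H2.
Qed.

End second_moment.

Section second_moment_gt.
Context {R : realType}.
Notation mu := (@lebesgue_measure R).

(** The maximal width is the diameter: a segment attaining the maximum has its own largest width
    [rho] at al + pi/2, which is at most the maximum, while the maximum is [rho] times a sine. *)
Lemma width_fun_max (q : R -> R) : width_fun q -> exists M al,
  (forall t, q t <= M) /\ (forall t, M * `|sin (t - al)| <= q t).
Proof.
move=> wq; have [cq pq sq] := wq.
have [t0 _ qt0] := EVT_max (pi_ge0 R) (continuous_subspaceT cq).
have qmax t : q t <= q t0.
  have [k k0 k1] := periodic_repr t.
  have := qt0 (t - k%:~R * pi); rewrite in_itv/= k0 (ltW k1) => /(_ isT).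
  by rewrite -(pi_periodicz pq _ k) subrK.
have [rho [al [rho0 qt0E qrho]]] := sq t0.
exists (q t0), al; split => // t.
suff -> : q t0 = rho by exact: qrho.
apply/eqP; rewrite eq_le; apply/andP; split.
  rewrite qt0E ler_piMr// ler_norml sin_geN1 sin_le1//.
apply: le_trans (qmax (al + pi / 2)); apply: le_trans (qrho _).
by rewrite addrAC subrr add0r sin_pihalf normr1 mulr1.
Qed.

Lemma width_mean_shift (d eta : R) q : 0 <= d <= 1 / 6 -> width_fun q ->
  2 * (d - 1 / 6) * q (eta + pi / 2) <=
  \int[mu]_(t in `[0, pi]) ((d + 1 / 2 * cos (2 * (t - eta))) * q t) <=
  2 * (d + 1 / 6) * q eta.
Proof.
move=> d01 wq; have [cq pq _] := wq.
pose g t := (d + 1 / 2 * cos (2 * (t - eta))) * q t.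
have cg : continuous g.
  move=> t; apply: cvgM; last exact: cq.
  apply: cvgD; first exact: cvg_cst.
  apply: cvgM; first exact: cvg_cst.
  apply: (@continuous_comp _ _ _ (fun u : R => 2 * (u - eta)) (@cos R)).
    apply: cvgM; first exact: cvg_cst.
    by apply: cvgB; [exact: cvg_id|exact: cvg_cst].
  exact: continuous_cos.
have pg : pi_periodic g.
  move=> t; rewrite /g pq; congr ((_ + _ * _) * _).
  by rewrite -[RHS]cosD2pi; congr cos; rewrite mulr2n; ring.
rewrite -(Rintegral_periodic eta cg pg) /g.
under eq_Rintegral do rewrite addrK.
have := width_mean d01 (width_fun_shift eta wq).
by rewrite add0r (addrC (pi / 2)).
Qed.

(* [second_moment_segment] is applied to a diameter of the body, except when
   [d = 1 / 6] and the mean may be large because [q eta] is close to the maximal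
   width [M]: then it is applied to the segment realizing [q eta]. *)
Lemma second_moment_gt (d eta : R) (q f : R -> R) :
  d = 0 \/ d = 1 / 6 ->
  width_fun q -> (forall t, q t <= 1) -> (exists t, 0 < q t) ->
  measurable_fun `[0, pi] f -> (forall t, 0 <= f t) ->
  (\int[mu]_(t in `[0%R, pi]) (f t)%:E = pi%:E)%E ->
  {ae mu, forall t, t \in [set` `[0, pi]] -> f t != 0} ->
  let h t := d + 1 / 2 * cos (2 * (t - eta)) in
  exists2 B : R,
    1 / 3 * \int[mu]_(t in `[0, pi]) (h t ^+ 2 * q t) +
      2 / 3 / pi * (\int[mu]_(t in `[0, pi]) (h t * q t)) ^+ 2 < B &
    (B%:E <= \int[mu]_(t in `[0%R, pi]) (h t ^+ 2 * q t / f t)%:E)%E.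
Proof.
move=> d01 wq q1 [tp qtp] mf f0 intf f_neq0 h; have p0 := pi_gt0 R.
have [M [al [qM Mq]]] := width_fun_max wq.
have M0 : 0 < M by exact: lt_le_trans (qM tp).
have M1 : M <= 1.
  have := Mq (al + pi / 2).
  rewrite addrAC subrr add0r sin_pihalf normr1 mulr1 => H.
  exact: le_trans H (q1 _).
have cos1 (x : R) : -1 <= cos x <= 1 by rewrite cos_geN1 cos_le1.
have MM : M * (22 / 7) ^+ 2 / 81 <= (42 / 100) ^+ 2 * M by lra.
have iVp : 0 < pi^-1 :> R by rewrite invr_gt0.
case: d01 => d_eq; subst d; set m := \int[mu]_(t in _) (h t * q t);
  set A := \int[mu]_(t in _) (h t ^+ 2 * q t).
- have d01 : 0 <= (0 : R) <= 1 / 6 by rewrite lexx divr_ge0.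
  have G := gain_qcoef (cos1 (2 * (al - eta))).
  have G0 : 0 < gain qcoef 0 (cos (2 * (al - eta))) by lra.
  exists (1 / 3 * A + 4 / pi * M * gain qcoef 0 (cos (2 * (al - eta)))); last first.
    exact: (second_moment_segment d01 (@qcoef_le R) wq qM (ltW M0) Mq MM G0).
  rewrite ltrD2l.
  have /andP[] := width_mean_shift eta d01 wq; rewrite -/m => m1 m2.
  have qx := qM eta; have qy := qM (eta + pi / 2).
  have mM : m ^+ 2 <= (M / 3) ^+ 2 by nra.
  (* Here M <= 1 lowers the degree, making the squared mean comparable with the gain, which is
     linear in [M]. *)
  have {}mM : m ^+ 2 <= M / 9 by nra.
  rewrite (_ : 2 / 3 / pi * m ^+ 2 = pi^-1 * (2 / 3 * m ^+ 2)); last by ring.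
  rewrite (_ : 4 / pi * M * _ = pi^-1 * (4 * M * gain qcoef 0 (cos (2 * (al - eta))))); last by ring.
  rewrite ltr_pM2l//; nra.
- have d01 : 0 <= (1 / 6 : R) <= 1 / 6 by rewrite lexx divr_ge0.
  have /andP[] := width_mean_shift eta d01 wq; rewrite -/m => m1 m2.
  have x0 := width_fun_ge0 eta wq.
  have mx : m ^+ 2 <= (2 / 3 * q eta) ^+ 2 by nra.
  (* In the first case the mean is small enough for the uniform gain of the diameter. In the second,
     the segment attaining q(eta) has length more than M / sqrt 2, long enough for the monotonicity
     condition. *)
  have [xM|Mx] := leP (2 * q eta ^+ 2) (M ^+ 2).
  + have [G _] := gain_pcoef (cos1 (2 * (al - eta))).
    have G0 : 0 < gain pcoef (1 / 6) (cos (2 * (al - eta))) by lra.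
    exists (1 / 3 * A + 4 / pi * M * gain pcoef (1 / 6) (cos (2 * (al - eta)))); last first.
      exact: (second_moment_segment d01 (@pcoef_le R) wq qM (ltW M0) Mq MM G0).
    rewrite ltrD2l.
    have {}mx : m ^+ 2 <= 2 / 9 * M by nra.
    rewrite (_ : 2 / 3 / pi * m ^+ 2 = pi^-1 * (2 / 3 * m ^+ 2)); last by ring.
    rewrite (_ : 4 / pi * M * _ = pi^-1 * (4 * M * gain pcoef (1 / 6) (cos (2 * (al - eta))))); last by ring.
    rewrite ltr_pM2l//; nra.
  + have [_ _ /(_ eta)[rho [be [rho0 qE qrho]]]] := wq.
    have rhoM : rho <= M.
      apply: le_trans (qM (be + pi / 2)); apply: le_trans (qrho _).
      by rewrite addrAC subrr add0r sin_pihalf normr1 mulr1.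
    (* The half-angle formula puts q(eta) in the variable of the gain polynomial, so that both sides
       carry the factor 1 - cos (2 (be - eta)). *)
    have x2 : q eta ^+ 2 = rho ^+ 2 * ((1 - cos (2 * (be - eta))) / 2).
      rewrite qE exprMn real_normK ?num_real//; congr (_ * _).
      rewrite -opprB sinN sqrrN mulr_natl mulr2n cosD -!expr2 cos2sin2.
      by field.
    have [G1 G2] := gain_pcoef (cos1 (2 * (be - eta))).
    have /andP[C1 C2] := cos1 (2 * (be - eta)).
    have G0 : 0 < gain pcoef (1 / 6) (cos (2 * (be - eta))) by lra.
    have C20 : 0 <= rho ^+ 2 by exact: sqr_ge0.
    have Mr : M ^+ 2 < 2 * rho ^+ 2.
      apply: lt_le_trans Mx _; rewrite x2.
      move: (cos _) (rho ^+ 2) C1 C2 C20 => C r2 C1 C2 C20; nra.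
    have r0 : 0 < rho.
      rewrite lt_neqAle rho0 andbT eq_sym; apply/eqP => rE.
      by move: Mr; rewrite rE expr0n/= mulr0 ltNge sqr_ge0.
    (* 36/25 is a rational just above sqrt 2, still small enough for the numerical condition on the
       next lines. *)
    have Mr2 : M <= 36 / 25 * rho.
      by clear -Mr r0 M0; nra.
    have MMr : M * (22 / 7) ^+ 2 / 81 <= (42 / 100) ^+ 2 * rho.
      by clear -Mr2 r0; lra.
    exists (1 / 3 * A + 4 / pi * rho * gain pcoef (1 / 6) (cos (2 * (be - eta)))); last first.
      exact: (second_moment_segment d01 (@pcoef_le R) wq qM rho0 qrho MMr G0).
    rewrite ltrD2l.
    rewrite (_ : 2 / 3 / pi * m ^+ 2 = pi^-1 * (2 / 3 * m ^+ 2)); last by ring.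
    rewrite (_ : 4 / pi * rho * _ = pi^-1 * (4 * rho * gain pcoef (1 / 6) (cos (2 * (be - eta))))); last by ring.
    rewrite ltr_pM2l//; move: mx; rewrite exprMn x2.
    have r1 : rho <= 1 by exact: le_trans rhoM M1.
    move: (cos _) (gain _ _ _) C1 C2 G2 => C G C1 C2 G2 mx.
    have rr : rho ^+ 2 * (1 - C) <= rho * (1 - C).
      by rewrite ler_wpM2r ?subr_ge0// expr2 ler_piMr.
    have rG : rho * (1 - C) < 27 * rho * G.
      rewrite (_ : 27 * rho * G = rho * (27 * G)); last by ring.
      by rewrite ltr_pM2l//; clear -G2; lra.
    clear -mx rr rG; move: (m ^+ 2) mx => mm mx; lra.
Qed.

End second_moment_gt.

(** * Coordinates on the spaces of lines *)

Section coordinates.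
Context {R : realType}.
Implicit Types (x y u v : plane R) (t s : R).

Lemma plane_ext x y : x ord0 ord0 = y ord0 ord0 ->
  x ord0 ord_max = y ord0 ord_max -> x = y.
Proof.
move=> e0 e1; apply/rowP => i; case: (unliftP ord0 i) => [j ->|->//].
by rewrite (ord1 j) (_ : lift ord0 ord0 = ord_max)//; exact: val_inj.
Qed.

(** The inner product of [x] with [normal_dir t], hence the signed distance of [x] from the line
    through the origin in direction [t]. *)
Definition dotn t x : R := cos t * x ord0 ord_max - sin t * x ord0 ord0.

Lemma dotnD t x y : dotn t (x + y) = dotn t x + dotn t y.
Proof. by rewrite /dotn !mxE; ring. Qed.

Lemma dotnZ t (a : R) x : dotn t (a *: x) = a * dotn t x.
Proof. by rewrite /dotn !mxE; ring. Qed.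

Lemma dotnB t x y : dotn t (x - y) = dotn t x - dotn t y.
Proof. by rewrite /dotn !mxE; ring. Qed.

Lemma dotn_pi t x : dotn (t + pi) x = - dotn t x.
Proof. by rewrite /dotn sinDpi cosDpi; ring. Qed.

Lemma unit_dir0 t : unit_dir t ord0 ord0 = cos t.
Proof. by rewrite mxE. Qed.

Lemma unit_dir1 t : unit_dir t ord0 ord_max = sin t.
Proof. by rewrite mxE. Qed.

Definition normal_dir t : plane R := unit_dir (t + pi / 2).

Lemma normal_dir0 t : normal_dir t ord0 ord0 = - sin t.
Proof. by rewrite unit_dir0 cosDpihalf. Qed.

Lemma normal_dir1 t : normal_dir t ord0 ord_max = cos t.
Proof. by rewrite unit_dir1 sinDpihalf. Qed.

Lemma affine_line_atP t s x : (affine_line_at (t, s) : set _) x <-> dotn t x = s.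
Proof.
have c2 := cos2Dsin2 t; split => [[a _ <-]|dx].
  rewrite /dotn !mxE /= cosDpihalf sinDpihalf.
  by rewrite -[RHS]mulr1 -c2; ring.
exists (cos t * x ord0 ord0 + sin t * x ord0 ord_max) => //=.
rewrite -dx /dotn; apply: plane_ext; rewrite !mxE /= ?cosDpihalf ?sinDpihalf.
  by rewrite -[RHS]mul1r -c2; ring.
by rewrite -[RHS]mul1r -c2; ring.
Qed.

Lemma linear_line_atP t x : (linear_line_at t : set _) x <-> dotn t x = 0.
Proof.
rewrite -affine_line_atP; split=> -[a aT <-]; exists a => //=; by rewrite scale0r.
Qed.

Lemma linear_line_at_pi t : linear_line_at (t + pi) = linear_line_at t.
Proof.
apply: linear_line_eq; apply/seteqP; split => x /linear_line_atP H;
  apply/linear_line_atP; move: H; rewrite dotn_pi; first by move/eqP; rewrite oppr_eq0 => /eqP.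
by move=> ->; rewrite oppr0.
Qed.

Lemma unit_vector_dir u : sqnorm u = 1 ->
  exists t, u = unit_dir t \/ u = - unit_dir t.
Proof.
rewrite sqnormE => u1.
have u0 : -1 <= u ord0 ord0 <= 1.
  rewrite -ler_norml -(@ler_pXn2r _ 2)// ?nnegrE// real_normK ?num_real// expr1n -u1.
  by rewrite lerDl sqr_ge0.
have c0 : cos (acos (u ord0 ord0)) = u ord0 ord0 by rewrite acosK ?in_itv.
have s0 : sin (acos (u ord0 ord0)) = `|u ord0 ord_max|.
  by rewrite sin_acos// -u1 addrAC subrr add0r sqrtr_sqr.
have [u1_ge0|u1_lt0] := leP 0 (u ord0 ord_max).
  exists (acos (u ord0 ord0)); left; apply: plane_ext.
    by rewrite unit_dir0.
  by rewrite unit_dir1 s0 ger0_norm.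
exists (- acos (u ord0 ord0)); left; apply: plane_ext.
  by rewrite unit_dir0 cosN.
by rewrite unit_dir1 sinN s0 ltr0_norm// opprK.
Qed.

Lemma linear_line_angle (L : linear_line R) :
  exists t, [/\ 0 <= t, t < pi & L = linear_line_at t].
Proof.
suff [t Lt] : exists t, L = linear_line_at t.
  have [k k0 k1] := periodic_repr t; exists (t - k%:~R * pi); split => //.
  by rewrite Lt -[RHS](pi_periodicz linear_line_at_pi _ k) subrK.
have [u u1 Lu] := linear_lineP L.
have [t ut] := unit_vector_dir u1; exists t.
apply: linear_line_eq; rewrite Lu /=.
case: ut => ->//; apply/seteqP; split => x [a _ <-]; exists (- a) => //.
  by rewrite scaleNr scalerN.
by rewrite scaleNr scalerN opprK.
Qed.

Lemma linear_line_at_dir t t' : linear_line_at t = linear_line_at t' ->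
  normal_dir t = normal_dir t' \/ normal_dir t = - normal_dir t'.
Proof.
move=> /(congr1 (@linear_line_set R)) /aline0_unit_inj.
move=> /(_ (sqnorm_unit_dir _) (sqnorm_unit_dir _)) H.
case: H => E; [left|right].
  have /(congr1 (fun u : plane R => (u ord0 ord0, u ord0 ord_max))) := E.
  rewrite !unit_dir0 !unit_dir1 => -[ec es].
  by apply: plane_ext; rewrite ?normal_dir0 ?normal_dir1 ?ec ?es.
have /(congr1 (fun u : plane R => (u ord0 ord0, u ord0 ord_max))) := E.
rewrite !mxE /= => -[ec es].
by apply: plane_ext; rewrite [in RHS]mxE !(normal_dir0, normal_dir1) ?ec ?es.
Qed.

Lemma linear_line_at_inj t t' : 0 <= t < pi -> 0 <= t' < pi ->
  linear_line_at t = linear_line_at t' -> t = t'.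
Proof.
move=> /andP[t0 tp] /andP[t'0 t'p] /linear_line_at_dir H.
have cinj : cos t = cos t' -> t = t'.
  by apply: cos_inj; rewrite in_itv/= ?t0 ?t'0 ltW.
case: H => H; first by apply: cinj; rewrite -!normal_dir1 H.
have st : sin t = - sin t'.
  by apply: oppr_inj; rewrite opprK -!normal_dir0 H mxE normal_dir0 opprK.
have s0 : 0 <= sin t by rewrite sin_ge0_pi// t0 ltW.
have s'0 : 0 <= sin t' by rewrite sin_ge0_pi// t'0 ltW.
have z (a : R) : 0 <= a -> a < pi -> sin a = 0 -> a = 0.
  move=> a0 ap sa; apply/eqP; apply: contraTT isT => an0.
  have : 0 < sin a by rewrite sin_gt0_pi// lt_neqAle eq_sym an0 a0.
  by rewrite sa ltxx.
have e : sin t = 0.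
  by apply/eqP; rewrite eq_le s0 andbT st oppr_le0 s'0.
have e' : sin t' = 0 by rewrite -[LHS]opprK -st e oppr0.
by rewrite (z _ t0 tp e) (z _ t'0 t'p e').
Qed.

(** The representative of the direction in [0, pi[. Together with [offset] it gives global
    coordinates on the affine lines, with a jump where the direction passes from pi to 0. *)
Definition angle (L : linear_line R) : R := sval (cid (linear_line_angle L)).

Lemma angleP L : [/\ 0 <= angle L, angle L < pi & L = linear_line_at (angle L)].
Proof. exact: (svalP (cid (linear_line_angle L))). Qed.

Lemma angle_at t : 0 <= t < pi -> angle (linear_line_at t) = t.
Proof.
move=> tpi; have [a0 api E] := angleP (linear_line_at t).
by apply: linear_line_at_inj => //; rewrite a0.
Qed.

Lemma parallel_at (p : R * R) : parallel (affine_line_at p) = linear_line_at p.1.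
Proof. by apply: linear_line_eq => /=; rewrite aline_diff. Qed.

Lemma affine_line_coord (E : affine_line R) :
  exists s, E = affine_line_at (angle (parallel E), s).
Proof.
have [x [u u1 Eu]] := affine_lineP E.
set t := angle _; have [_ _ Et] := angleP (parallel E).
have Lu : parallel E = aline 0 u :> set (plane R) by rewrite /= Eu aline_diff.
exists (dotn t x); apply: affine_line_eq.
have uv : aline 0 u = aline 0 (unit_dir t) by rewrite -Lu Et.
rewrite Eu; apply/seteqP; split => y.
  move=> [a _ <-]; apply/affine_line_atP; rewrite dotnD.
  suff -> : dotn t (a *: u) = 0 by rewrite addr0.
  apply/linear_line_atP; rewrite /linear_line_at/= -uv; exists a => //.
  by rewrite add0r.
move=> /affine_line_atP yx.
have : aline 0 u (y - x).
  by rewrite uv; apply/(linear_line_atP t); rewrite dotnB yx subrr.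
by move=> [a _ ayx]; exists a => //; move: ayx; rewrite add0r => ->; rewrite addrC subrK.
Qed.

Definition offset (E : affine_line R) : R := sval (cid (affine_line_coord E)).

Lemma offsetP E : E = affine_line_at (angle (parallel E), offset E).
Proof. exact: (svalP (cid (affine_line_coord E))). Qed.

(** Both sides are the foot of the perpendicular from the origin. Two parametrizations of a line
    differ by a common sign of normal and distance, which cancels in the product. *)
Lemma affine_line_at_foot t s t' s' :
  affine_line_at (t, s) = affine_line_at (t', s') ->
  s *: normal_dir t = s' *: normal_dir t'.
Proof.
move=> E; have := congr1 (@parallel R) E; rewrite !parallel_at /= => /linear_line_at_dir H.
have dn a : dotn a (normal_dir a) = 1.
  by rewrite /dotn normal_dir0 normal_dir1 -[RHS](cos2Dsin2 a); ring.
have : (affine_line_at (t, s) : set _) (s *: normal_dir t).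
  by apply/affine_line_atP; rewrite dotnZ dn mulr1.
rewrite E => /affine_line_atP <-; rewrite dotnZ.
case: H => ->; first by rewrite dn mulr1.
by rewrite -scaleN1r dotnZ dn mulr1 mulrN1 scaleN1r scalerN scaleNr.
Qed.

Lemma offset_at t s : 0 <= t < pi -> offset (affine_line_at (t, s)) = s.
Proof.
move=> t0; have := offsetP (affine_line_at (t, s)).
rewrite parallel_at angle_at//= => /(congr1 (@affine_line_set R)) E.
have : (affine_line_at (t, s) : set _) (s *: normal_dir t).
  apply/affine_line_atP; rewrite dotnZ /dotn normal_dir0 normal_dir1.
  by rewrite -[RHS]mulr1 -[in RHS](cos2Dsin2 t); ring.
by move=> H; move: (H); rewrite E => /affine_line_atP <-; apply/affine_line_atP.
Qed.

End coordinates.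

Section measurability.
Context {R : realType}.

Lemma measurable_linear_line_at :
  measurable_fun setT (linear_line_at : R -> linear_lines R).
Proof.
apply: (@measurability _ _ _ (linear_lines R) _ _ (@open_linear_lines R)) => //.
move=> _ [ U oU <-]; rewrite setTI; exact: open_measurable.
Qed.

Lemma measurable_parallel :
  measurable_fun setT (@parallel R : affine_lines R -> linear_lines R).
Proof.
apply: (@measurability _ _ _ (linear_lines R) _ _ (@open_linear_lines R)) => //.
move=> _ [ U oU <-]; rewrite setTI; apply: sub_sigma_algebra.
rewrite /open_affine_lines/=.
have -> : affine_line_at @^-1` (@parallel R @^-1` U) =
    fst @^-1` (linear_line_at @^-1` U).
  by apply/seteqP; split => p /=; rewrite parallel_at.
by apply: open_comp => // p _; exact: cvg_fst.
Qed.

Lemma measurable_affine_continuous (g : affine_line R -> R) :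
  continuous (g \o affine_line_at) ->
  measurable_fun setT (g : affine_lines R -> R).
Proof.
move=> cg; apply: (measurability (@RGenOInfty.G R)).
  exact: RGenOInfty.measurableE.
move=> _ [_ [x ->] <-]; rewrite setTI; apply: sub_sigma_algebra.
rewrite /open_affine_lines/= -comp_preimage.
by apply: open_comp => [p _|]; [exact: cg|exact: interval_open].
Qed.

(** Although [angle] jumps, its superlevel sets at heights a >= 0 avoid the jump: in the parameter
    they are the translates of ]a, pi[ by multiples of pi. *)
Lemma open_angle_gt (a : R) : 0 <= a ->
  open (linear_line_at @^-1` [set L | a < angle L]).
Proof.
move=> a0.
have -> : linear_line_at @^-1` [set L | a < angle L] =
    \bigcup_(k : int) ((fun t => t - k%:~R * pi) @^-1` `]a, pi[).
  apply/seteqP; split => t /=.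
    have [k k0 kpi] := periodic_repr t.
    rewrite -(pi_periodicz linear_line_at_pi _ (- k)) intrN mulNr angle_at ?k0// => ak.
    by exists k => //=; rewrite in_itv/= ak.
  move=> [k _] /=; rewrite in_itv/= => /andP[ak kpi].
  rewrite -(pi_periodicz linear_line_at_pi _ (- k)) intrN mulNr angle_at//.
  by rewrite (le_trans a0 (ltW ak)).
apply: bigcup_open => k _; apply: open_comp.
  move=> t _; apply: cvgB; first exact: cvg_id.
  exact: cvg_cst.
exact: interval_open.
Qed.

Lemma measurable_angle : measurable_fun setT (angle : linear_lines R -> R).
Proof.
apply: (measurability (@RGenOInfty.G R)).
  exact: RGenOInfty.measurableE.
move=> _ [_ [a ->] <-]; rewrite setTI.
have [a0|a0] := leP 0 a.
  apply: sub_sigma_algebra; rewrite /open_linear_lines/=.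
  have -> : angle @^-1` `]a, +oo[ = [set L | a < angle L].
    by apply/seteqP; split => L /=; rewrite in_itv/= andbT.
  exact: open_angle_gt.
rewrite (_ : _ @^-1` _ = setT); first exact: measurableT.
apply/seteqP; split => // L _ /=; rewrite in_itv/= andbT.
by have [A0 _ _] := angleP L; exact: lt_le_trans a0 A0.
Qed.

(** The foot of the perpendicular from the origin. Unlike [offset], which changes sign where the
    angle jumps, it depends continuously on the line; [offset] is recovered from it and the
    measurable [angle]. *)
Let foot (E : affine_line R) : plane R :=
  offset E *: normal_dir (angle (parallel E)).

Let foot_at t s : foot (affine_line_at (t, s)) = s *: normal_dir t.
Proof. by apply: affine_line_at_foot; rewrite -offsetP. Qed.

Lemma measurable_offset : measurable_fun setT (offset : affine_lines R -> R).
Proof.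
have m0 : measurable_fun setT ((fun E => foot E ord0 ord0) : affine_lines R -> R).
  apply: measurable_affine_continuous => -[t s].
  have -> : (fun E => foot E ord0 ord0) \o affine_line_at =
      (fun p : R * R => - (p.2 * sin p.1)).
    by apply/funext => -[a b] /=; rewrite foot_at mxE normal_dir0 mulrN.
  apply: cvgN; apply: cvgM; first exact: cvg_snd.
  apply: (@continuous_comp _ _ _ (@fst R R) (@sin R)); first exact: cvg_fst.
  exact: continuous_sin.
have m1 : measurable_fun setT ((fun E => foot E ord0 ord_max) : affine_lines R -> R).
  apply: measurable_affine_continuous => -[t s].
  have -> : (fun E => foot E ord0 ord_max) \o affine_line_at =
      (fun p : R * R => p.2 * cos p.1).
    by apply/funext => -[a b] /=; rewrite foot_at mxE normal_dir1.
  apply: cvgM; first exact: cvg_snd.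
  apply: (@continuous_comp _ _ _ (@fst R R) (@cos R)); first exact: cvg_fst.
  exact: continuous_cos.
have -> : offset = (fun E => cos (angle (parallel E)) * foot E ord0 ord_max -
    sin (angle (parallel E)) * foot E ord0 ord0).
  apply/funext => E; rewrite /foot !mxE /=.
  set t := angle _; rewrite cosDpihalf sinDpihalf -[LHS]mulr1 -[in LHS](cos2Dsin2 t).
  by ring.
have mt : measurable_fun setT ((fun E => angle (parallel E)) : affine_lines R -> R).
  apply: (measurableT_comp measurable_angle); exact: measurable_parallel.
have mc : measurable_fun setT (@cos R) by exact: continuous_measurable_fun (@continuous_cos R).
have ms : measurable_fun setT (@sin R) by exact: continuous_measurable_fun (@continuous_sin R).
by apply: measurable_funB; apply: measurable_funM => //; exact: measurableT_comp.
Qed.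

End measurability.

(** * Support functions *)

Section support.
Context {R : realType}.
Implicit Types (x y v : plane R) (K : set (plane R)) (t s r : R).

Lemma dotn_continuous t : continuous (dotn t).
Proof.
have c i : continuous (fun x : plane R => x ord0 i) by exact: coord_continuous.
have cZ a i : continuous (fun x : plane R => a * x ord0 i).
  move=> x; apply: (@continuous_comp _ _ _ (fun x : plane R => x ord0 i) ( *%R a)).
    exact: c.
  exact: mulrl_continuous.
move=> x; exact: (continuousB (@cZ (cos t) ord_max x) (@cZ (sin t) ord0 x)).
Qed.

Lemma dotn_sqnorm t x : dotn t x ^+ 2 <= sqnorm x.
Proof.
rewrite /dotn sqnormE -subr_ge0.
rewrite (_ : _ - _ = (cos t * x ord0 ord0 + sin t * x ord0 ord_max) ^+ 2).
  exact: sqr_ge0.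
rewrite -[X in X - _]mulr1 -(cos2Dsin2 t); ring.
Qed.

Lemma hitting_disc r t s : 0 <= r ->
  hitting (disc r) (affine_line_at (t, s)) <-> `|s| <= r.
Proof.
move=> r0; split => [[x [/affine_line_atP <- /= xr]]|sr].
  rewrite -ler_sqr ?nnegrE// real_normK ?num_real//.
  exact: le_trans (dotn_sqnorm t x) xr.
exists (s *: normal_dir t); split.
  by exists 0; rewrite //= scale0r addr0.
rewrite /disc/= sqnormE !mxE /= cosDpihalf sinDpihalf !exprMn sqrrN -mulrDr.
by rewrite addrC cos2Dsin2 mulr1 -(real_normK (num_real s)) ler_sqr ?nnegrE.
Qed.

(** With rho = |v| and [al] the direction of [v], this is the sine form of the inner product with a
    rotating normal. It identifies the sinusoids of [width_fun] with widths of segments. *)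
Lemma polar v : exists rho al, 0 <= rho /\
  forall t, `|dotn t v| = rho * `|sin (t - al)|.
Proof.
have [v0|v0] := eqVneq (sqnorm v) 0.
  exists 0, 0; split => // t; rewrite mul0r; apply/eqP.
  rewrite normr_eq0 -sqrf_eq0 eq_le sqr_ge0 andbT -v0; exact: dotn_sqnorm.
have sv : 0 <= sqnorm v by rewrite sqnormE addr_ge0 ?sqr_ge0.
pose rho := Num.sqrt (sqnorm v).
have rho2 : rho ^+ 2 = sqnorm v by rewrite sqr_sqrtr.
have rho_neq0 : rho != 0 by rewrite -sqrf_eq0 rho2.
have [a ua] : exists a, rho^-1 *: v = unit_dir a \/ rho^-1 *: v = - unit_dir a.
  apply: unit_vector_dir; rewrite sqnormE !mxE !exprMn -mulrDr -sqnormE -rho2.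
  by rewrite exprVn mulVf// sqrf_eq0.
exists rho, a; split => [|t]; first exact: sqrtr_ge0.
have -> : v = rho *: (rho^-1 *: v) by rewrite scalerA divff// scale1r.
rewrite dotnZ normrM ger0_norm ?sqrtr_ge0//; congr (_ * _).
have du : dotn t (unit_dir a) = - sin (t - a).
  by rewrite /dotn unit_dir0 unit_dir1 sinD cosN sinN; ring.
case: ua => ->; first by rewrite du normrN.
by rewrite -scaleN1r dotnZ du mulN1r opprK.
Qed.

Section body.
Variables (K : set (plane R)).
Hypothesis K_compact : compact K.
Hypothesis K_convex : convex_set K.
Hypothesis K_neq0 : K !=set0.

Let support_subproof t : exists2 x, K x & forall y, K y -> dotn t y <= dotn t x.
Proof.
have [x Kx xmax] := compact_EVT_max K_neq0 K_compact
  (continuous_subspaceT (@dotn_continuous t)).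
by exists x; [rewrite inE in Kx|move=> y Ky; apply: xmax; rewrite inE].
Qed.

Definition support_point t := s2val (cid2 (support_subproof t)).
Definition support t := dotn t (support_point t).

Lemma support_pointP t : K (support_point t).
Proof. exact: (s2valP (cid2 (support_subproof t))). Qed.

Lemma support_ge t y : K y -> dotn t y <= support t.
Proof. exact: (s2valP' (cid2 (support_subproof t))). Qed.

(** The signed distances of points of [K] have maximum [support t] and minimum [- support (t + pi)].
    By convexity the segment joining the two extremal points realizes every value in between. *)
Lemma hitting_support t s : hitting K (affine_line_at (t, s)) <->
  - support (t + pi) <= s <= support t.
Proof.
have lowE : - support (t + pi) = dotn t (support_point (t + pi)).
  by rewrite /support dotn_pi opprK.
split => [[x [/affine_line_atP <- Kx]]|].
  rewrite support_ge// andbT lowE.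
  by have := support_ge (t + pi) Kx; rewrite /support !dotn_pi lerN2.
rewrite lowE /support => /andP[ls su].
set a := support_point (t + pi) in ls; set b := support_point t in su.
have [e|ne] := eqVneq (dotn t a) (dotn t b).
  exists a; split; last exact: support_pointP.
  by apply/affine_line_atP; apply/eqP; rewrite eq_le ls e su.
have ab : 0 < dotn t b - dotn t a.
  by rewrite subr_gt0 lt_neqAle ne (le_trans ls).
(* The weight at which the point l a + (1 - l) b has signed distance [s]. *)
pose l := (dotn t b - s) / (dotn t b - dotn t a).
have l0 : 0 <= l by rewrite divr_ge0 ?subr_ge0// -subr_ge0 ltW.
have l1 : l <= 1 by rewrite ler_pdivrMr// mul1r lerD2l lerN2.
exists (l *: a + (1 - l) *: b); split.
  apply/affine_line_atP; rewrite dotnD !dotnZ /l; field.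
  by rewrite lt0r_neq0.
have := @K_convex a b (Itv01 l0 l1); rewrite !inE.
by move=> /(_ (support_pointP _) (support_pointP _)).
Qed.

Variable r : R.
Hypothesis r_gt0 : 0 < r.
Hypothesis K_sub : K `<=` disc r.

Let coord_le y : K y -> `|y ord0 ord0| <= r /\ `|y ord0 ord_max| <= r.
Proof.
have r0 := ltW r_gt0.
move=> /K_sub; rewrite /disc/= sqnormE => yr.
by split; rewrite -ler_sqr ?nnegrE// real_normK ?num_real//; apply: le_trans yr;
  rewrite ?lerDl ?lerDr sqr_ge0.
Qed.

(** The support point for [t] competes in the maximum for [t'], and its coordinates are at most
    [r]. *)
Let support_le_dist t t' : support t <=
  support t' + r * (`|cos t - cos t'| + `|sin t - sin t'|).
Proof.
have Kx := support_pointP t; have [x0 x1] := coord_le Kx.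
apply: le_trans (lerD (support_ge t' Kx) (lexx _)).
rewrite -lerBlDl /support; set x := support_point t in Kx x0 x1 *.
rewrite (_ : _ - _ = (cos t - cos t') * x ord0 ord_max - (sin t - sin t') * x ord0 ord0); last first.
  by rewrite /dotn; ring.
apply: le_trans (ler_norm _) _; apply: le_trans (ler_normB _ _) _.
by rewrite !normrM mulrDr lerD// mulrC ler_wpM2r.
Qed.

Lemma support_continuous : continuous support.
Proof.
move=> t; apply/cvgrPdist_le => e e0.
pose g t' := r * (`|cos t' - cos t| + `|sin t' - sin t|).
have cg : continuous g.
  move=> t'; apply: cvgM; first exact: cvg_cst.
  apply: cvgD; apply: cvg_norm; apply: cvgB; do 1?[exact: cvg_cst].
    exact: continuous_cos.
  exact: continuous_sin.
have g0 : g t = 0 by rewrite /g !subrr normr0 addr0 mulr0.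
have := cg t; rewrite /continuous_at g0 => /cvgrPdist_le /(_ _ e0).
apply: filterS => t'; rewrite sub0r normrN => gt'.
have {}gt' : g t' <= e by exact: le_trans (ler_norm _) gt'.
apply: le_trans gt'; rewrite ler_distlC; apply/andP; split.
  rewrite lerBlDr; apply: le_trans (support_le_dist t t') _.
  by rewrite lerD2l /g distrC (distrC (sin t)).
exact: support_le_dist.
Qed.

(* By central symmetry of [K - K] this is the width orthogonal to the direction
   [t], relative to the diameter of the disc. *)
Definition width t := (support t + support (t + pi)) / (2 * r).

Let r2 : 0 < 2 * r. Proof. by rewrite mulr_gt0. Qed.

Let width_ge t x y : K x -> K y -> `|dotn t (x - y)| / (2 * r) <= width t.
Proof.
move=> Kx Ky; rewrite ler_pM2r ?invr_gt0// dotnB.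
have sx := support_ge t Kx; have sy := support_ge t Ky.
have := support_ge (t + pi) Kx; have := support_ge (t + pi) Ky; rewrite !dotn_pi => s'y s'x.
by rewrite ler_norml; lra.
Qed.

(** The segment attaining the width at [t0] joins the two opposite support points. In every other
    direction its width is at most that of the body. *)
Lemma width_fun_width : width_fun width.
Proof.
split.
- move=> t; apply: cvgM; last exact: cvg_cst.
  apply: cvgD; first exact: support_continuous.
  apply: (@continuous_comp _ _ _ (fun t => t + pi) support).
    by apply: cvgD; [exact: cvg_id|exact: cvg_cst].
  exact: support_continuous.
- move=> t; rewrite /width addrC; congr ((_ + _) / _).
  have dnE (x : plane R) : dotn (t + pi + pi) x = dotn t x by rewrite !dotn_pi opprK.
  apply/eqP; rewrite eq_le; apply/andP; split.
    rewrite {1}/support dnE; exact/support_ge/support_pointP.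
  rewrite {1}/support -dnE; exact/support_ge/support_pointP.
- move=> t0; set x := support_point t0; set y := support_point (t0 + pi).
  have [rho [al [rho0 vE]]] := polar (x - y).
  exists (rho / (2 * r)), al; split.
  + by rewrite divr_ge0// ltW.
  + rewrite mulrAC -vE; apply/eqP; rewrite eq_le; apply/andP; split; last first.
      by apply: width_ge; exact: support_pointP.
    rewrite ler_pM2r ?invr_gt0//; apply: le_trans (ler_norm _).
    by rewrite dotnB /support -/x -/y dotn_pi.
  + by move=> t; rewrite mulrAC -vE; apply: width_ge; exact: support_pointP.
Qed.

Lemma support_le t : support t <= r.
Proof.
have r0 := ltW r_gt0.
have Kx := support_pointP t; apply: le_trans (ler_norm _) _.
rewrite -ler_sqr ?nnegrE// real_normK ?num_real//.
exact: le_trans (dotn_sqnorm _ _) (K_sub Kx).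
Qed.

Lemma width_le1 t : width t <= 1.
Proof.
rewrite /width ler_pdivrMr// mul1r.
by have := support_le t; have := support_le (t + pi); lra.
Qed.

Lemma width_gt0 : (exists x y, [/\ K x, K y & x != y]) -> exists t, 0 < width t.
Proof.
move=> [x [y [Kx Ky xy]]].
suff [t dt] : exists t, dotn t (x - y) != 0.
  exists t; apply: lt_le_trans (width_ge t Kx Ky).
  by rewrite divr_gt0// normr_gt0.
have [e1|] := eqVneq (dotn 0 (x - y)) 0; last by exists 0.
exists (pi / 2); apply: contra_neq xy => e2.
move: e1 e2; rewrite /dotn cos0 sin0 cos_pihalf sin_pihalf !mxE => e1 e2.
by apply: plane_ext; apply/eqP; rewrite -subr_eq0; apply/eqP; lra.
Qed.

End body.
End support.

(** * The kinematic formula *)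

Section density.
Context d (T : measurableType d) (R : realType).
Local Open Scope ereal_scope.
Import HBNNSimple.

(** The density identity extends from sets to simple functions by linearity, then to nonnegative
    measurable functions by monotone convergence along an increasing simple approximation. *)
Lemma ge0_integral_density (mu la : {measure set T -> \bar R})
    (w : T -> R) (f : T -> \bar R) :
  measurable_fun setT w -> (forall x, (0 <= w x)%R) ->
  (forall A, measurable A -> la A = \int[mu]_(x in A) (w x)%:E) ->
  measurable_fun setT f -> (forall x, 0 <= f x) ->
  \int[la]_x f x = \int[mu]_x (f x * (w x)%:E).
Proof.
move=> mw w0 law mf f0.
have mw' : measurable_fun setT (EFin \o w) by apply/measurable_EFinP.
pose h := nnsfun_approx measurableT mf.
have hf x : (EFin \o h n) x @[n --> \oo] --> f x.
  exact: cvg_nnsfun_approx.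
have nd x : {homo (fun n => (EFin \o h n) x) : a b / (a <= b)%N >-> a <= b}.
  by move=> a b ab; rewrite lee_fin; exact/lefP/nd_nnsfun_approx.
have -> : \int[la]_x f x = limn (fun n => \int[la]_x (EFin \o h n) x).
  under eq_integral do rewrite -(cvg_lim _ (hf _))//.
  apply: monotone_convergence => //.
  - by move=> n; apply/measurable_EFinP.
  - by move=> n x _; rewrite lee_fin.
have -> : \int[mu]_x (f x * (w x)%:E) =
    limn (fun n => \int[mu]_x ((EFin \o h n) x * (w x)%:E)).
  rewrite -monotone_convergence//; last 3 first.
  - by move=> n; apply: emeasurable_funM => //; apply/measurable_EFinP.
  - by move=> n x _; rewrite mule_ge0// lee_fin.
  - by move=> x _ a b ab; rewrite lee_wpmul2r ?lee_fin//; exact: nd.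
  apply: eq_integral => x _; apply/esym/cvg_lim => //.
  by apply: cvgeZr => //; exact: hf.
congr (limn _); apply/funext => n.
transitivity (\int[la]_x
   (\sum_(y \in range (h n)) (y * \1_(h n @^-1` [set y]) x)%:E)).
  by apply: eq_integral => t tE; rewrite /= fimfunE -fsumEFin.
have indich m r : measurable_fun setT (fun x => (r * \1_(h m @^-1` [set r]) x)%:E).
  by apply: (measurable_comp measurableT) => //; exact: measurable_funM.
rewrite ge0_integral_fsum//; last by move=> m y Ey; exact: nnfun_muleindic_ge0.
transitivity (\int[mu]_x (\sum_(y \in range (h n))
    (y * \1_(h n @^-1` [set y]) x)%:E * (w x)%:E)); last first.
  apply: eq_integral => x _.
  rewrite -ge0_mule_fsuml => [|y]; last exact: nnfun_muleindic_ge0.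
  by rewrite fsumEFin // -(fimfunE _ x).
rewrite ge0_integral_fsum//; last 2 first.
- by move=> y; apply: emeasurable_funM.
- by move=> m y Ey; apply: mule_ge0; [exact: nnfun_muleindic_ge0|rewrite lee_fin].
apply: eq_fsbigr => r /[!inE] -[x0 _ rE].
have r0 : (0 <= r)%R by rewrite -rE.
have mA : measurable (h n @^-1` [set r]) by exact: measurable_sfunP.
under eq_integral do rewrite EFinM.
rewrite ge0_integralZl//; last by apply/measurable_EFinP.
rewrite integral_indic// setIT law//.
under [RHS]eq_integral do rewrite EFinM -muleA.
rewrite [RHS]ge0_integralZl//; last 2 first.
- by apply: emeasurable_funM => //; apply/measurable_EFinP.
- by move=> x _; rewrite mule_ge0// lee_fin.
congr (_ * _); rewrite integral_mkcond; apply: eq_integral => x _.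
by rewrite epatch_indic muleC.
Qed.

End density.

(** * Rotations and the uniform law of directions *)

Section rotations.
Context {R : realType}.
Notation leb := (@lebesgue_measure R).

(** Points are row vectors multiplied from the left, so the transpose of the usual matrix is the one
    that turns counterclockwise by [a]. *)
Definition rot (a : R) : 'M[R]_2 := \matrix_(i < 2, j < 2)
  if i == j then cos a else if i == ord0 then sin a else - sin a.

Lemma sum2 (F : 'I_2 -> R) : \sum_(i < 2) F i = F ord0 + F ord_max.
Proof. by rewrite big_ord_recl big_ord1; congr (_ + F _); exact: val_inj. Qed.

Lemma rotation_rot a : rotation (rot a).
Proof.
have c2 := cos2Dsin2 a; split.
  apply/matrixP => i j; rewrite !mxE sum2 !mxE.
  case: (unliftP ord0 i) => [i' ->|->]; case: (unliftP ord0 j) => [j' ->|->];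
    rewrite ?(ord1 i') ?(ord1 j') /= -?c2; ring.
rewrite (expand_det_row _ ord0) sum2 /cofactor !det_mx11 !mxE /= add0n expr0 expr1.
by rewrite -[RHS]c2; ring.
Qed.

Lemma motion_rot0 a v (x : plane R) : motion (rot a) v x ord0 ord0 =
  cos a * x ord0 ord0 - sin a * x ord0 ord_max + v ord0 ord0.
Proof. by rewrite /motion !mxE sum2 !mxE /=; ring. Qed.

Lemma motion_rot1 a v (x : plane R) : motion (rot a) v x ord0 ord_max =
  sin a * x ord0 ord0 + cos a * x ord0 ord_max + v ord0 ord_max.
Proof. by rewrite /motion !mxE sum2 !mxE /=; ring. Qed.

Lemma dotn_motion a v t (x : plane R) :
  dotn (t + a) (motion (rot a) v x) = dotn t x + dotn (t + a) v.
Proof.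
rewrite /dotn motion_rot0 motion_rot1 sinD cosD.
have c2 := cos2Dsin2 a.
rewrite -[X in X * x ord0 ord_max - _]mulr1 -[X in _ - X * x ord0 ord0]mulr1 -c2; ring.
Qed.

Lemma motion_surj a v (y : plane R) : exists x, y = motion (rot a) v x.
Proof.
exists (motion (rot (- a)) 0 (y - v)); apply: plane_ext.
  rewrite motion_rot0 motion_rot0 motion_rot1 !mxE cosN sinN.
  rewrite -[LHS](subrK (v ord0 ord0)); congr (_ + _).
  by rewrite -[LHS]mul1r -(cos2Dsin2 a); ring.
rewrite motion_rot1 motion_rot0 motion_rot1 !mxE cosN sinN.
rewrite -[LHS](subrK (v ord0 ord_max)); congr (_ + _).
by rewrite -[LHS]mul1r -(cos2Dsin2 a); ring.
Qed.

Lemma motion_affine_line a v t s : motion (rot a) v @` affine_line_at (t, s) =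
  affine_line_at (t + a, s + dotn (t + a) v).
Proof.
apply/seteqP; split => [_ [x /affine_line_atP <- <-]|y].
  by apply/affine_line_atP; rewrite dotn_motion.
have [x ->] := motion_surj a v y; move=> /affine_line_atP; rewrite dotn_motion.
by move=> /addIr/affine_line_atP H; exists x.
Qed.

Lemma affine0_linear (t : R) : affine_line_at (t, 0) = linear_line_at t :> set _.
Proof.
by apply/seteqP; split => x; rewrite affine_line_atP linear_line_atP.
Qed.

Definition turn (a : R) (L : linear_line R) := linear_line_at (angle L + a).

Lemma turnE a t : turn a (linear_line_at t) = linear_line_at (t + a).
Proof.
have [k k0 kp] := periodic_repr t.
rewrite /turn -(pi_periodicz linear_line_at_pi t (- k)) -(pi_periodicz linear_line_at_pi (t + a) (- k)).
rewrite intrN mulNr angle_at ?k0//.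
by congr linear_line_at; ring.
Qed.

Lemma turn_motion a (L : linear_line R) :
  motion (rot a) 0 @` L = turn a L :> set _.
Proof.
have [_ _ {1}->] := angleP L.
rewrite -affine0_linear motion_affine_line -affine0_linear.
by congr (affine_line_set (affine_line_at (_, _))); rewrite /dotn !mxE !mulr0 subr0 addr0.
Qed.

Lemma turnN a L : turn a (turn (- a) L) = L.
Proof. by have [_ _ {2}->] := angleP L; rewrite turnE subrK. Qed.

Lemma measurable_turn : measurable_fun setT
  ((fun p => turn p.2 p.1) : linear_lines R * measurableTypeR R -> linear_lines R).
Proof.
apply: (measurableT_comp (@measurable_linear_line_at R)).
apply: measurable_funD; last exact: measurable_snd.
by apply: (measurableT_comp (@measurable_angle R)); exact: measurable_fst.
Qed.

(** Invariance is stated for images; the preimage under a turn is the image under the opposite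
    rotation. *)
Lemma rotation_invariantE (m : set (linear_lines R) -> \bar R) :
  rotation_invariant m -> forall a (B : set (linear_lines R)), measurable B ->
  m (turn a @^-1` B) = m B.
Proof.
move=> inv a B mB; rewrite -(inv _ (rotation_rot (- a)) B mB).
congr m; apply/seteqP; split => L /=.
  move=> BL; exists (turn a L) => //.
  by rewrite turn_motion -{2}(opprK a) turnN.
move=> [L' BL']; rewrite turn_motion => /linear_line_eq ->.
by rewrite turnN.
Qed.

Local Open Scope ereal_scope.

(** Uniqueness of the invariant probability by Tonelli: g (turn t L) is integrated over [L] and over
    t in [0, pi[. Periodicity makes the inner integral over [t] independent of [L]; invariance makes
    the inner integral over [L] independent of [t]. *)
Lemma ge0_integral_lines (m : probability (linear_lines R) R)
    (g : linear_lines R -> \bar R) :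
  (forall a (B : set (linear_lines R)), measurable B ->
    m (turn a @^-1` B) = m B) ->
  measurable_fun setT g -> (forall L, 0 <= g L) ->
  \int[m]_L g L = (pi^-1)%:E * \int[leb]_(t in `[0%R, pi[) g (linear_line_at t).
Proof.
move=> inv mg g0; have p0 := pi_gt0 R.
have mturn a : measurable_fun setT (turn a : linear_lines R -> linear_lines R).
  apply: (measurableT_comp (@measurable_linear_line_at R)).
  by apply: measurable_funD; [exact: measurable_angle|exact: measurable_cst].
have inv' a : \int[m]_L g (turn a L) = \int[m]_L g L.
  have := @ge0_integral_pushforward _ _ _ _ R _ (mturn a) m setT g measurableT mg (fun L _ => g0 L).
  rewrite preimage_setT => <-; apply: eq_measure_integral => A mA _.
  exact: inv.
pose G (p : linear_lines R * measurableTypeR R) : \bar R :=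
  (\1_(`[0%R, pi[%classic : set R) p.2)%:E * g (turn p.2 p.1).
have mG : measurable_fun setT G.
  apply: emeasurable_funM; last exact: (measurableT_comp mg measurable_turn).
  apply/measurable_EFinP; apply: measurableT_comp; last exact: measurable_snd.
  exact: measurable_indic.
have G0 p : 0 <= G p by rewrite mule_ge0// lee_fin.
have E1 : \int[m]_x \int[leb]_y G (x, y) = \int[leb]_(t in `[0%R, pi[) g (linear_line_at t).
  transitivity (\int[m]_x \int[leb]_(t in `[0%R, pi[) g (linear_line_at t)).
    apply: eq_integral => L _.
    have mgl : measurable_fun setT (fun t => g (linear_line_at t)).
      exact: (measurableT_comp mg (@measurable_linear_line_at R)).
    rewrite -(@ge0_integral_periodic _ (angle L) (fun t => g (linear_line_at t)))//; last first.
      by move=> t; rewrite linear_line_at_pi.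
    rewrite [RHS]integral_mkcond; apply: eq_integral => t _.
    by rewrite epatch_indic /G /= muleC /turn addrC.
  by rewrite [LHS](@integral_cst _ _ _ m setT measurableT) [X in _ * X](@probability_setT _ _ _ m) mule1.
have E2 : \int[leb]_y \int[m]_x G (x, y) = pi%:E * \int[m]_L g L.
  transitivity (\int[leb]_y ((\1_(`[0%R, pi[%classic : set R) y)%:E * \int[m]_L g L)).
    apply: eq_integral => t _; rewrite /G/= ge0_integralZl//.
    - by rewrite inv'.
    - exact: (measurableT_comp mg (mturn t)).
  rewrite ge0_integralZr//; last 2 first.
  - by apply/measurable_EFinP; exact: measurable_indic.
  - exact: integral_ge0.
  have lpi : lebesgue_measure (`[0%R, pi[%classic : set R) = pi%:E.
    by rewrite lebesgue_measure_itv/= lte_fin p0 sube0.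
  by rewrite integral_indic// setIT; congr (_ * _); exact: lpi.
rewrite -E1 (@fubini_tonelli _ _ _ _ _ m leb G mG)// E2 muleA -EFinM mulVf ?mul1e//.
exact: lt0r_neq0.
Qed.
End rotations.

Section mu_facts.
Context {R : realType}.
Notation leb := (@lebesgue_measure R).
Implicit Types (E : affine_line R).

Definition th E : R := angle (parallel E).

Lemma thP E : 0 <= th E < pi.
Proof. by have [-> -> _] := angleP (parallel E). Qed.

Lemma sin_th_ge0 E : 0 <= sin (th E).
Proof. by have /andP[t0 tp] := thP E; rewrite sin_ge0_pi// t0 ltW. Qed.

Lemma th_at t s : 0 <= t < pi -> th (affine_line_at (t, s)) = t.
Proof. by move=> t0; rewrite /th parallel_at angle_at. Qed.

Lemma measurable_th : measurable_fun setT (th : affine_lines R -> R).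
Proof. exact: (measurableT_comp (@measurable_angle R) (@measurable_parallel R)). Qed.

Definition chi (l u s : R) : R := ((l <= s) && (s <= u))%:R.

Lemma chi_ge0 l u s : 0 <= chi l u s. Proof. by rewrite /chi. Qed.

Lemma measurable_chi d (T : measurableType d) (l u s : T -> R) :
  measurable_fun setT l -> measurable_fun setT u -> measurable_fun setT s ->
  measurable_fun setT (fun x => chi (l x) (u x) (s x)).
Proof.
move=> ml mu ms.
pose pos x : R := \1_(`[0, +oo[%classic : set R) x.
have -> : (fun x => chi (l x) (u x) (s x)) =
    (fun x => pos (s x - l x) * pos (u x - s x)).
  apply/funext => x; rewrite /chi /pos !indicE !mem_setE !in_itv/= !andbT !subr_ge0.
  by case: (_ <= _); case: (_ <= _); rewrite ?mulr1 ?mulr0.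
have mpos : measurable_fun setT pos by exact: measurable_indic.
by apply: measurable_funM; apply: (measurableT_comp mpos); exact: measurable_funB.
Qed.

Lemma hitting_discE r E : 0 <= r -> \1_(hitting (disc r)) E = chi (- r) r (offset E).
Proof.
move=> r0; rewrite indicE /chi -ler_norml; congr (nat_of_bool _)%:R.
rewrite {1}[E]offsetP; apply/idP/idP.
  by rewrite inE => /(hitting_disc _ _ r0).
by move=> H; rewrite inE; apply/(hitting_disc _ _ r0).
Qed.

Lemma integral_chi (l u s k : R) : 0 < k -> l <= u ->
  (\int[leb]_a (chi l u (s + a * k))%:E = ((u - l) / k)%:E)%E.
Proof.
move=> k0 lu.
transitivity (\int[leb]_a (\1_(`[(l - s) / k, (u - s) / k]%classic : set R) a)%:E)%E.
  apply: eq_integral => a _; rewrite indicE mem_setE in_itv/= /chi.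
  by rewrite ler_pdivrMr// ler_pdivlMr// lerBlDl lerBrDl.
have lE : lebesgue_measure (`[(l - s) / k, (u - s) / k]%classic : set R) =
    ((u - l) / k)%:E.
  rewrite lebesgue_measure_itv/= lte_fin ltr_pM2r ?invr_gt0// ltrD2r.
  have [_|ul] := ltP l u.
    by rewrite -EFinB -mulrBl; congr (_ / _)%:E; ring.
  by rewrite (@le_anti _ _ l u) ?lu// subrr mul0r.
by rewrite integral_indic// setIT; exact: lE.
Qed.

(* The translate of [E] by [- a] along the first axis. *)
Definition shiftx (a : R) E : affine_line R :=
  affine_line_at (th E, offset E + a * sin (th E)).

Lemma th_shiftx a E : th (shiftx a E) = th E.
Proof. exact/th_at/thP. Qed.

Lemma offset_shiftx a E : offset (shiftx a E) = offset E + a * sin (th E).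
Proof. exact/offset_at/thP. Qed.

Lemma parallel_shiftx a E : parallel (shiftx a E) = parallel E.
Proof. by rewrite /shiftx parallel_at /=; have [_ _ <-] := angleP (parallel E). Qed.

Lemma shiftxN a E : shiftx a (shiftx (- a) E) = E.
Proof.
by rewrite {1}/shiftx offset_shiftx th_shiftx mulNr subrK -offsetP.
Qed.

Lemma motion_line a v E : motion (rot a) v @` E =
  affine_line_at (th E + a, offset E + dotn (th E + a) v).
Proof. by rewrite {1}[E]offsetP motion_affine_line. Qed.

(** The definition of [shiftx] uses normalized coordinates, but being a translation it has the same
    formula for every angle. In these parameters it is visibly continuous, whence its
    measurability. *)
Lemma shiftx_at a t s :
  shiftx a (affine_line_at (t, s)) = affine_line_at (t, s + a * sin t).
Proof.
pose v : plane R := \row_(i < 2) (if i == ord0 then - a else 0).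
have vE x : dotn (x + 0) v = a * sin x.
  by rewrite /dotn !mxE /= addr0 mulr0 sub0r mulrN opprK mulrC.
apply: affine_line_eq; have := motion_affine_line 0 v t s; rewrite vE addr0 => <-.
by rewrite motion_line vE addr0.
Qed.

Lemma measurable_shiftx a :
  measurable_fun setT (shiftx a : affine_lines R -> affine_lines R).
Proof.
apply: (@measurability _ _ _ (affine_lines R) _ _ (@open_affine_lines R)) => //.
move=> _ [ U oU <-]; rewrite setTI; apply: sub_sigma_algebra.
rewrite /open_affine_lines/=.
pose F (p : R * R) : R * R := (p.1, p.2 + a * sin p.1).
have -> : affine_line_at @^-1` (shiftx a @^-1` U) = F @^-1` (affine_line_at @^-1` U).
  by apply/seteqP; split => -[t s] /=; rewrite shiftx_at.
apply: open_comp; last exact: oU.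
move=> p _; apply: (@cvg_pair _ _ _ _ (nbhs p.1) (nbhs (p.2 + a * sin p.1))).
  exact: cvg_fst.
apply: cvgD; first exact: cvg_snd.
apply: cvgM; first exact: cvg_cst.
apply: (@continuous_comp _ _ _ (@fst R R) (@sin R)); first exact: cvg_fst.
exact: continuous_sin.
Qed.

Variable mu : {measure set (affine_lines R) -> \bar R}.
Hypothesis mu_invariant : motion_invariant mu.

Lemma mu_shiftx a (B : set (affine_lines R)) : measurable B ->
  mu ((shiftx a : affine_lines R -> affine_lines R) @^-1` B) = mu B.
Proof.
move=> mB; pose v : plane R := \row_(i < 2) (if i == ord0 then a else 0).
rewrite -(mu_invariant v (rotation_rot 0) mB); congr (mu _).
have vE t : dotn (t + 0) v = - (a * sin t).
  by rewrite /dotn !mxE /= addr0 mulr0 sub0r mulrC.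
have ME E : motion (rot 0) v @` E = shiftx (- a) E :> set _.
  by rewrite motion_line vE addr0 /shiftx mulNr.
apply/seteqP; split => E /=.
  move=> BE; exists (shiftx a E) => //; rewrite ME -{2}(opprK a) shiftxN//.
by move=> [E' BE']; rewrite ME => /affine_line_eq ->; rewrite shiftxN.
Qed.

End mu_facts.

(* [parallel] between the measurable spaces of lines, to carry the structure of a
   measurable function. *)
Definition par (R : realType) : affine_lines R -> linear_lines R := @parallel R.

HB.instance Definition _ (R : realType) := isMeasurableFun.Build _ _
  (affine_lines R) (linear_lines R) (@par R) (@measurable_parallel R).

(** * The law of an isotropic uniform line and of its direction *)

Section isotropic_law.
Context {R : realType}.
Notation leb := (@lebesgue_measure R).
Implicit Types (E : affine_line R).
Variable mu : {measure set (affine_lines R) -> \bar R}.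
Hypothesis mu_invariant : motion_invariant mu.
Variable r : R.
Hypothesis r_gt0 : 0 < r.
Variable la : probability (affine_lines R) R.
Hypothesis laE : forall B : set (affine_lines R), measurable B ->
  (la B = (2 * r)^-1%:E *
    \int[mu]_(E in B) (\1_(hitting (disc r)) E)%:E)%E.
Local Open Scope ereal_scope.

Definition dweight E : R := ((2 * r)^-1 * chi (- r) r (offset E))%R.

Lemma dweight_ge0 E : (0 <= dweight E)%R.
Proof. by rewrite mulr_ge0 ?chi_ge0// invr_ge0 mulr_ge0// ltW. Qed.

Lemma measurable_dweight : measurable_fun setT (dweight : affine_lines R -> R).
Proof.
apply: measurable_funM; first exact: measurable_cst.
by apply: measurable_chi; [exact: measurable_cst|exact: measurable_cst|exact: measurable_offset].
Qed.

Lemma dlaw_dweight (B : set (affine_lines R)) : measurable B ->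
  la B = \int[mu]_(E in B) (dweight E)%:E.
Proof.
move=> mB; rewrite laE// /dweight.
under eq_integral do rewrite hitting_discE ?(ltW r_gt0)//.
rewrite -ge0_integralZl_EFin//.
- by move=> E _; rewrite lee_fin chi_ge0.
- apply/measurable_EFinP; apply: measurable_funTS.
  by apply: measurable_chi; [exact: measurable_cst|exact: measurable_cst|exact: measurable_offset].
- by rewrite invr_ge0 mulr_ge0// ltW.
Qed.

Lemma dlaw_integral (f : affine_lines R -> \bar R) :
  measurable_fun setT f -> (forall E, 0 <= f E) ->
  \int[la]_E f E = \int[mu]_E (f E * (dweight E)%:E).
Proof.
move=> mf f0; apply: ge0_integral_density => //.
- exact: measurable_dweight.
- exact: dweight_ge0.
- exact: dlaw_dweight.
Qed.

Lemma measurable_hitting_disc : measurable (hitting (disc r) : set (affine_lines R)).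
Proof.
have -> : hitting (disc r) = (@offset R) @^-1` `[(- r)%R, r].
  apply/seteqP; split => E /=; rewrite in_itv/= -ler_norml => H.
    by move: H; rewrite {1}[E]offsetP => /(hitting_disc _ _ (ltW r_gt0)).
  by rewrite [E]offsetP; apply/(hitting_disc _ _ (ltW r_gt0)).
rewrite -[X in measurable X]setTI; apply: measurable_offset => //.
Qed.

Lemma dlaw_hitting (B : set (affine_lines R)) : measurable B ->
  la B = (2 * r)^-1%:E * mu (B `&` hitting (disc r)).
Proof.
move=> mB; rewrite laE// integral_indic//; first by rewrite setIC.
exact: measurable_hitting_disc.
Qed.

(** Rotations about the origin preserve both the invariant measure and the set of lines hitting the
    centred disc, so the direction of an isotropic line has a rotation invariant law. *)
Lemma parallel_turn a (B : set (linear_lines R)) : measurable B ->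
  distribution la (@par R) (turn a @^-1` B) =
  distribution la (@par R) B.
Proof.
move=> mB; rewrite /distribution /pushforward/=.
have mpB C : measurable C -> measurable ((@parallel R : affine_lines R -> linear_lines R) @^-1` C).
  by move=> mC; rewrite -[X in measurable X]setTI; exact: measurable_parallel.
have mtB : measurable (turn a @^-1` B : set (linear_lines R)).
  rewrite -[X in measurable X]setTI.
  suff mt : measurable_fun setT (turn a : linear_lines R -> linear_lines R) by exact: mt.
  apply: (measurableT_comp (@measurable_linear_line_at R)).
  by apply: measurable_funD; [exact: measurable_angle|exact: measurable_cst].
rewrite !dlaw_hitting//; [|exact: mpB|exact: mpB].
congr (_ * _).
rewrite -(mu_invariant (0 : plane R)%R (rotation_rot (- a)%R) (measurableI _ _ (mpB _ mB) measurable_hitting_disc)).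
have ME b E : motion (rot b) (0 : plane R)%R @` E = affine_line_at (th E + b, offset E)%R :> set _.
  by rewrite motion_line /dotn !mxE !mulr0 subr0 addr0.
pose tn b E := affine_line_at (th E + b, offset E)%R.
have tnE b t s : tn b (affine_line_at (t, s)) = affine_line_at (t + b, s)%R.
  apply: affine_line_eq; rewrite /tn -ME motion_affine_line.
  by rewrite /dotn !mxE !mulr0 subr0 addr0.
have tnN b E : tn b (tn (- b)%R E) = E.
  by rewrite {2}/tn tnE subrK -offsetP.
have parN b E : parallel (tn b E) = turn b (parallel E).
  by rewrite /tn parallel_at.
have hit b E : hitting (disc r) E -> hitting (disc r) (tn b E).
  rewrite {1}[E]offsetP /tn => /(hitting_disc _ _ (ltW r_gt0)) H.
  exact/(hitting_disc _ _ (ltW r_gt0)).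
congr (mu _); apply/seteqP; split => E /=.
  move=> [BE hE]; exists (tn a E).
    by split; [rewrite /preimage/= /par parN|exact: hit].
  by rewrite ME -/(tn _ _) -{2}(opprK a) tnN.
move=> [E' [BE' hE']]; rewrite ME -/(tn _ _) => /affine_line_eq ->.
by split; [rewrite /par parN turnN|exact: hit].
Qed.

Lemma integral_direction (G : linear_lines R -> \bar R) :
  measurable_fun setT G -> (forall L, 0 <= G L) ->
  \int[la]_E G (parallel E) =
  (pi^-1)%:E * \int[leb]_(t in `[0%R, pi[) G (linear_line_at t).
Proof.
move=> mG G0.
rewrite -(@ge0_integral_lines _ (distribution la (@par R)))//.
  by rewrite ge0_integral_distribution.
exact: parallel_turn.
Qed.

End isotropic_law.

Section kinematic.
Context {R : realType}.
Notation leb := (@lebesgue_measure R).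
Implicit Types (E : affine_line R).
Variable mu : {measure set (affine_lines R) -> \bar R}.
Hypothesis mu_invariant : motion_invariant mu.
Variable r : R.
Hypothesis r_gt0 : 0 < r.
Variable la : probability (affine_lines R) R.
Hypothesis laE : forall B : set (affine_lines R), measurable B ->
  (la B = (2 * r)^-1%:E *
    \int[mu]_(E in B) (\1_(hitting (disc r)) E)%:E)%E.
Variables lo hi : R -> R.
Hypothesis mlo : measurable_fun setT lo.
Hypothesis mhi : measurable_fun setT hi.
Hypothesis lohi : forall t, lo t <= hi t.
Hypothesis rlo : forall t, - r <= lo t.
Hypothesis hir : forall t, hi t <= r.
Variable G : linear_lines R -> R.
Hypothesis mG : measurable_fun setT G.
Hypothesis G_ge0 : forall L, 0 <= G L.

(** The factor sin (th E) is the speed at which [shiftx] moves the offset and cancels the Jacobian 1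
    / sin (th E). The indicator singles out the lines that are not parallel to the first axis, the
    only ones that [shiftx] moves. *)
Let H E : R := (0 < sin (th E))%R%:R * sin (th E) * G (parallel E).

Let H0 E : 0 <= H E.
Proof. by rewrite !mulr_ge0// sin_th_ge0. Qed.

Let mH : measurable_fun setT (H : affine_lines R -> R).
Proof.
have ms : measurable_fun setT ((fun E => sin (th E)) : affine_lines R -> R).
  apply: measurableT_comp; last exact: measurable_th.
  exact: continuous_measurable_fun (@continuous_sin R).
apply: measurable_funM; last exact: (measurableT_comp mG (@measurable_parallel R)).
apply: measurable_funM => //.
have mpos : measurable_fun setT (\1_(`]0, +oo[%classic : set R) : R -> R).
  exact: measurable_indic.
have := measurableT_comp mpos ms; congr measurable_fun.
by apply/funext => E /=; rewrite indicE mem_setE in_itv/= andbT.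
Qed.

Let kap (s : R) E : R := chi (lo (th E)) (hi (th E)) s.

Let mkap d (T : measurableType d) (s : T -> R) (e : T -> affine_lines R) :
  measurable_fun setT s -> measurable_fun setT e ->
  measurable_fun setT (fun x => kap (s x) (e x)).
Proof.
move=> ms me; have mt := measurableT_comp (@measurable_th R) me.
apply: measurable_chi => //; first exact: (measurableT_comp mlo mt).
exact: (measurableT_comp mhi mt).
Qed.

Let kap_disc s E : kap s E * chi (- r) r s = kap s E.
Proof.
rewrite /kap /chi.
have [l|] := boolP (_ <= s); last by rewrite /= mul0r.
have [h|] := boolP (s <= _); last by rewrite /= mul0r.
by rewrite (le_trans (rlo _) l) (le_trans h (hir _)) mulr1.
Qed.

Local Open Scope ereal_scope.

(** Passing from [la] to [mu] adds the disc indicator of the offset. On the left it is absorbed by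
    [kap], since the body lies in the disc. Translating the line then moves [a] into [kap] and turns
    the other disc indicator into the density of [la]. *)
Let translate a :
  \int[la]_E ((kap (offset E) E * chi (- r) r (offset E + a * sin (th E))) * H E)%:E =
  \int[la]_E (kap (offset E - a * sin (th E)) E * H E)%:E.
Proof.
have msh b : measurable_fun setT
    ((fun E => offset E + b * sin (th E)) : affine_lines R -> R)%R.
  apply: measurable_funD; first exact: measurable_offset.
  apply: measurable_funM; first exact: measurable_cst.
  apply: measurableT_comp; last exact: measurable_th.
  exact: continuous_measurable_fun (@continuous_sin R).
have mr (s : affine_lines R -> R) : measurable_fun setT s ->
    measurable_fun setT (fun E : affine_lines R => chi (- r) r (s E)).
  by move=> ms; apply: measurable_chi => //; exact: measurable_cst.
pose Phi b E := ((kap (offset E) E * chi (- r) r (offset E + b * sin (th E))) *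
   H E * (2 * r)^-1)%:E.
have mPhi b : measurable_fun setT (Phi b : affine_lines R -> \bar R).
  apply/measurable_EFinP; apply: measurable_funM; last exact: measurable_cst.
  apply: measurable_funM; last exact: mH.
  apply: measurable_funM; last by apply: mr; exact: msh.
  by apply: mkap; [exact: measurable_offset|exact: measurable_id].
have Phi0 b E : 0 <= Phi b E.
  rewrite lee_fin; apply: mulr_ge0; last by rewrite invr_ge0 mulr_ge0// ltW.
  by apply: mulr_ge0; [exact: (mulr_ge0 (chi_ge0 _ _ _) (chi_ge0 _ _ _))|exact: H0].
rewrite !(dlaw_integral r_gt0 laE); last 4 first.
- apply/measurable_EFinP; apply: measurable_funM; last exact: mH.
  apply: mkap; last exact: measurable_id.
  have := msh (- a)%R; congr measurable_fun; apply/funext => E.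
  by rewrite mulNr.
- by move=> E; rewrite lee_fin; apply: mulr_ge0; [exact: chi_ge0|exact: H0].
- apply/measurable_EFinP; apply: measurable_funM; last exact: mH.
  apply: measurable_funM; last by apply: mr; exact: msh.
  by apply: mkap; [exact: measurable_offset|exact: measurable_id].
- move=> E; rewrite lee_fin; apply: mulr_ge0; last exact: H0.
  exact: (mulr_ge0 (chi_ge0 _ _ _) (chi_ge0 _ _ _)).
transitivity (\int[mu]_E Phi a E).
  apply: eq_integral => E _; rewrite -EFinM /dweight; congr EFin.
  by rewrite -{2}[kap _ _]kap_disc; ring.
have shE : \int[mu]_E Phi a (shiftx (- a)%R E) = \int[mu]_E Phi a E.
  have := @ge0_integral_pushforward _ _ _ _ R _ (@measurable_shiftx R (- a)%R) mu setT (Phi a) measurableT (mPhi a) (fun E _ => Phi0 a E).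
  rewrite preimage_setT => <-; apply: eq_measure_integral.
    exact: measurable_shiftx.
  move=> ms A mA _.
  exact: (mu_shiftx mu_invariant (- a)%R mA).
rewrite -shE; apply: eq_integral => E _; rewrite -EFinM /dweight /Phi/= /H.
rewrite offset_shiftx parallel_shiftx th_shiftx /kap th_shiftx mulNr subrK.
by congr EFin; ring.
Qed.

(* Integrate over [E] and [a] the indicator that [E] hits the body and
   [shiftx a E] hits the disc, with weight [sin (th E)], the speed of the offset
   in [a]: each order of integration gives one side. *)
Lemma integral_hitting_sin :
  \int[la]_E (kap (offset E) E * (2 * r) * (0 < sin (th E))%R%:R * G (parallel E))%:E =
  \int[la]_E ((hi (th E) - lo (th E)) * (0 < sin (th E))%R%:R * G (parallel E))%:E.
Proof.
have r0 := r_gt0.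
have msh (b : R) : measurable_fun setT
    ((fun p => offset p.1 + (b * p.2) * sin (th p.1)) :
       affine_lines R * measurableTypeR R -> R)%R.
  apply: measurable_funD; first exact: (measurableT_comp (@measurable_offset R) measurable_fst).
  apply: measurable_funM.
    by apply: measurable_funM; [exact: measurable_cst|exact: measurable_snd].
  apply: (measurableT_comp (continuous_measurable_fun (@continuous_sin R))).
  exact: (measurableT_comp (@measurable_th R) measurable_fst).
pose F (p : affine_lines R * measurableTypeR R) : \bar R :=
  ((kap (offset p.1) p.1 * chi (- r) r (offset p.1 + (1 * p.2) * sin (th p.1))) * H p.1)%:E.
pose F' (p : affine_lines R * measurableTypeR R) : \bar R :=
  (kap (offset p.1 + (-1 * p.2) * sin (th p.1)) p.1 * H p.1)%:E.
have mF : measurable_fun setT F.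
  apply/measurable_EFinP; apply: measurable_funM; last exact: (measurableT_comp mH measurable_fst).
  apply: measurable_funM.
    apply: mkap; last exact: measurable_fst.
    exact: (measurableT_comp (@measurable_offset R) measurable_fst).
  by apply: measurable_chi; [exact: measurable_cst|exact: measurable_cst|exact: msh].
have mF' : measurable_fun setT F'.
  apply/measurable_EFinP; apply: measurable_funM; last exact: (measurableT_comp mH measurable_fst).
  by apply: mkap; [exact: msh|exact: measurable_fst].
have F0 p : 0 <= F p.
  rewrite lee_fin; apply: mulr_ge0; last exact: H0.
  exact: (mulr_ge0 (chi_ge0 _ _ _) (chi_ge0 _ _ _)).
have F'0 p : 0 <= F' p.
  by rewrite lee_fin; apply: mulr_ge0; [exact: chi_ge0|exact: H0].
have mchi (l u s k : R) : measurable_fun setT (fun a : R => chi l u (s + a * k)%R).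
  apply: measurable_chi; [exact: measurable_cst|exact: measurable_cst|].
  apply: measurable_funD; first exact: measurable_cst.
  by apply: measurable_funM; [exact: measurable_id|exact: measurable_cst].
transitivity (\int[la]_E \int[leb]_a F (E, a)).
  apply: eq_integral => E _; rewrite /F/=.
  under [RHS]eq_integral => a _ do rewrite mul1r mulrAC EFinM.
  rewrite ge0_integralZl//.
  - have [s0|s0] := ltP 0%R (sin (th E)); last first.
      by rewrite /H ltNge s0/= !mul0r !mulr0 !mul0r mul0e.
    rewrite integral_chi//; last by rewrite (@le_trans _ _ 0%R)// ?oppr_le0 ltW.
    rewrite -EFinM /H s0/=; congr EFin; field.
    exact: lt0r_neq0.
  - by apply/measurable_EFinP; exact: mchi.
  - by move=> a _; rewrite lee_fin chi_ge0.
  - by rewrite lee_fin; apply: mulr_ge0; [exact: chi_ge0|exact: H0].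
rewrite (@fubini_tonelli _ _ _ _ _ la leb F mF)//.
transitivity (\int[leb]_a \int[la]_E F' (E, a)).
  apply: eq_integral => a _; rewrite /F /F'/=.
  under eq_integral do rewrite mul1r.
  rewrite translate; apply: eq_integral => E _.
  by rewrite mulN1r mulNr.
rewrite -(@fubini_tonelli _ _ _ _ _ la leb F' mF')//.
apply: eq_integral => E _; rewrite /F'/=.
(* Reflection makes the coefficient of [a] positive, as [integral_chi] requires. *)
have chiN (l u s k a : R) : chi l u (s + (-1 * a) * k) = chi (- u) (- l) (- s + a * k).
  have -> : (s + (-1 * a) * k = - (- s + a * k))%R by ring.
  by rewrite /chi lerNr [(- _ <= u)%R]lerNl andbC.
under eq_integral => a _ do rewrite /kap chiN mulrC EFinM.
rewrite ge0_integralZl//.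
- have [s0|s0] := ltP 0%R (sin (th E)); last first.
    by rewrite /H ltNge s0/= !mul0r !mulr0 !mul0r mul0e.
  rewrite integral_chi//; last by rewrite lerN2.
  rewrite -EFinM /H s0/=; congr EFin; field.
  exact: lt0r_neq0.
- by apply/measurable_EFinP; exact: mchi.
- by move=> a _; rewrite lee_fin chi_ge0.
- by rewrite lee_fin H0.
Qed.

End kinematic.

Section kinematic_formula.
Context {R : realType}.
Notation leb := (@lebesgue_measure R).
Implicit Types (E : affine_line R).
Variable mu : {measure set (affine_lines R) -> \bar R}.
Hypothesis mu_invariant : motion_invariant mu.
Variable r : R.
Hypothesis r_gt0 : 0 < r.
Variable la : probability (affine_lines R) R.
Hypothesis laE : forall B : set (affine_lines R), measurable B ->
  (la B = (2 * r)^-1%:E *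
    \int[mu]_(E in B) (\1_(hitting (disc r)) E)%:E)%E.

(** On [0, pi[ the sine vanishes only at 0, and the uniform law of the direction gives a single
    direction probability zero. *)
Lemma ae_sin_th_gt0 : {ae la, forall E, 0 < sin (th E)}.
Proof.
pose Z : set (affine_lines R) := [set E | th E = 0].
have mZ : measurable Z.
  have := @measurable_th R measurableT [set 0]; rewrite setTI; apply.
  exact: measurable_set1.
exists Z; split => //; last first.
  move=> E /=; apply: contra_notP => t0; have /andP[t1 t2] := thP E.
  by apply: sin_gt0_pi; rewrite t2 andbT lt_neqAle t1 andbT eq_sym; apply/eqP.
pose G (L : linear_lines R) : \bar R := (\1_[set 0 : R] (angle L))%:E.
have mG : measurable_fun setT G.
  apply/measurable_EFinP; apply: (measurableT_comp _ (@measurable_angle R)).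
  by apply: measurable_indic; exact: measurable_set1.
have G0 L : (0 <= G L)%E by rewrite lee_fin.
have := integral_direction mu_invariant r_gt0 laE mG G0.
have -> : (\int[la]_E G (parallel E) = la Z)%E.
  transitivity (\int[la]_E (\1_Z E)%:E)%E; last by rewrite integral_indic// setIT.
  apply: eq_integral => E _; rewrite /G !indicE.
  suff -> : (angle (parallel E) \in [set 0 : R]) = (E \in Z) by [].
  by apply/idP/idP; rewrite !inE.
move=> ->; rewrite -[RHS](mule0 (pi^-1)%:E); congr (_ * _)%E.
have -> : (\int[leb]_(t in `[0%R, pi[) G (linear_line_at t) =
    \int[leb]_(t in `[0%R, pi[) (\1_[set 0 : R] t)%:E)%E.
  by apply: eq_integral => t; rewrite inE/= in_itv/= => t0; rewrite /G angle_at.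
rewrite integral_indic//; apply: (@subset_measure0 _ _ _ leb _ [set 0 : R]).
- by apply: measurableI; [exact: measurable_set1|exact: measurable_itv].
- exact: measurable_set1.
- by move=> x [].
- exact: lebesgue_measure_set1.
Qed.

Section hitting.
Variables lo hi : R -> R.
Hypothesis mlo : measurable_fun setT lo.
Hypothesis mhi : measurable_fun setT hi.
Hypothesis lohi : forall t, lo t <= hi t.
Hypothesis rlo : forall t, - r <= lo t.
Hypothesis hir : forall t, hi t <= r.
Variable G : linear_lines R -> R.
Hypothesis mG : measurable_fun setT G.
Hypothesis G_ge0 : forall L, 0 <= G L.
Local Open Scope ereal_scope.

(** The identity obtained from translations is freed of its indicator, almost surely 1. What remains
    depends on the direction alone, whose law is known. *)
Lemma integral_hitting :
  \int[la]_E (chi (lo (th E)) (hi (th E)) (offset E) * G (parallel E))%:E =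
  (pi^-1)%:E * \int[leb]_(t in `[0%R, pi[)
     ((hi t - lo t) / (2 * r) * G (linear_line_at t))%:E.
Proof.
have r2 : (0 < 2 * r)%R by rewrite mulr_gt0.
have r2i : (0 <= (2 * r)^-1)%R by rewrite invr_ge0 ltW.
pose G' L := ((2 * r)^-1 * G L)%R.
have mG' : measurable_fun setT G' by exact: measurable_funM.
have G'0 L : (0 <= G' L)%R by rewrite mulr_ge0.
pose W (L : linear_lines R) : R := ((hi (angle L) - lo (angle L)) * G' L)%R.
have mW : measurable_fun setT W.
  apply: measurable_funM => //; apply: measurable_funB.
    exact: (measurableT_comp mhi (@measurable_angle R)).
  exact: (measurableT_comp mlo (@measurable_angle R)).
have W0 L : (0 <= W L)%R by rewrite mulr_ge0// subr_ge0.
have mpar (g : linear_lines R -> R) : measurable_fun setT g ->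
    measurable_fun setT ((fun E => g (parallel E)) : affine_lines R -> R).
  by move=> mg; exact: (measurableT_comp mg (@measurable_parallel R)).
have mchi : measurable_fun setT
    ((fun E => chi (lo (th E)) (hi (th E)) (offset E)) : affine_lines R -> R).
  apply: measurable_chi; last exact: measurable_offset.
    exact: (measurableT_comp mlo (@measurable_th R)).
  exact: (measurableT_comp mhi (@measurable_th R)).
have msin : measurable_fun setT ((fun E => (0 < sin (th E))%R%:R) : affine_lines R -> R).
  have ms : measurable_fun setT ((fun E => sin (th E)) : affine_lines R -> R).
    apply: measurableT_comp; last exact: measurable_th.
    exact: continuous_measurable_fun (@continuous_sin R).
  have mpos : measurable_fun setT (\1_(`]0%R, +oo[%classic : set R) : R -> R).
    exact: measurable_indic.
  have := measurableT_comp mpos ms; congr measurable_fun.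
  by apply/funext => E /=; rewrite indicE mem_setE in_itv/= andbT.
transitivity (\int[la]_E (chi (lo (th E)) (hi (th E)) (offset E) * (2 * r) *
    (0 < sin (th E))%R%:R * G' (parallel E))%:E).
  apply: ge0_ae_eq_integral => //.
  - by apply/measurable_EFinP; apply: measurable_funM => //; exact: mpar.
  - apply/measurable_EFinP; apply: measurable_funM; last exact: mpar.
    by apply: measurable_funM => //; apply: measurable_funM => //; exact: measurable_cst.
  - by move=> E _; rewrite lee_fin mulr_ge0 ?chi_ge0.
  - move=> E _; rewrite lee_fin; apply: mulr_ge0 => //; apply: mulr_ge0 => //.
    by apply: mulr_ge0; [exact: chi_ge0|exact: ltW].
  - case: ae_sin_th_gt0 => N [mN N0 sub]; exists N; split => // E nE.
    apply: sub => /= s0; apply: nE => _; congr EFin.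
    by rewrite s0 /= mulr1 /G' -[RHS]mulrA mulVKf//; exact: lt0r_neq0.
rewrite (integral_hitting_sin mu_invariant r_gt0 laE mlo mhi lohi rlo hir mG' G'0).
transitivity (\int[la]_E (W (parallel E))%:E).
  apply/esym; apply: ge0_ae_eq_integral => //.
  - by apply/measurable_EFinP; exact: mpar.
  - apply/measurable_EFinP; apply: measurable_funM; last exact: mpar.
    apply: measurable_funM => //; apply: measurable_funB.
      exact: (measurableT_comp mhi (@measurable_th R)).
    exact: (measurableT_comp mlo (@measurable_th R)).
  - by move=> E _; rewrite lee_fin.
  - move=> E _; rewrite lee_fin; apply: mulr_ge0 => //.
    by apply: mulr_ge0 => //; rewrite subr_ge0.
  - case: ae_sin_th_gt0 => N [mN N0 sub]; exists N; split => // E nE.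
    by apply: sub => /= s0; apply: nE => _; rewrite s0 mulr1.
have mWe : measurable_fun setT (EFin \o W) by exact/measurable_EFinP.
rewrite (@integral_direction _ _ mu_invariant _ r_gt0 _ laE _ mWe)//.
congr (_ * _); apply: eq_integral => t; rewrite inE/= in_itv/= => t0.
by rewrite /W/= angle_at// /G' mulrA.
Qed.

End hitting.

Variable K : set (plane R).
Hypothesis K_compact : compact K.
Hypothesis K_convex : convex_set K.
Hypothesis K_neq0 : K !=set0.
Hypothesis K_sub : K `<=` disc r.

Lemma V0_chi E : V0 (K `&` E) =
  chi (- support K_compact K_neq0 (th E + pi)) (support K_compact K_neq0 (th E))
    (offset E).
Proof.
have [h1 h2] := hitting_support K_compact K_convex K_neq0 (th E) (offset E).
rewrite -offsetP in h1 h2; rewrite /V0 /chi setIC; congr (nat_of_bool _)%:R.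
by apply/asboolP/idP; [exact: h1|exact: h2].
Qed.

(** The offsets of lines hitting [K] in direction [t] fill the interval from [- support (t + pi)] to
    [support t]. Its length divided by 2r is the conditional hitting probability [width]. *)
Lemma kinematic_formula (G : linear_lines R -> R) :
  measurable_fun setT G -> (forall L, 0 <= G L) ->
  (\int[la]_E (G (parallel E) * V0 (K `&` E))%:E =
  (pi^-1)%:E * \int[leb]_(t in `[0%R, pi])
     (G (linear_line_at t) * width K_compact K_neq0 r t)%:E)%E.
Proof.
move=> mG G0.
have cs := support_continuous (K_compact := K_compact) (K_neq0 := K_neq0) r_gt0 K_sub.
have ms := continuous_measurable_fun cs.
have mhi : measurable_fun setT (fun t : R => - support K_compact K_neq0 (t + pi)).
  apply: (@measurableT_comp _ _ _ _ _ _ (@GRing.opp R)) => //.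
  by apply: (measurableT_comp ms); apply: measurable_funD => //; exact: measurable_cst.
under eq_integral do rewrite V0_chi mulrC.
rewrite (integral_hitting (lo := fun t : R => - support K_compact K_neq0 (t + pi)))//.
- congr (_ * _)%E; rewrite -(@integral_itv_bndo_bndc _ _ _ _ _).
    by apply: eq_integral => t _; rewrite mulrC opprK.
  apply/measurable_EFinP; apply: measurable_funTS; apply: measurable_funM.
    exact: (measurableT_comp mG (@measurable_linear_line_at R)).
  have [cw _ _] := width_fun_width K_compact K_neq0 r_gt0 K_sub.
  exact: continuous_measurable_fun.
- move=> t; rewrite -subr_ge0 opprK.
  have := width_fun_ge0 t (width_fun_width K_compact K_neq0 r_gt0 K_sub).
  by rewrite /width pmulr_lge0// invr_gt0 mulr_gt0.
- by move=> t; rewrite lerN2; exact: support_le.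
- by move=> t; exact: support_le.
Qed.

End kinematic_formula.

(** * Variances *)

Section variance_lemmas.
Context d (T : measurableType d) (R : realType) (P : probability T R).
Local Open Scope ereal_scope.

Lemma bounded_integrable (f : T -> R) c : measurable_fun setT f ->
  (forall x, `|f x| <= c)%R -> P.-integrable setT (EFin \o f).
Proof.
move=> mf fc; apply: measurable_bounded_integrable => //.
  by rewrite [X in X < _](@probability_setT _ _ _ P) ltry.
exists c; split; first exact: num_real.
by move=> M cM x _; exact: (le_trans (fc x) (ltW cM)).
Qed.

Lemma bounded_Lfun2 (f : T -> R) c : measurable_fun setT f ->
  (forall x, `|f x| <= c)%R -> f \in Lfun P 2%:E.
Proof.
move=> mf fc; apply/andP; split; rewrite inE//=.
rewrite /finite_norm unlock/= poweR_lty//.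
have /integrableP[_] : P.-integrable setT (EFin \o (fun x => f x ^+ 2)%R).
  apply: (@bounded_integrable _ (c ^+ 2)%R); first exact: measurable_funX.
  move=> x; rewrite normrX; apply: lerXn2r; rewrite ?nnegrE//.
  exact: (le_trans (normr_ge0 _) (fc x)).
congr (_ < _); apply: eq_integral => x _ /=.
by rewrite powR_mulrn// normrX.
Qed.

(** Only integrability is assumed because the weighted estimator may have infinite variance; that
    case is trivial, and otherwise the square is expanded around the mean. *)
Lemma second_moment_le (f : T -> R) : P.-integrable setT (EFin \o f) ->
  'E_P[f ^+ 2] <= 'V_P[f] + ((fine 'E_P[f]) ^+ 2)%:E.
Proof.
move=> If; set m := fine _.
have mf : measurable_fun setT f by case/integrableP: If => /measurable_EFinP.
have VE : 'V_P[f] = \int[P]_x ((f x - m) ^+ 2)%:E.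
  by rewrite /variance covariance.unlock -/m expectation.unlock; apply: eq_integral => x _; rewrite expr2.
have [Voo|Vfin] := eqVneq 'V_P[f] +oo; first by rewrite Voo addye// leey.
have IV : P.-integrable setT (EFin \o (fun x => (f x - m) ^+ 2)%R).
  apply/integrableP; split.
    by apply/measurable_EFinP; apply: measurable_funX; apply: measurable_funB.
  rewrite ltey; move: Vfin; rewrite VE; congr (_ != _); apply: eq_integral => x _ /=.
  by rewrite ger0_norm// sqr_ge0.
have IC : P.-integrable setT (EFin \o (fun x => (2 * m) * f x - m ^+ 2)%R).
  have -> : EFin \o (fun x => (2 * m) * f x - m ^+ 2)%R =
     (fun x => (2 * m)%:E * (EFin \o f) x) \- (EFin \o cst (m ^+ 2)%R).
    by apply/funext => x /=.
  apply: integrableB => //; first exact: integrableZl.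
  exact: finite_measure_integrable_cst.
have fm : (\int[P]_x (f x)%:E) = m%:E.
  by rewrite /m unlock fineK//; apply: integrable_fin_num.
rewrite [X in X <= _](_ : _ = \int[P]_x (((f x - m) ^+ 2)%:E + ((2 * m) * f x - m ^+ 2)%:E)); last first.
  rewrite unlock; apply: eq_integral => x _ /=; rewrite -EFinD; congr EFin.
  have -> : ((f ^+ 2) x = f x ^+ 2)%R by rewrite !expr2.
  by ring.
rewrite [X in X <= _](@integralD _ _ _ P setT measurableT _ _ IV IC) VE leeD2l//.
rewrite [X in X <= _](_ : _ = \int[P]_x ((2 * m)%:E * (f x)%:E - (m ^+ 2)%:E)); last first.
  by apply: eq_integral => x _ /=.
rewrite integralB//; last 2 first.
- exact: integrableZl.
- exact: finite_measure_integrable_cst.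
rewrite integralZl// fm [X in _ - X](@integral_cst _ _ _ P setT measurableT).
rewrite [X in _ - _ * X](@probability_setT _ _ _ P) mule1 -EFinM -EFinB lee_fin.
by have -> : (2 * m * m - m ^+ 2 = m ^+ 2)%R by ring.
Qed.

Lemma variance_mean3 (X : 'I_3 -> T -> R) v :
  (forall k, X k \in Lfun P 2%:E) ->
  (forall k, 'V_P[X k] = v%:E) ->
  (forall k l, k != l -> covariance P (X k) (X l) = 0) ->
  'V_P[(fun w => 3^-1 * \sum_(k < 3) X k w)%R] = (3^-1 * v)%:E.
Proof.
move=> X2 Vv Cov.
pose i0 : 'I_3 := inord 0; pose i1 : 'I_3 := inord 1; pose i2 : 'I_3 := inord 2.
have -> : (fun w => 3^-1 * \sum_(k < 3) X k w)%R =
    ((3^-1)%R \o* (X i0 \+ (X i1 \+ X i2)))%R.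
  apply/funext => w /=; rewrite mulrC !big_ord_recl big_ord0 addr0.
  by congr ((X _ w + (X _ w + X _ w)) * _)%R; apply/val_inj; rewrite /= inordK.
have ne (a b : nat) : (a < 3)%N -> (b < 3)%N -> a != b -> (inord a : 'I_3) != inord b.
  by move=> a3 b3; apply: contra => /eqP/(congr1 (@nat_of_ord _)); rewrite !inordK// => ->.
have Pfin : P setT \is a fin_num := fin_num_measure P _ measurableT.
have X1 k := Lfun_subset12 Pfin (X2 k).
have X12 : (X i1 \+ X i2)%R \in Lfun P 2%:E by rewrite rpredD ?lee1n//=.
have X012 : (X i0 \+ (X i1 \+ X i2))%R \in Lfun P 2%:E by rewrite rpredD ?lee1n//=.
rewrite varianceZ//.
rewrite varianceD// varianceD//.
have C01 := Cov _ _ (ne 0%N 1%N isT isT isT); have C02 := Cov _ _ (ne 0%N 2%N isT isT isT).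
have C12 := Cov _ _ (ne 1%N 2%N isT isT isT).
rewrite covarianceDr ?Lfun2_mul_Lfun1// !Vv C01 C02 C12.
rewrite adde0 !mule0 !adde0 -!EFinD -EFinM; congr EFin.
by field.
Qed.

(** The product rule on rectangles identifies the joint law with the product of the two laws, and
    Fubini factors the mean of the product; boundedness supplies the integrability. *)
Lemma covariance_independent d' (S : measurableType d')
    (U V : {mfun T >-> S}) (f : S -> R) (c : R) :
  (forall A B, measurable A -> measurable B ->
    P (U @^-1` A `&` V @^-1` B) = P (U @^-1` A) * P (V @^-1` B)) ->
  measurable_fun setT f -> (forall x, `|f x| <= c)%R ->
  covariance P (f \o U) (f \o V) = 0.
Proof.
move=> ind mf fc.
have Lf (W : {mfun T >-> S}) : f \o W \in Lfun P 2%:E.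
  apply: (@bounded_Lfun2 _ c); last by move=> x; exact: fc.
  exact: (measurableT_comp mf (measurable_funPT W)).
have Pfin : P setT \is a fin_num := fin_num_measure P _ measurableT.
have L1 (W : {mfun T >-> S}) := Lfun_subset12 Pfin (Lf W).
rewrite covarianceE ?Lfun2_mul_Lfun1//.
have EW (W : {mfun T >-> S}) : 'E_P[f \o W] = \int[distribution P W]_x (f x)%:E.
  rewrite unlock integral_distribution//.
    exact/measurable_EFinP.
  by have /Lfun1_integrable := L1 W.
pose UV (w : T) : S * S := (U w, V w).
have mUV : measurable_fun setT UV by exact: measurable_fun_pair.
pose UV' : {mfun T >-> (S * S)%type} := HB.pack UV (isMeasurableFun.Build _ _ _ _ UV mUV).
pose F (p : S * S) : \bar R := (f p.1 * f p.2)%:E.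
have mF : measurable_fun setT F.
  apply/measurable_EFinP; apply: measurable_funM.
    exact: (measurableT_comp mf measurable_fst).
  exact: (measurableT_comp mf measurable_snd).
have IF : (distribution P U \x distribution P V).-integrable setT F.
  apply: measurable_bounded_integrable => //.
  - by rewrite [X in X < _](@probability_setT _ _ _ (distribution P U \x distribution P V)) ltry.
  - exact/measurable_EFinP.
  exists (c * c)%R; split; first exact: num_real.
  move=> M cM x _; apply: le_trans (ltW cM); rewrite normrM.
  by apply: ler_pM => //; exact: fc.
have UVE : 'E_P[(f \o U) * (f \o V)] = \int[distribution P UV']_x F x.
  rewrite unlock integral_distribution//.
  by have /Lfun1_integrable := Lfun2_mul_Lfun1 (Lf U) (Lf V).
rewrite UVE.
have -> : \int[distribution P UV']_x F x =
    \int[distribution P U \x distribution P V]_x F x.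
  by apply: eq_measure_integral => A mA _; apply/esym; apply: product_measure_unique.
have If (W : {mfun T >-> S}) : (distribution P W).-integrable setT (EFin \o f).
  apply: measurable_bounded_integrable => //.
    by rewrite [X in X < _](@probability_setT _ _ _ (distribution P W)) ltry.
  exists c; split; first exact: num_real.
  by move=> M cM x _; exact: (le_trans (fc x) (ltW cM)).
have mE (W : {mfun T >-> S}) :
    \int[distribution P W]_x (f x)%:E = (fine 'E_P[f \o W])%:E.
  by rewrite -EW fineK//; apply: expectation_fin_num.
have -> : \int[distribution P U \x distribution P V]_x F x =
    (fine 'E_P[f \o U] * fine 'E_P[f \o V])%:E.
  rewrite -integral12_prod_meas1//= /fubini_F/=.
  transitivity (\int[distribution P U]_x ((f x)%:E * (fine 'E_P[f \o V])%:E)).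
    apply: eq_integral => x _; rewrite /fubini_F /F/=; under eq_integral do rewrite EFinM.
    by rewrite integralZl; [rewrite mE|exact: measurableT|exact: If].
  by rewrite integralZr; [rewrite mE|exact: measurableT|exact: If].
rewrite EFinM !fineK; [|exact: expectation_fin_num|exact: expectation_fin_num].
by rewrite subee// fin_numM//; exact: expectation_fin_num.
Qed.

End variance_lemmas.

(** * Moments of weighted lines *)

Section coefficients.
Context {R : realType}.
Implicit Types (i j : 'I_2) (t : R).

(** Double-angle formulas: cos^2 t - 1/3 and sin^2 t - 1/3 are 1/6 plus or minus cos (2t) / 2, which
    gives eta = 0 and pi/2. The product cos t sin t is sin (2t) / 2, that is eta = pi/4. *)
Lemma g_ij_at i j : exists d eta : R, (d = 0 \/ d = 1 / 6) /\
  forall t, g_ij (linear_line_at t) i j = 3 / 8 * (d + 1 / 2 * cos (2 * (t - eta))).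
Proof.
have gE t := @g_ijE R (linear_line_at t) _ i j (sqnorm_unit_dir t) erefl.
have c2 t : cos (2 * t) = cos t ^+ 2 - sin t ^+ 2 by rewrite mulr_natl cos_mulr2n sin2cos2; ring.
have s2 t : sin (2 * t) = 2 * (cos t * sin t) by rewrite mulr_natl sin_mulr2n; ring.
have cs t := cos2Dsin2 t.
have c4 t : cos (2 * (t - pi / 4)) = 2 * (cos t * sin t).
  have -> : 2 * (t - pi / 4) = 2 * t - pi / 2 by lra.
  by rewrite cosB cos_pihalf sin_pihalf mulr0 add0r mulr1 s2.
case: (unliftP ord0 i) gE => [i' ->|->]; case: (unliftP ord0 j) => [j' ->|->] gE;
  rewrite ?(ord1 i') ?(ord1 j') in gE *.
- exists (1 / 6), (pi / 2); split; first by right.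
  move=> t; rewrite gE !mxE /=.
  have -> : 2 * (t - pi / 2) = 2 * t - pi by lra.
  rewrite cosB cospi sinpi mulr0 addr0 mulrN1 c2.
  by have := cs t; move: (cos t) (sin t) => c s cs'; lra.
- exists 0, (pi / 4); split; first by left.
  by move=> t; rewrite gE !mxE /= c4; lra.
- exists 0, (pi / 4); split; first by left.
  by move=> t; rewrite gE !mxE /= c4; lra.
- exists (1 / 6), 0; split; first by right.
  move=> t; rewrite gE !mxE /= subr0 c2.
  by have := cs t; move: (cos t) (sin t) => c s cs'; lra.
Qed.

End coefficients.

Section moments.
Context {R : realType}.
Notation leb := (@lebesgue_measure R).
Implicit Types (E : affine_line R) (L : linear_line R).
Variable mu : {measure set (affine_lines R) -> \bar R}.
Hypothesis mu_invariant : motion_invariant mu.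
Variable r : R.
Hypothesis r_gt0 : 0 < r.
Variable la : probability (affine_lines R) R.
Hypothesis laE : forall B : set (affine_lines R), measurable B ->
  (la B = (2 * r)^-1%:E *
    \int[mu]_(E in B) (\1_(hitting (disc r)) E)%:E)%E.
Variable K : set (plane R).
Hypothesis K_compact : compact K.
Hypothesis K_convex : convex_set K.
Hypothesis K_neq0 : K !=set0.
Hypothesis K_sub : K `<=` disc r.
Variables (i j : 'I_2) (h : R -> R).
Hypothesis ch : continuous h.
Hypothesis h_le1 : forall t, `|h t| <= 1.
Hypothesis gh : forall t, g_ij (linear_line_at t) i j = 3 / 8 * h t.
Local Notation q := (width K_compact K_neq0 r).

Lemma measurable_g : measurable_fun setT ((fun L => g_ij L i j) : linear_lines R -> R).
Proof.
have := measurableT_comp (continuous_measurable_fun ch) (@measurable_angle R).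
move=> mh; have := measurable_funM (measurable_cst (3 / 8 : R)) mh.
congr measurable_fun; apply/funext => L /=.
by have [_ _ {2}->] := angleP L; rewrite gh.
Qed.

Lemma g_ge L : -1 <= g_ij L i j.
Proof.
have [_ _ ->] := angleP L; rewrite gh.
by move: (h_le1 (angle L)); rewrite ler_norml => /andP[a b]; lra.
Qed.

Lemma g_le L : g_ij L i j <= 1.
Proof.
have [_ _ ->] := angleP L; rewrite gh.
by move: (h_le1 (angle L)); rewrite ler_norml => /andP[a b]; lra.
Qed.

Lemma measurable_V0 : measurable_fun setT ((fun E => V0 (K `&` E)) : affine_lines R -> R).
Proof.
have ms := continuous_measurable_fun
  (support_continuous (K_compact := K_compact) (K_neq0 := K_neq0) r_gt0 K_sub).
have mt := @measurable_th R.
have -> : ((fun E => V0 (K `&` E)) : affine_lines R -> R) =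
    (fun E => chi (- support K_compact K_neq0 (th E + pi)) (support K_compact K_neq0 (th E))
    (offset E)).
  by apply/funext => E; rewrite V0_chi.
apply: measurable_chi; last exact: measurable_offset.
  apply: (@measurableT_comp _ _ _ _ _ _ (@GRing.opp R)) => //.
  by apply: (measurableT_comp ms); apply: measurable_funD => //; exact: measurable_cst.
exact: (measurableT_comp ms mt).
Qed.

Lemma V0_sqr (M : set (plane R)) : @V0 R M ^+ 2 = @V0 R M.
Proof. by rewrite /V0; case: `[< _ >]; rewrite ?expr1n ?expr0n. Qed.

Section weighted.
Variable f : linear_lines R -> R.
Hypothesis mf : measurable_fun setT f.
Hypothesis f_ge0 : forall L, 0 <= f L.
Context d' (T' : measurableType d') (P' : probability T' R).
Variable F : {mfun T' >-> affine_lines R}.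
Hypothesis F_weighted : weighted_random_line mu r f P' F.
Local Open Scope ereal_scope.

Let mfp : measurable_fun setT ((fun E => f (parallel E)) : affine_lines R -> R).
Proof. exact: (measurableT_comp mf (@measurable_parallel R)). Qed.

(** The isotropic law serves as reference measure: relative to it a weighted line has density f o
    parallel, and the disc indicator disappears into [la]. *)
Lemma weighted_law (B : set (affine_lines R)) : measurable B ->
  distribution P' F B = \int[la]_(E in B) (f (parallel E))%:E.
Proof.
move=> mB; rewrite /distribution /pushforward/= F_weighted//.
have mhit : measurable_fun setT (\1_(hitting (disc r)) : affine_lines R -> R).
  by apply: measurable_indic; exact: measurable_hitting_disc.
rewrite -ge0_integralZl_EFin//; last 3 first.
- by move=> E _; rewrite lee_fin mulr_ge0.
- apply/measurable_EFinP; apply: measurable_funTS.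
  exact: measurable_funM.
- by rewrite invr_ge0 mulr_ge0// ltW.
rewrite [RHS]integral_mkcond (dlaw_integral r_gt0 laE); last 2 first.
- apply/(measurable_restrictT _ _).1 => //.
  by apply: measurable_funTS; exact/measurable_EFinP.
- by move=> E; rewrite epatch_indic mule_ge0// lee_fin.
rewrite [LHS]integral_mkcond; apply: eq_integral => E _.
rewrite !epatch_indic /dweight -hitting_discE ?(ltW r_gt0)// -!EFinM.
by congr EFin; ring.
Qed.

Lemma weighted_integral (Y : affine_lines R -> R) :
  measurable_fun setT Y -> (forall E, 0 <= Y E)%R ->
  \int[P']_w (Y (F w))%:E = \int[la]_E (Y E * f (parallel E))%:E.
Proof.
move=> mY Y0.
rewrite -(@ge0_integral_distribution _ _ _ _ _ P' F (EFin \o Y))//.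
  by rewrite (ge0_integral_density mfp _ weighted_law)//; exact/measurable_EFinP.
exact/measurable_EFinP.
Qed.

Let Y E : R := (phi_hat r K i j E / f (parallel E))%R.

Let mY : measurable_fun setT (Y : affine_lines R -> R).
Proof.
have mg := measurableT_comp measurable_g (@measurable_parallel R).
apply: measurable_funM; last exact: measurable_fun_ge0_inv.
apply: measurable_funM; last exact: measurable_V0.
by apply: measurable_funM.
Qed.

Lemma weighted_second_moment :
  'E_P'[(Y \o F) ^+ 2] = ((2 * r * (3 / 8)) ^+ 2 / pi)%:E *
    \int[leb]_(t in `[0%R, pi]) (h t ^+ 2 * q t / f (linear_line_at t))%:E.
Proof.
have p0 := pi_gt0 R.
pose G L : R := ((2 * r * g_ij L i j) ^+ 2 / f L)%R.
have mG : measurable_fun setT (G : linear_lines R -> R).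
  apply: measurable_funM; last exact: measurable_fun_ge0_inv.
  by apply: measurable_funX; apply: measurable_funM => //; exact: measurable_g.
have G0 L : (0 <= G L)%R by rewrite mulr_ge0 ?sqr_ge0 ?invr_ge0.
transitivity (\int[P']_w ((fun E => Y E ^+ 2)%R (F w))%:E).
  by rewrite unlock; apply: eq_integral => w _; rewrite !expr2.
rewrite (@weighted_integral (fun E => Y E ^+ 2)%R); last 2 first.
- exact: measurable_funX.
- by move=> E; exact: sqr_ge0.
transitivity (\int[la]_E (G (parallel E) * V0 (K `&` E))%:E).
  apply: eq_integral => E _; congr EFin.
  rewrite /Y /G /phi_hat exprMn exprMn V0_sqr.
  (* Where [f] vanishes both sides are 0 by the convention 0^-1 = 0, so the second moment formula
     holds without excluding zeros. *)
  have [->|f0] := eqVneq (f (parallel E)) 0%R; first by rewrite invr0 !mulr0 mul0r.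
  by field.
rewrite (kinematic_formula mu_invariant r_gt0 laE K_compact K_convex K_neq0 K_sub mG G0).
have [cq _ _] := width_fun_width K_compact K_neq0 r_gt0 K_sub.
have mfl : measurable_fun setT (fun t => f (linear_line_at t)).
  exact: (measurableT_comp mf (@measurable_linear_line_at R)).
rewrite mulrC EFinM -muleA; congr (_ * _).
rewrite -ge0_integralZl_EFin//; last 3 first.
- move=> t _; rewrite lee_fin; apply: mulr_ge0; last by rewrite invr_ge0.
  apply: mulr_ge0; first exact: sqr_ge0.
  exact: (width_fun_ge0 t (width_fun_width K_compact K_neq0 r_gt0 K_sub)).
- apply/measurable_EFinP; apply: measurable_funTS.
  apply: measurable_funM; last exact: measurable_fun_ge0_inv.
  apply: measurable_funM; last exact: continuous_measurable_fun.
  by apply: measurable_funX; exact: continuous_measurable_fun.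
- exact: sqr_ge0.
by apply: eq_integral => t _; rewrite -EFinM /G gh; congr EFin; rewrite !exprMn; ring.
Qed.

Hypothesis f_neq0 : {ae la, forall E, f (parallel E) != 0%R}.

(** The kinematic formula is for nonnegative integrands, whereas [g_ij] changes sign. Since g >= -1,
    adding a >= 1 repairs this, and the estimator is recovered as a combination of two such
    parts. *)
Let part (a : R) : (1 <= a)%R ->
  P'.-integrable setT (EFin \o (fun w => (2 * r * (g_ij (parallel (F w)) i j + a)) * V0 (K `&` F w) / f (parallel (F w)))%R) /\
  \int[P']_w ((2 * r * (g_ij (parallel (F w)) i j + a)) * V0 (K `&` F w) / f (parallel (F w)))%:E =
  (pi^-1 * \int[leb]_(t in `[0%R, pi]) (2 * r * (3 / 8 * h t + a) * q t))%:E.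
Proof.
move=> a1; have p0 := pi_gt0 R.
have [cq _ _] := width_fun_width K_compact K_neq0 r_gt0 K_sub.
pose G (L : linear_lines R) : R := (2 * r * (g_ij L i j + a))%R.
have mG : measurable_fun setT G.
  apply: measurable_funM; first exact: measurable_cst.
  by apply: measurable_funD; [exact: measurable_g|exact: measurable_cst].
have G0 L : (0 <= G L)%R.
  apply: mulr_ge0; first by rewrite mulr_ge0// ltW.
  by have := g_ge L; lra.
pose Z E : R := (G (parallel E) * V0 (K `&` E) / f (parallel E))%R.
have mGp := measurableT_comp mG (@measurable_parallel R).
have mZ : measurable_fun setT (Z : affine_lines R -> R).
  apply: measurable_funM; last exact: measurable_fun_ge0_inv.
  by apply: measurable_funM => //; exact: measurable_V0.
have Z0 E : (0 <= Z E)%R.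
  by rewrite /Z mulr_ge0 ?invr_ge0// mulr_ge0.
have IE : \int[P']_w (Z (F w))%:E =
    (pi^-1 * \int[leb]_(t in `[0%R, pi]) (2 * r * (3 / 8 * h t + a) * q t))%:E.
  rewrite weighted_integral//.
  transitivity (\int[la]_E (G (parallel E) * V0 (K `&` E))%:E).
    apply: ge0_ae_eq_integral => //.
    - by apply/measurable_EFinP; exact: measurable_funM.
    - by apply/measurable_EFinP; apply: measurable_funM => //; exact: measurable_V0.
    - by move=> E _; rewrite lee_fin mulr_ge0.
    - by move=> E _; rewrite lee_fin mulr_ge0.
    (* For the mean the zeros of [f] matter: weight and division cancel only where f <> 0. *)
    - case: f_neq0 => N [mN N0 sub]; exists N; split => // E nE.
      by apply: sub => /= f0; apply: nE => _; rewrite /Z divfK.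
  rewrite (kinematic_formula mu_invariant r_gt0 laE K_compact K_convex K_neq0 K_sub mG G0).
  rewrite EFinM; congr (_ * _).
  rewrite /Rintegral fineK; first by apply: eq_integral => t _; rewrite /G gh.
  apply: integrable_fin_num => //; apply: continuous_integrable.
  move=> t; apply: cvgM; last exact: cq.
  apply: cvgM; first exact: cvg_cst.
  apply: cvgD; last exact: cvg_cst.
  by apply: cvgM; [exact: cvg_cst|exact: ch].
split; last exact: IE.
apply/integrableP; split.
  by apply/measurable_EFinP; exact: (measurableT_comp mZ (measurable_funPT F)).
have -> : \int[P']_w `|(Z (F w))%:E| = \int[P']_w (Z (F w))%:E.
  by apply: eq_integral => w _; rewrite /= ger0_norm.
by rewrite IE ltry.
Qed.

Lemma weighted_mean : P'.-integrable setT (EFin \o (Y \o F)) /\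
  'E_P'[Y \o F] =
  (2 * r * (3 / 8) / pi * \int[leb]_(t in `[0%R, pi]) (h t * q t))%:E.
Proof.
have [cq _ _] := width_fun_width K_compact K_neq0 r_gt0 K_sub.
have [I1 E1] := part (lexx _); have [I2 E2] := part (ler1n R 2 : (1 <= 2)%R).
pose Z a w : R := (2 * r * (g_ij (parallel (F w)) i j + a) * V0 (K `&` F w) / f (parallel (F w)))%R.
(* From g = 2 (g + 1) - (g + 2). *)
have YZ : EFin \o (Y \o F) = (EFin \o (fun w => 2 * Z 1 w - Z 2 w))%R.
  apply/funext => w /=; congr EFin; rewrite /Y /Z /phi_hat.
  by ring.
have I1' : P'.-integrable setT (EFin \o (fun w => 2 * Z 1 w)%R).
  have -> : EFin \o (fun w => 2 * Z 1 w)%R = (fun w => 2%:E * (EFin \o Z 1%R) w) by [].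
  exact: integrableZl.
have IY : P'.-integrable setT (EFin \o (Y \o F)).
  rewrite YZ.
  have -> : EFin \o (fun w => 2 * Z 1 w - Z 2 w)%R =
     (EFin \o (fun w => 2 * Z 1 w)%R) \- (EFin \o Z 2%R) by [].
  exact: integrableB.
split=> //; rewrite unlock.
transitivity (\int[P']_w ((2 * Z 1 w)%:E - (Z 2 w)%:E)).
  by apply: eq_integral => w _; have := congr1 (@^~ w) YZ.
rewrite (integralB measurableT I1' I2).
have RE a : (\int[leb]_(t in `[0, pi]) (2 * r * (3 / 8 * h t + a) * q t) =
    2 * r * (3 / 8) * \int[leb]_(t in `[0, pi]) (h t * q t) +
    2 * r * a * \int[leb]_(t in `[0, pi]) q t)%R.
  have Ihq : leb.-integrable `[0%R, pi] (EFin \o (fun t => h t * q t)%R).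
    by apply: continuous_integrable => t; apply: cvgM; [exact: ch|exact: cq].
  have Iq : leb.-integrable `[0%R, pi] (EFin \o q) by exact: continuous_integrable.
  rewrite -RintegralZl// -[X in _ = (_ + X)%R]RintegralZl// -RintegralD//; last 2 first.
  - exact: (integrableZl _ _ Ihq).
  - exact: (integrableZl _ _ Iq).
  by apply: eq_Rintegral => t _; ring.
transitivity (2%:E * \int[P']_w (Z 1 w)%:E - \int[P']_w (Z 2 w)%:E).
  by congr (_ - _); rewrite -integralZl.
rewrite E1 E2 -EFinM -EFinB !RE; congr EFin.
ring.
Qed.

End weighted.
End moments.

(** * The density in the angular coordinate *)

Section directions.
Context {R : realType}.
Notation leb := (@lebesgue_measure R).
Variable nu : probability (linear_lines R) R.
Hypothesis nu_invariant : rotation_invariant nu.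
Variable f : linear_lines R -> R.
Hypothesis f_density : is_density nu f.
Hypothesis f_neq0 : {ae nu, forall L, f L != 0}.
Local Open Scope ereal_scope.

Let mf : measurable_fun setT f. Proof. by case: f_density. Qed.
Let f_ge0 L : (0 <= f L)%R. Proof. by case: f_density. Qed.

Lemma density_integral : \int[leb]_(t in `[0%R, pi]) (f (linear_line_at t))%:E = pi%:E.
Proof.
have p0 := pi_gt0 R.
have mfl : measurable_fun setT (fun t => (f (linear_line_at t))%:E).
  by apply/measurable_EFinP; exact: (measurableT_comp mf (@measurable_linear_line_at R)).
case: f_density => _ _.
rewrite (ge0_integral_lines (rotation_invariantE nu_invariant)); last 2 first.
- exact/measurable_EFinP.
- by move=> L; rewrite lee_fin.
rewrite -integral_itv_bndo_bndc; last exact: measurable_funTS.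
move=> /(congr1 (fun x => pi%:E * x)).
by rewrite mule1 muleA -EFinM divff ?mul1e// lt0r_neq0.
Qed.

Let Z : set (linear_lines R) := [set L | f L = 0%R].

Let mZ : measurable Z.
Proof.
by have := mf measurableT (measurable_set1 (0%R : R)); rewrite setTI.
Qed.

Let integral_Z : \int[leb]_(t in `[0%R, pi[) (\1_Z (linear_line_at t))%:E = 0.
Proof.
have p0 := pi_gt0 R.
have Z0 : nu Z = 0.
  case: f_neq0 => N [mN N0 sub]; apply: (subset_measure0 mZ mN _ N0).
  by move=> L ZL; apply: sub => /=; rewrite ZL eqxx.
have : \int[nu]_L (\1_Z L)%:E = 0 by rewrite integral_indic// setIT.
rewrite (ge0_integral_lines (rotation_invariantE nu_invariant)); last 2 first.
- by apply/measurable_EFinP; exact: measurable_indic.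
- by move=> L; rewrite lee_fin.
by move=> /eqP; rewrite mule_eq0 eqe invr_eq0 (gt_eqF p0)/= => /eqP.
Qed.

(** The invariant probability is Lebesgue measure in the angle on [0, pi[, up to a factor, so null
    sets of directions carry over; the endpoint pi adds a single point. *)
Lemma ae_density_neq0 :
  {ae leb, forall t, t \in [set` `[0%R, pi]] -> f (linear_line_at t) != 0%R}.
Proof.
have mW : measurable ((fun t => linear_line_at t) @^-1` Z : set R).
  by have := @measurable_linear_line_at R measurableT _ mZ; rewrite setTI.
pose W := (fun t => linear_line_at t) @^-1` Z : set R.
have W0 : leb (W `&` `[0%R, pi[%classic) = 0.
  rewrite -[LHS](integral_indic leb (measurable_itv _) mW) -integral_Z.
  apply: eq_integral => t _; rewrite !indicE.
  suff -> : (t \in W) = (linear_line_at t \in Z) by [].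
  by apply/idP/idP; rewrite !inE.
have mWI : measurable (W `&` `[0%R, pi[%classic) by exact: measurableI.
have : leb.-negligible ((W `&` `[0%R, pi[%classic) `|` [set (pi : R)]).
  apply: negligibleU; first by exists (W `&` `[0%R, pi[%classic); split.
  by exists [set (pi : R)]; split => //; exact: lebesgue_measure_set1.
apply: negligibleS => t /= nt.
have [t0 /eqP ft] : t \in [set` `[0%R, pi]] /\ f (linear_line_at t) == 0%R.
  by move/not_implyP: nt => [a /negP]; rewrite negbK.
move: t0; rewrite inE/= in_itv/= => /andP[t0 tp].
have [->|tn] := eqVneq t pi; first by right.
by left; split => //=; rewrite in_itv/= t0 lt_neqAle tn.
Qed.

Variable mu : {measure set (affine_lines R) -> \bar R}.
Hypothesis mu_invariant : motion_invariant mu.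
Variable r : R.
Hypothesis r_gt0 : (0 < r)%R.
Variable la : probability (affine_lines R) R.
Hypothesis laE : forall B : set (affine_lines R), measurable B ->
  la B = (2 * r)^-1%:E *
    \int[mu]_(E in B) (\1_(hitting (disc r)) E)%:E.

Lemma ae_density_parallel_neq0 :
  {ae la, forall E, f (parallel E) != 0%R}.
Proof.
have mpZ : measurable ((@parallel R : affine_lines R -> linear_lines R) @^-1` Z).
  by have := @measurable_parallel R measurableT _ mZ; rewrite setTI.
exists ((@parallel R : affine_lines R -> linear_lines R) @^-1` Z); split => //.
  transitivity (\int[la]_E (\1_Z (parallel E))%:E).
    rewrite -[X in la X]setIT -[LHS](integral_indic la measurableT mpZ).
    apply: eq_integral => E _; rewrite !indicE.
    suff -> : (E \in (@parallel R : affine_lines R -> linear_lines R) @^-1` Z) = (parallel E \in Z) by [].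
    by apply/idP/idP; rewrite !inE.
  rewrite (@integral_direction _ _ mu_invariant _ r_gt0 _ laE (fun L => (\1_Z L)%:E)).
  - by rewrite integral_Z mule0.
  - by apply/measurable_EFinP; exact: measurable_indic.
  - by move=> L; rewrite lee_fin.
by move=> E /= /negP; rewrite negbK => /eqP.
Qed.

End directions.

Theorem theorem4p11 (R : realType)
  (nu : probability (linear_lines R) R)
  (nu_invariant : rotation_invariant nu)
  (mu : {measure set (affine_lines R) -> \bar R})
  (mu_invariant : motion_invariant mu)
  (mu_normalized : mu (hitting (disc 1)) = 2%:E)
  (K : set (plane R)) (r : R)
  (K_compact : compact K) (K_convex : convex_set K)
  (* for K empty or a single point both variances vanish *)
  (K_nondegenerate : exists x y : plane R, [/\ K x, K y & x != y])
  (r_gt0 : 0 < r) (K_sub : K `<=` disc r)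
  (f : linear_lines R -> R)
  (f_density : is_density nu f)
  (f_neq0 : {ae nu, forall L, f L != 0})
  (d : measure_display) (T : measurableType d) (P : probability T R)
  (E : 'I_3 -> {mfun T >-> affine_lines R})
  (E_IUR : forall k, IUR_line mu r P (E k))
  (E_independent : independent P E)
  (d' : measure_display) (T' : measurableType d') (P' : probability T' R)
  (F : {mfun T' >-> affine_lines R})
  (F_weighted : weighted_random_line mu r f P' F)
  (i j : 'I_2) :
  ('V_P[(fun w => 3^-1 * \sum_(k < 3) phi_hat r K i j (E k w))%R] <
   'V_P'[(fun w => phi_hat r K i j (F w) / f (parallel (F w)))%R])%E.
Proof.
have p0 := pi_gt0 R.
have K_neq0 : K !=set0 by case: K_nondegenerate => x [y [Kx _ _]]; exists x.
have [mf f_ge0 _] := f_density.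
pose q := width K_compact K_neq0 r.
have wq : width_fun q := width_fun_width K_compact K_neq0 r_gt0 K_sub.
have [cq _ _] := wq.
have [dd [eta [ddE gh]]] := @g_ij_at R i j.
pose h t := dd + 1 / 2 * cos (2 * (t - eta)).
have ch : continuous h.
  move=> t; apply: cvgD; first exact: cvg_cst.
  apply: cvgM; first exact: cvg_cst.
  apply: (@continuous_comp _ _ _ (fun u : R => 2 * (u - eta)) (@cos R)).
    apply: cvgM; first exact: cvg_cst.
    by apply: cvgB; [exact: cvg_id|exact: cvg_cst].
  exact: continuous_cos.
have h_le1 t : `|h t| <= 1.
  have := cos_geN1 (2 * (t - eta)); have := cos_le1 (2 * (t - eta)).
  rewrite /h ler_norml; move: (cos _) => c c1 c2.
  by apply/andP; case: ddE => ->; split; lra.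
(* The law of one isotropic line is the common reference probability, used for the three lines and
   for the weighted line. *)
pose la : probability (affine_lines R) R := distribution P (E ord0).
have laE (B : set (affine_lines R)) : measurable B -> (la B = (2 * r)^-1%:E *
    \int[mu]_(E in B) (\1_(hitting (disc r)) E)%:E)%E.
  move=> mB; rewrite [LHS](E_IUR ord0 B mB); congr (_ * _)%E.
  by apply: eq_integral => L _; rewrite mulr1.
pose S := \int[lebesgue_measure]_(t in `[0, pi]) (h t ^+ 2 * q t).
pose m1 := \int[lebesgue_measure]_(t in `[0, pi]) (h t * q t).
(* A real number strictly in between keeps the inequality strict even if the integral on the right
   is infinite. *)
have [B BS BI] : exists2 B, 1 / 3 * S + 2 / 3 / pi * m1 ^+ 2 < B &
    (B%:E <= \int[lebesgue_measure]_(t in `[0%R, pi])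
       (h t ^+ 2 * q t / f (linear_line_at t))%:E)%E.
  apply: (@second_moment_gt R dd eta q (fun t => f (linear_line_at t)) ddE wq).
  - exact: width_le1.
  - exact: width_gt0.
  - exact: measurable_funTS (measurableT_comp mf (@measurable_linear_line_at R)).
  - by move=> t; exact: f_ge0.
  - exact: (density_integral nu_invariant f_density).
  - exact: (ae_density_neq0 nu_invariant f_density f_neq0).
pose c := 2 * r * (3 / 8).
have c0 : 0 < c by rewrite /c !mulr_gt0// divr_gt0.
have fN := ae_density_parallel_neq0 nu_invariant f_density f_neq0 mu_invariant r_gt0 laE.
have [IY EY] := weighted_mean mu_invariant r_gt0 laE K_compact K_convex K_neq0 K_sub
  ch h_le1 gh mf f_ge0 F_weighted fN.
have EY2 := weighted_second_moment mu_invariant r_gt0 laE K_compact K_convex K_neq0 K_sub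
  ch gh mf f_ge0 F_weighted.
pose m := c / pi * m1.
have IS : (\int[lebesgue_measure]_(t in `[0%R, pi]) (h t ^+ 2 * q t / 1)%:E = S%:E)%E.
  rewrite /S /Rintegral fineK; first by apply: eq_integral => t _; rewrite divr1.
  apply: integrable_fin_num => //; apply: continuous_integrable => t.
  by apply: cvgM; [apply: cvgM; exact: ch|exact: cq].
pose X k w := phi_hat r K i j (E k w).
have mX : measurable_fun setT (phi_hat r K i j : affine_lines R -> R).
  apply: measurable_funM; last exact: (measurable_V0 r_gt0 K_compact K_convex K_neq0 K_sub).
  apply: measurable_funM; first exact: measurable_cst.
  exact: (measurableT_comp (measurable_g ch gh) (@measurable_parallel R)).
have X_le L : `|phi_hat r K i j L| <= 2 * r.
  have r2 : 0 <= 2 * r by rewrite mulr_ge0// ltW.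
  rewrite /phi_hat normrM [X in X * _]normrM (ger0_norm r2).
  rewrite -[leRHS]mulr1 -mulrA; apply: ler_wpM2l => //.
  rewrite -[leRHS]mulr1; apply: ler_pM => //.
    by rewrite ler_norml (g_ge h_le1 gh) (g_le h_le1 gh).
  by rewrite /V0; case: `[< _ >]; rewrite ?normr1 ?normr0.
have X2 k : X k \in Lfun P 2%:E.
  apply: (@bounded_Lfun2 _ _ _ _ _ (2 * r)); last by move=> w; exact: X_le.
  exact: (measurableT_comp mX (measurable_funPT (E k))).
(* An isotropic line is the weighted line with f = 1, so the same moment formulas apply. *)
have XV k : ('V_P[X k] = (c ^+ 2 / pi * S - m ^+ 2)%:E)%E.
  have one : measurable_fun setT ((fun=> 1) : linear_lines R -> R) by exact: measurable_cst.
  have one0 (L : linear_line R) : 0 <= (fun=> 1 : R) L by [].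
  have XE : X k = (fun L => phi_hat r K i j L / (fun=> 1) (parallel L)) \o E k.
    by apply/funext => w; rewrite /= divr1.
  have ae1 : {ae la, forall L, (fun=> 1 : R) (parallel L) != 0}.
    by apply: aeW => L; exact: oner_neq0.
  have [_ E1] := weighted_mean mu_invariant r_gt0 laE K_compact K_convex K_neq0 K_sub
    ch h_le1 gh one one0 (E_IUR k) ae1.
  have E2 := weighted_second_moment mu_invariant r_gt0 laE K_compact K_convex K_neq0 K_sub
    ch gh one one0 (E_IUR k).
  rewrite varianceE// XE E1 E2 IS -EFinM; congr (_%:E).
have X0 k l : k != l -> covariance P (X k) (X l) = 0%E.
  move=> kl; apply: (@covariance_independent _ _ _ _ _ _ (E k) (E l) _ (2 * r)) => //.
  (* Pairwise independence is the triple product rule with the whole space in the remaining slot. *)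
  move=> A C mA mC; pose D n := if n == k then A else if n == l then C else setT.
  have Dk : D k = A by rewrite /D eqxx.
  have Dl : D l = C by rewrite /D eq_sym (negbTE kl) eqxx.
  have DT n : n != k -> n != l -> D n = setT.
    by rewrite /D => /negbTE -> /negbTE ->.
  have mD n : measurable (D n) by rewrite /D; case: ifP => // _; case: ifP.
  have -> : E k @^-1` A `&` E l @^-1` C = [set w | forall n, D n (E n w)].
    apply/seteqP; split => w /=.
      move=> [Aw Cw] n; have [->|nk] := eqVneq n k; first by rewrite Dk.
      by have [->|nl] := eqVneq n l; [rewrite Dl|rewrite DT].
    by move=> Dw; have := Dw k; have := Dw l; rewrite Dk Dl.
  rewrite (E_independent D mD) (bigD1 k)//= (bigD1 l) ?[l == k]eq_sym//= Dk Dl.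
  rewrite big1 ?mule1// => n /andP[nk nl].
  by rewrite DT// preimage_setT [LHS](@probability_setT _ _ _ P).
rewrite (variance_mean3 X2 XV X0).
have VY := second_moment_le IY.
rewrite EY /= in VY.
have cE : 0 < c ^+ 2 / pi by rewrite divr_gt0// exprn_gt0.
have {}BI : ((c ^+ 2 / pi * B)%:E <= 'E_P'[(fun w => phi_hat r K i j (F w) / f (parallel (F w)))%R ^+ 2])%E.
  rewrite EFinM [leRHS]EY2; apply: lee_wpmul2l => //.
  by rewrite lee_fin ltW.
(* Both estimators have the same mean [m]. Subtracting the finite m^2 turns the second moment
   inequality into the variance inequality, because E2 / 3 - m^2 / 3 equals (E2 / 3 + 2 m^2 / 3) -
   m^2. *)
have := le_trans BI VY; rewrite -leeBlDr// -EFinB; apply: lt_le_trans.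
rewrite lte_fin /m -/c -/m1.
have -> : 3^-1 * (c ^+ 2 / pi * S - (c / pi * m1) ^+ 2) =
    c ^+ 2 / pi * (1 / 3 * S + 2 / 3 / pi * m1 ^+ 2) - (c / pi * m1) ^+ 2.
  by move: (pi : R) p0 => z z0; field; exact: lt0r_neq0.
by rewrite ltrD2r ltr_pM2l.
Qed.
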